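(* Let $d\in\{1,2,3\}$, let $\mathcal{D}\subset\mathbb{R}^d$ be bounded, let $\nu>0$ be fixed, and for $i=0,1$ let $\alpha_i,\beta_i,\sigma_i^2>0$ and $\boldsymbol\theta_i=\{\alpha_i,\beta_i\}$. Let $\mathcal{P}_i$, $i=0,1$, be the Gaussian probability measure defined by a zero-mean Gaussian process on $\mathcal{D}$ with the CH covariance $C(h;\nu,\alpha_i,\beta_i,\sigma_i^2)$. Let $\mathcal{D}_1\subset\mathcal{D}_2\subset\cdots\subset\mathcal{D}$, where $\mathcal{D}_n=\{\mathbf{s}_1,\dots,\mathbf{s}_n\}$ consists of $n$ distinct observation locations, and let $\mathbf{s}_0\in\mathcal{D}$ be a location that belongs to no $\mathcal{D}_n$ and is a limit point of $\bigcup_n\mathcal{D}_n$. With the predictor $\hat Z_n(\boldsymbol\theta)$ and variances defined in the context, the following hold. (a) For any fixed $\boldsymbol\theta_1$, as $n\to\infty$, $$\frac{\mathrm{Var}_{\nu,\boldsymbol\theta_0,\sigma_0^2}\{\hat Z_n(\boldsymbol\theta_1)-Z(\mathbf{s}_0)\}}{\mathrm{Var}_{\nu,\boldsymbol\theta_0,\sigma_0^2}\{\hat Z_n(\boldsymbol\theta_0)-Z(\mathbf{s}_0)\}}\to1.$$ (b) If moreover $\sigma_0^2\beta_0^{-2\nu}\Gamma(\nu+\alpha_0)/\Gamma(\alpha_0)=\sigma_1^2\beta_1^{-2\nu}\Gamma(\nu+\alpha_1)/\Gamma(\alpha_1)$, then as $n\to\infty$, $$\frac{\mathrm{Var}_{\nu,\boldsymbol\theta_1,\sigma_1^2}\{\hat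 Z_n(\boldsymbol\theta_1)-Z(\mathbf{s}_0)\}}{\mathrm{Var}_{\nu,\boldsymbol\theta_0,\sigma_0^2}\{\hat Z_n(\boldsymbol\theta_1)-Z(\mathbf{s}_0)\}}\to1.$$ (c) Let $\hat\sigma_n^2=\mathbf{Z}_n^\top\mathbf{R}_n^{-1}(\boldsymbol\theta_1)\mathbf{Z}_n/n$. Then, almost surely under $\mathcal{P}_0$, as $n\to\infty$, $$\frac{\mathrm{Var}_{\nu,\boldsymbol\theta_1,\hat\sigma_n^2}\{\hat Z_n(\boldsymbol\theta_1)-Z(\mathbf{s}_0)\}}{\mathrm{Var}_{\nu,\boldsymbol\theta_0,\sigma_0^2}\{\hat Z_n(\boldsymbol\theta_1)-Z(\mathbf{s}_0)\}}\to1.$$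
   Context: The CH covariance function with parameters $\nu,\alpha,\beta,\sigma^2>0$ is $$C(h;\nu,\alpha,\beta,\sigma^2)=\frac{\sigma^2\beta^{2\alpha}\Gamma(\nu+\alpha)}{\Gamma(\nu)\Gamma(\alpha)}\int_0^\infty x^{\nu-1}(x+\beta^2)^{-(\nu+\alpha)}\exp(-\nu h^2/x)\,dx,\quad h\ge0,$$ with correlation function $R(h;\boldsymbol\theta)=C(h;\nu,\alpha,\beta,\sigma^2)/\sigma^2$, $\boldsymbol\theta=\{\alpha,\beta\}$. Put $\mathbf{Z}_n=(Z(\mathbf{s}_1),\dots,Z(\mathbf{s}_n))^\top$, $\mathbf{R}_n(\boldsymbol\theta)=[R(|\mathbf{s}_i-\mathbf{s}_j|;\boldsymbol\theta)]_{i,j\le n}$, $\mathbf{r}_n(\boldsymbol\theta)=[R(|\mathbf{s}_0-\mathbf{s}_i|;\boldsymbol\theta)]_{i\le n}$ (Euclidean norm). The predictor is $\hat Z_n(\boldsymbol\theta)=\mathbf{r}_n^\top(\boldsymbol\theta)\mathbf{R}_n^{-1}(\boldsymbol\theta)\mathbf{Z}_n$. For parameters $(\boldsymbol\theta',\sigma'^2)$, $\mathrm{Var}_{\nu,\boldsymbol\theta',\sigma'^2}\{\hat Z_n(\boldsymbol\theta)-Z(\mathbf{s}_0)\}$ is the variance of the prediction error when $Z$ is mean-zero Gaussian with covariance $C(\cdot;\nu,\boldsymbol\theta',\sigma'^2)$, i.e. $$\sigma'^2\{1-2\mathbf{r}_n^\top(\boldsymbol\theta)\mathbf{R}_n^{-1}(\boldsymbol\theta)\mathbf{r}_n(\boldsymbol\theta')+\mathbf{r}_n^\top(\boldsymbol\theta)\mathbf{R}_n^{-1}(\boldsymbol\theta)\mathbf{R}_n(\boldsymbol\theta')\mathbf{R}_n^{-1}(\boldsymbol\theta)\mathbf{r}_n(\boldsymbol\theta)\};$$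 in (c) this formula is used with $\sigma'^2=\hat\sigma_n^2$ plugged in. *)

(* Defs.v *)
From HB Require Import structures.
From mathcomp Require Import all_boot all_order all_algebra.
From mathcomp Require Import all_classical all_reals all_analysis.
From mathcomp Require Import ring.
Set Implicit Arguments.
Unset Strict Implicit.
Unset Printing Implicit Defensive.
Import Order.TTheory GRing.Theory Num.Theory.
Import numFieldNormedType.Exports.
Local Open Scope classical_set_scope.
Local Open Scope ring_scope.

Definition Gamma (R : realType) (a : R) : R :=
  \int[lebesgue_measure]_(t in `]0, +oo[) (t `^ (a - 1) * expR (- t)).

(* The library's norm on row vectors is the sup norm; distances between
   locations are Euclidean. *)
Definition eucl_dist (R : realType) (d : nat) (x y : 'rV[R]_d) : R :=
  Num.sqrt (\sum_(i < d) (x 0 i - y 0 i) ^+ 2).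

(* The parameter [sigma2] is the variance sigma^2, not its square root. *)
Definition CH_cov (R : realType) (nu alpha beta sigma2 h : R) : R :=
  sigma2 * beta `^ (2 * alpha) * Gamma (nu + alpha) / (Gamma nu * Gamma alpha) *
  \int[lebesgue_measure]_(x in `]0, +oo[)
    (x `^ (nu - 1) * (x + beta ^+ 2) `^ (- (nu + alpha)) *
     expR (- (nu * h ^+ 2 / x))).

Definition CH_corr (R : realType) (nu : R) (theta : R * R) (h : R) : R :=
  CH_cov nu theta.1 theta.2 1 h.

Lemma CH_corrE (R : realType) (nu alpha beta sigma2 h : R) : 0 < sigma2 ->
  CH_corr nu (alpha, beta) h = CH_cov nu alpha beta sigma2 h / sigma2.
Proof.
move=> /lt0r_neq0 sigma2_neq0; apply: (mulIf sigma2_neq0); rewrite divfK//.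
by rewrite /CH_corr /CH_cov /= mul1r mulrC !mulrA.
Qed.

(* Normal law with mean [m] and variance [v >= 0]. The degenerate case is
   separate because [normal_prob m 0] is not the point mass at [m]. *)
Definition normal_law (R : realType) (m v : R) (B : set R) : \bar R :=
  if v == 0 then \d_m B else normal_prob m (Num.sqrt v) B.

(* Only the restriction of the family [Z] to the index set [D] is constrained. *)
Definition gaussian_process (R : realType) (I : Type)
    (disp : measure_display) (Omega : measurableType disp)
    (P : probability Omega R) (D : set I) (Z : I -> {RV P >-> R})
    (mean : I -> R) (cov : I -> I -> R) : Prop :=
  [/\ forall (m : nat) (t : 'I_m -> I) (a : 'I_m -> R), (forall i, D (t i)) ->
        exists mu v : R, 0 <= v /\ forall B : set R, measurable B ->
          P ((fun w => \sum_(i < m) a i * Z (t i) w) @^-1` B) =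
          normal_law mu v B,
      forall t, D t -> expectation P (Z t) = (mean t)%:E &
      forall t u, D t -> D u -> covariance P (Z t) (Z u) = (cov t u)%:E].

(* Observation locations are indexed from 0: the [n] sites used at stage [n]
   are [s 0, ..., s n.-1]. *)
Definition corr_mx (R : realType) (d : nat) (nu : R) (theta : R * R)
    (s : nat -> 'rV[R]_d) (n : nat) : 'M[R]_n :=
  \matrix_(i < n, j < n) CH_corr nu theta (eucl_dist (s i) (s j)).

Definition corr_vec (R : realType) (d : nat) (nu : R) (theta : R * R)
    (s : nat -> 'rV[R]_d) (s0 : 'rV[R]_d) (n : nat) : 'cV[R]_n :=
  \col_(i < n) CH_corr nu theta (eucl_dist s0 (s i)).

Definition predictor (R : realType) (d : nat) (nu : R) (theta : R * R)
    (s : nat -> 'rV[R]_d) (s0 : 'rV[R]_d) (n : nat) (z : 'cV[R]_n) : R :=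
  ((corr_vec nu theta s s0 n)^T *m invmx (corr_mx nu theta s n) *m z) 0 0.

(* Variance of (predictor built with [theta]) - Z(s0) when Z is a mean-zero
   Gaussian process whose covariance has parameters nu, [theta'], [sigma2']. *)
Definition pred_err_var (R : realType) (d : nat) (nu : R)
    (theta' : R * R) (sigma2' : R) (theta : R * R)
    (s : nat -> 'rV[R]_d) (s0 : 'rV[R]_d) (n : nat) : R :=
  let r := corr_vec nu theta s s0 n in
  let r' := corr_vec nu theta' s s0 n in
  let Ri := invmx (corr_mx nu theta s n) in
  let R' := corr_mx nu theta' s n in
  sigma2' * (1 - 2 * (r^T *m Ri *m r') 0 0
               + (r^T *m Ri *m R' *m Ri *m r) 0 0).

Definition sigma2_hat (R : realType) (d : nat) (nu : R) (theta : R * R)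
    (s : nat -> 'rV[R]_d) (n : nat) (z : 'cV[R]_n) : R :=
  (z^T *m invmx (corr_mx nu theta s n) *m z) 0 0 / n%:R.

Lemma mean0_Lfun2 (R : realType) (disp : measure_display)
    (Omega : measurableType disp) (P : probability Omega R)
    (X : {RV P >-> R}) (v : R) :
  expectation P X = 0%E -> covariance P X X = v%:E ->
  (X : Omega -> R) \in Lfun P 2%:E.
Proof.
move=> EX0; rewrite covariance.unlock EX0 /= => VX.
rewrite inE; apply/andP; split; first by rewrite inE /=; exact: measurable_funPT.
rewrite inE /= /finite_norm unlock poweR_lty//.
suff -> : (\int[P]_x (`|X x| `^ 2)%:E = v%:E)%E by exact: ltry.
rewrite -VX expectation.unlock; apply: eq_integral => w _ /=.
by rewrite -[RHS]/(((X w - 0) * (X w - 0))%:E) !subr0 powR_mulrn ?normr_ge0// real_normK ?num_real// expr2.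
Qed.

Lemma covariance_suml (R : realType) (disp : measure_display)
    (Omega : measurableType disp) (P : probability Omega R)
    (n : nat) (c : 'I_n -> R) (X : 'I_n -> Omega -> R) (Y : Omega -> R)
    (k : 'I_n -> R) :
  (forall i, X i \in Lfun P 2%:E) -> Y \in Lfun P 2%:E ->
  (forall i, covariance P (X i) Y = (k i)%:E) ->
  (fun w => \sum_(i < n) c i * X i w) \in Lfun P 2%:E /\
  covariance P (fun w => \sum_(i < n) c i * X i w) Y =
    (\sum_(i < n) c i * k i)%:E.
Proof.
move=> X2 Y2 XY.
have Pfin : P setT \is a fin_num := fin_num_measure P _ measurableT.
have cX i : (fun w => c i * X i w) = (c i \o* X i).
  by apply/funext => w /=; rewrite mulrC.
have c2 i : (fun w => c i * X i w) \in Lfun P 2%:E.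
  by rewrite cX; apply: Lfun_scale => //; rewrite ler1n.
elim: (index_enum _) => [|i r [IH1 IH2]].
  rewrite [X in X \in _](_ : _ = cst 0); last first.
    by apply/funext => w; rewrite big_nil.
  rewrite [X in covariance P X _](_ : _ = cst 0); last first.
    by apply/funext => w; rewrite big_nil.
  by rewrite big_nil covariance_cst_l Lfun_cst.
have -> : (fun w => \sum_(j <- i :: r) c j * X j w) =
  (fun w => c i * X i w) \+ (fun w => \sum_(j <- r) c j * X j w).
  by apply/funext => w; rewrite big_cons.
split; first by rewrite rpredD// lee_fin ler1n.
rewrite covarianceDl// IH2 cX covarianceZl ?XY ?big_cons//; [exact: (Lfun_subset12 Pfin)|exact: (Lfun_subset12 Pfin)|exact: Lfun2_mul_Lfun1].
Qed.

Lemma eucl_dist0 (R : realType) (d : nat) (x : 'rV[R]_d) : eucl_dist x x = 0.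
Proof. by rewrite /eucl_dist big1 ?sqrtr0// => i _; rewrite subrr expr0n. Qed.

Lemma eucl_distC (R : realType) (d : nat) (x y : 'rV[R]_d) : eucl_dist x y = eucl_dist y x.
Proof. by congr Num.sqrt; apply: eq_bigr => i _; rewrite -sqrrN opprB. Qed.

(* The closed form is indeed the variance of the prediction error; the leading
   1 in it is the value at 0 of the correlation function. *)
Lemma pred_err_varE (R : realType) (d : nat) (nu : R) (theta' : R * R)
    (sigma2' : R) (theta : R * R) (disp : measure_display)
    (Omega : measurableType disp) (P : probability Omega R)
    (D : set 'rV[R]_d) (Z : 'rV[R]_d -> {RV P >-> R})
    (s : nat -> 'rV[R]_d) (s0 : 'rV[R]_d) (n : nat) :
  CH_corr nu theta' 0 = 1 ->
  gaussian_process D Z (fun=> 0)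
    (fun t u => CH_cov nu theta'.1 theta'.2 sigma2' (eucl_dist t u)) ->
  (forall i, D (s i)) -> D s0 ->
  variance P (fun w => predictor nu theta s s0 (\col_(i < n) Z (s i) w) - Z s0 w)
    = (pred_err_var nu theta' sigma2' theta s s0 n)%:E.
Proof.
move=> K0 [_ EZ covZ] Ds Ds0.
have covE h : CH_cov nu theta'.1 theta'.2 sigma2' h = sigma2' * CH_corr nu theta' h.
  by rewrite /CH_corr /CH_cov mul1r !mulrA.
have Z2 t : D t -> (Z t : _ -> R) \in Lfun P 2%:E.
  by move=> Dt; apply: mean0_Lfun2 (covZ _ _ Dt Dt); rewrite EZ.
set r := corr_vec nu theta s s0 n; set Ri := invmx (corr_mx nu theta s n).
set c := r^T *m Ri; set r' := corr_vec nu theta' s s0 n.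
set R' := corr_mx nu theta' s n.
pose S w := \sum_(i < n) c 0 i * Z (s i) w.
have -> : (fun w => predictor nu theta s s0 (\col_(i < n) Z (s i) w) - Z s0 w) =
    S \- Z s0.
  by apply/funext => w; congr (_ - _); rewrite /predictor mxE;
    apply: eq_bigr => i _; rewrite [(\col__ _) _ _]mxE.
have cSY (Y : Omega -> R) (k : 'I_n -> R) :=
  covariance_suml (c 0) (X := fun i => Z (s i)) (Y := Y) (k := k)
  (fun i => Z2 _ (Ds i)).
have [S2 cS0] := cSY _ (fun i => sigma2' * r' i 0) (Z2 _ Ds0)
  ltac:(by move=> i; rewrite covZ// covE /r' mxE eucl_distC).
have cSj (j : 'I_n) : covariance P (Z (s j)) S = (\sum_(i < n) c 0 i * (sigma2' * R' i j))%:E.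
  rewrite covarianceC; apply: (proj2 (cSY _ _ (Z2 _ (Ds j)) _)) => i.
  by rewrite covZ// covE /R' mxE.
have [_ cSS] := cSY _ _ S2 cSj.
have Z0 := Z2 _ Ds0.
rewrite /variance covarianceBl ?rpredB ?lee_fin ?ler1n// !covarianceBr//.
rewrite (covarianceC P (Z s0) S) cS0 cSS covZ// covE eucl_dist0 K0 mulr1 -!EFinB; congr EFin.
rewrite /pred_err_var -/r -/r' -/Ri -/R' -/c.
have Rs : Ri^T = Ri.
  rewrite /Ri trmx_inv; congr invmx; apply/matrixP => i j.
  by rewrite !mxE eucl_distC.
have cT : Ri *m r = c^T by rewrite /c trmx_mul trmxK Rs.
rewrite -(mulmxA _ Ri r) cT.
have -> : \sum_(i < n) c 0 i * (sigma2' * r' i 0) = sigma2' * (c *m r') 0 0.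
  by rewrite mxE mulr_sumr; apply: eq_bigr => i _; rewrite mulrCA.
have -> : \sum_(j < n) c 0 j * (\sum_(i < n) c 0 i * (sigma2' * R' i j)) =
    sigma2' * (c *m R' *m c^T) 0 0.
  rewrite mxE mulr_sumr; apply: eq_bigr => j _; rewrite [c^T _ _]mxE [(c *m R') _ _]mxE.
  rewrite mulr_suml !mulr_sumr; apply: eq_bigr => i _.
  ring.
set a := (c *m r') 0 0; set b := (c *m R' *m c^T) 0 0.
ring.
Qed.

(* Main.v *)
(* The CH covariance is a mixture [\int w(x) exp (- nu h^2 / x) dx] of Gaussian
   kernels, and the matching condition of (b) says that the mixing densities of
   the two models are equivalent as [x -> 0].

   For coefficients [c] at sites [t], write [G x] for the Gaussian quadratic
   form at scale [x] and [Q] for the CH one, so that [Q = \int w(x) G x dx].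
   Smoothing a compactly supported extension of a monomial by the heat flow and
   applying the fundamental theorem of calculus in [x] bounds every moment
   [\sum_a c_a t_a^m] by [C A^|m| sqrt Q]. For [x] away from [0], [G x] is a
   convergent series of products of moments. Hence the quadratic forms of the
   two models dominate each other, and their suitably normalized ratio tends to
   [1] along any sequence whose moments are negligible with respect to [sqrt Q].

   Moments are bounded linear functionals on the Hilbert space spanned by the
   process, so by Bessel's inequality they are negligible along the innovations
   and, as [s0] is a limit of sites, along the prediction errors. This gives (b),
   and with the minimality of the best linear predictor (a). For (c),
   [n * sigma2_hat] is the sum of the squared normalized innovations, whose means
   converge by the same comparison; domination bounds its variance by [O(n)], so
   a strong law along [n = m^2] and monotonicity conclude. *)
Require Import Defs.
From HB Require Import structures.
From mathcomp Require Import all_boot all_order all_algebra.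
From mathcomp Require Import all_classical all_reals all_analysis.
From mathcomp Require Import measurable_realfun ring lra zify.
Set Implicit Arguments.
Unset Strict Implicit.
Unset Printing Implicit Defensive.
Import Order.TTheory GRing.Theory Num.Theory.
Import numFieldNormedType.Exports.
Local Open Scope classical_set_scope.
Local Open Scope ring_scope.

(** Near [x = 0] the two rescaled densities agree up to a small factor; away from [0] the Gaussian
    kernel is so smooth that, up to an error small relative to [Q], its form depends on finitely
    many moments only. So the two normalized forms differ by something small once finitely many
    bounded functionals are small, and everything rests on the boundedness of moments. No Fourier
    transform is used for it. The heat flow at a time proportional to [x] averages against the very
    Gaussian kernel of scale [x], so a sum of smoothed values costs only [x^(-d/2) sqrt (G x)].
    Returning to [x = 0] by a Taylor sum in [x] gains a factor [x^K]; taking [2 K - d >= nu - 1]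
    brings [x^(2 K - d) G x] below the integrand [x^(nu - 1) G x] on []0, 1]]. Bounds geometric in
    the degree suffice afterwards, because the term of order [p] in the expansion of [G x] involves
    moments of total degree [2 p] and is divided by [p!]. Square roots of integrals are avoided:
    estimates are kept in the form [th * I + th^-1] with [th] free, and optimized once at the
    end. *)

Section Derive1.
Variable R : realType.
Implicit Types (f g : R -> R) (x df dg : R).

Lemma is_derive1D f g x df dg : is_derive x 1 f df -> is_derive x 1 g dg ->
  is_derive x 1 (fun y => f y + g y) (df + dg).
Proof. by move=> hf hg; exact: is_deriveD. Qed.

Lemma is_derive1M f g x df dg : is_derive x 1 f df -> is_derive x 1 g dg ->
  is_derive x 1 (fun y => f y * g y) (df * g x + f x * dg).
Proof.
move=> hf hg; have := is_deriveM hf hg.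
by rewrite /GRing.scale/= addrC [g x * _]mulrC.
Qed.

Lemma is_derive1Z f x df (a : R) : is_derive x 1 f df ->
  is_derive x 1 (fun y => a * f y) (a * df).
Proof.
move=> hf; have := is_derive1M (is_derive_cst a x 1) hf.
by rewrite mul0r add0r.
Qed.

Lemma is_derive1N f x df : is_derive x 1 f df ->
  is_derive x 1 (fun y => - f y) (- df).
Proof. by move=> hf; exact: is_deriveN. Qed.

Lemma is_derive1X f x df (n : nat) : is_derive x 1 f df ->
  is_derive x 1 (fun y => f y ^+ n) (n%:R * f x ^+ n.-1 * df).
Proof.
move=> hf; have := is_deriveX n hf.
rewrite /GRing.scale/= => h.
rewrite (_ : (fun y => f y ^+ n) = f ^+ n)//; apply/funext => y.
by rewrite exprfctE.
Qed.

Lemma is_derive1_sum (I : Type) (s : seq I) (F : I -> R -> R) (dF : I -> R) x :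
  (forall i, is_derive x 1 (F i) (dF i)) ->
  is_derive x 1 (fun y => \sum_(i <- s) F i y) (\sum_(i <- s) dF i).
Proof.
move=> dFi; elim: s => [|i s IH].
  by rewrite big_nil; under eq_fun do rewrite big_nil; exact: is_derive_cst.
rewrite big_cons; under eq_fun do rewrite big_cons.
exact: is_derive1D.
Qed.

Lemma is_derive1_eq f x df df' : is_derive x 1 f df -> df = df' ->
  is_derive x 1 f df'.
Proof. by move=> ? <-. Qed.

Lemma is_derive1_shift (a x : R) : is_derive x 1 (fun y : R => y + a) 1.
Proof.
apply: (is_derive1_eq (is_derive1D (is_derive_id x 1) (is_derive_cst a x 1))).
by rewrite addr0.
Qed.

Lemma is_derive1_comp_shift f (a x df : R) : is_derive (x + a) 1 f df ->
  is_derive x 1 (fun y => f (y + a)) df.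
Proof.
move=> hf; have := @is_derive1_comp R f (fun y => y + a) x _ _ hf (is_derive1_shift a x).
by rewrite mulr1.
Qed.

End Derive1.

(** * One-variable analysis: Taylor sums, the fundamental theorem, finite sums and products *)

Lemma is_derive_expN_fact (R : realType) (j : nat) (x : R) :
  is_derive x 1 (fun y : R => (- y) ^+ j.+1 / (j.+1)`!%:R)
    (- ((- x) ^+ j / j`!%:R)).
Proof.
have h := is_derive1M (is_derive1X j.+1 (is_derive1N (is_derive_id x 1)))
  (is_derive_cst ((j.+1)`!%:R^-1 : R) x 1).
apply: (is_derive1_eq h).
rewrite mulr0 addr0 /cst factS natrM invfM /GRing.scale/=.
have : (j`!)%:R != 0 :> R by rewrite pnatr_eq0 -lt0n fact_gt0.
have : j.+1%:R != 0 :> R by rewrite pnatr_eq0.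
by move=> a b; field; rewrite b nat1r a.
Qed.

(* The sum telescopes: its derivative only sees the last function of the chain. *)
Lemma is_derive_taylor_chain (R : realType) (V : nat -> R -> R) (K : nat) (x : R) :
  (forall j, (j <= K)%N -> is_derive x (1 : R) (V j) (V j.+1 x)) ->
  is_derive x 1 (fun y : R => \sum_(j < K.+1) (- y) ^+ j / j`!%:R * V j y)
    ((- x) ^+ K / K`!%:R * V K.+1 x).
Proof.
elim: K => [|K IH] dV.
  under eq_fun do rewrite big_ord1 expr0 divr1 mul1r.
  by rewrite expr0 divr1 mul1r; exact: dV.
under eq_fun do rewrite big_ord_recr/=.
have {}IH := IH (fun j jK => dV j (leqW jK)).
have h := is_derive1D IH (is_derive1M (is_derive_expN_fact K x) (dV K.+1 (leqnn _))).
apply: (is_derive1_eq h).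
ring.
Qed.

(** Linearizes a square root: [sqrt h <= th * h + th^-1] can be integrated term by term, and stands
    in for Cauchy-Schwarz under the integral sign. *)
Lemma ler_sqrt_theta (R : realType) (y M h th : R) : 0 <= M -> 0 <= h -> 0 < th ->
  y ^+ 2 <= M ^+ 2 * h -> `|y| <= M * (th * h + th^-1).
Proof.
move=> M0 h0 th0 yh.
have -> : `|y| = Num.sqrt (y ^+ 2) by rewrite sqrtr_sqr.
apply: (@le_trans _ _ (M * Num.sqrt h)).
  rewrite -[X in X * _](ger0_norm M0) -[X in X * _]sqrtr_sqr -sqrtrM ?sqr_ge0//.
  by rewrite ler_sqrt// mulr_ge0// sqr_ge0.
rewrite ler_wpM2l// -{2}(sqr_sqrtr h0).
set s := Num.sqrt h.
rewrite -(ler_pM2l th0) mulrDr mulfV ?gt_eqF//.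
have := sqr_ge0 (th * s - 1).
have := sqr_ge0 (th * s).
rewrite !expr2; nra.
Qed.

Lemma continuous_derivable (R : realType) (f : R -> R) (x df : R) :
  is_derive x (1 : R) f df -> {for x, continuous f}.
Proof.
move=> h; apply: differentiable_continuous; apply/derivable1_diffP.
exact: (@ex_derive _ _ _ _ _ _ _ h).
Qed.

Lemma continuous_at_sum (R : realType) (I : Type) (s : seq I) (F : I -> R -> R) (x : R) :
  (forall i, {for x, continuous (F i)}) ->
  {for x, continuous (fun y => \sum_(i <- s) F i y)}.
Proof.
move=> cF; elim: s => [|i s IH].
  rewrite (_ : (fun _ => _) = cst 0); first exact: cst_continuous.
  by apply/funext => y; rewrite big_nil.
rewrite (_ : (fun _ => _) = (fun y => F i y + \sum_(j <- s) F j y)).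
  by apply: continuousD; [exact: cF|exact: IH].
by apply/funext => y; rewrite big_cons.
Qed.

Lemma continuous_itv_integrable (R : realType) (f : R -> R) (a b : R) :
  (forall x : R, x \in `[a, b] -> {for x, continuous f}) ->
  lebesgue_measure.-integrable `[a, b] (EFin \o f).
Proof.
move=> cf; apply: continuous_compact_integrable; first exact: segment_compact.
apply: continuous_in_subspaceT => x; rewrite inE/= => xab; apply: cf.
by rewrite in_itv.
Qed.

Lemma Rintegral_FTC (R : realType) (f F : R -> R) (a b : R) : a < b ->
  (forall x : R, x \in `[a, b] -> is_derive x (1 : R) F (f x)) ->
  (forall x : R, x \in `[a, b] -> {for x, continuous f}) ->
  \int[lebesgue_measure]_(x in `[a, b]) f x = F b - F a.
Proof.
move=> ab dF cf; rewrite /Rintegral (@continuous_FTC2 _ f F) ?fineB//.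
- apply: continuous_in_subspaceT => x; rewrite inE/= => xab; apply: cf.
  by rewrite in_itv.
- split.
  + move=> x xab; have := dF x (subset_itv_oo_cc xab) => h.
    exact: (@ex_derive _ _ _ _ _ _ _ h).
  + apply: cvg_at_right_filter; apply: (continuous_derivable (df := f a)); apply: dF.
    by rewrite in_itv/= lexx ltW.
  + apply: cvg_at_left_filter; apply: (continuous_derivable (df := f b)); apply: dF.
    by rewrite in_itv/= lexx ltW.
- move=> x xab; rewrite derive1E; have := dF x (subset_itv_oo_cc xab) => h.
  exact: (@derive_val _ _ _ _ _ _ _ h).
Qed.

Lemma Rintegral_itv_cst (R : realType) (a b r : R) : a < b ->
  \int[lebesgue_measure]_(x in `[a, b]) r = r * (b - a).
Proof.
move=> ab.
have h1 (x : R) : x \in `[a, b] -> is_derive x (1 : R) (fun x => r * x) (cst r x).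
  by move=> _; apply: (is_derive1_eq (is_derive1Z r (is_derive_id x 1))); rewrite mulr1.
have h2 (x : R) : x \in `[a, b] -> {for x, continuous (cst r : R -> R)}.
  by move=> _; exact: cst_continuous.
by have := Rintegral_FTC ab h1 h2; rewrite mulrBr => <-.
Qed.

Section Continuity1.
Variable R : realType.
Implicit Types (f g : R -> R) (x : R).

Lemma continuous1D f g x : {for x, continuous f} -> {for x, continuous g} ->
  {for x, continuous (fun y => f y + g y)}.
Proof. by move=> cf cg; exact: continuousD. Qed.

Lemma continuous1M f g x : {for x, continuous f} -> {for x, continuous g} ->
  {for x, continuous (fun y => f y * g y)}.
Proof. by move=> cf cg; exact: continuousM. Qed.

Lemma continuous1_id x : {for x, continuous (fun y : R => y)}.
Proof. exact: cvg_id. Qed.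

Lemma continuous1_cst (a x : R) : {for x, continuous (fun _ : R => a)}.
Proof. exact: cvg_cst. Qed.

End Continuity1.

Lemma cvg_sum_seq (R : realType) (T I : Type) (F : set_system T) {FF : Filter F}
    (s : seq I) (f : I -> T -> R) (l : I -> R) :
  (forall i, f i x @[x --> F] --> l i) ->
  \sum_(i <- s) f i x @[x --> F] --> \sum_(i <- s) l i.
Proof.
move=> fl; elim: s => [|i s IH].
  by rewrite big_nil; under eq_fun do rewrite big_nil; exact: cvg_cst.
by rewrite big_cons; under eq_fun do rewrite big_cons; exact: cvgD.
Qed.

Lemma cvg_prod_seq (R : realType) (T I : Type) (F : set_system T) {FF : Filter F}
    (s : seq I) (f : I -> T -> R) (l : I -> R) :
  (forall i, f i x @[x --> F] --> l i) ->
  \prod_(i <- s) f i x @[x --> F] --> \prod_(i <- s) l i.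
Proof.
move=> fl; elim: s => [|i s IH].
  by rewrite big_nil; under eq_fun do rewrite big_nil; exact: cvg_cst.
by rewrite big_cons; under eq_fun do rewrite big_cons; exact: cvgM.
Qed.

(** [Z] is the Taylor sum at [x] extrapolated to [0], and [Y] multiplies it by a cutoff that
    vanishes at [1], so that [v] is minus the integral of [dY] over []0, 1]]. Both terms of [dY]
    carry a factor [x^K], and [x^K |V j| <= M sqrt (x^(2 K - d) g) <= M sqrt (x^(nu - 1) g)] there.
    The crude bound [b] serves to identify the limit of [Y] at [0]. *)
Lemma chain_bound (R : realType) (K d : nat) (nu M b v I : R) (V : nat -> R -> R)
    (g : R -> R) :
  0 <= M -> nu - 1 <= (2 * K)%:R - d%:R ->
  (forall x : R, 0 < x -> 0 <= g x) ->
  (forall x : R, 0 < x -> {for x, continuous g}) ->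
  (forall (x : R) j, 0 < x -> (j <= K)%N -> is_derive x (1 : R) (V j) (V j.+1 x)) ->
  (forall x : R, 0 < x -> {for x, continuous (V K.+1)}) ->
  (forall (x : R) j, 0 < x <= 1 -> (j <= K.+1)%N -> (V j x) ^+ 2 * x ^+ d <= M ^+ 2 * g x) ->
  (forall (x : R) j, 0 < x <= 1 -> (j <= K.+1)%N -> `|V j x| <= b) ->
  V 0%N x @[x --> 0^'+] --> v ->
  (forall e : R, 0 < e < 1 ->
    \int[lebesgue_measure]_(x in `[e, 1]) (x `^ (nu - 1) * g x) <= I) ->
  forall th, 0 < th -> `|v| <= (K.+2 ^ 2)%:R * M * (th * I + th^-1).
Proof.
move=> M0 nuK g0 cg dV cVK VM Vb V0 HI th th0.
pose Z (x : R) := \sum_(j < K.+1) (- x) ^+ j / j`!%:R * V j x.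
pose dZ (x : R) := (- x) ^+ K / K`!%:R * V K.+1 x.
pose Y (x : R) := (1 - x ^+ K.+1) * Z x.
pose dY (x : R) := - (K.+1%:R * x ^+ K) * Z x + (1 - x ^+ K.+1) * dZ x.
have dZE (x : R) : 0 < x -> is_derive x (1:R) Z (dZ x).
  by move=> x0; apply: is_derive_taylor_chain => j jK; exact: dV.
have dYE (x : R) : 0 < x -> is_derive x (1:R) Y (dY x).
  move=> x0.
  have := is_derive1M (is_derive1D (is_derive_cst (1:R) x 1) (is_derive1N (is_derive1X K.+1 (is_derive_id x 1)))) (dZE _ x0).
  move/is_derive1_eq; apply.
  by rewrite /dY/= add0r mulr1.
have cX n (x : R) : {for x, continuous (fun y : R => y ^+ n)}.
  by move=> ?; exact: exprn_continuous.
have cZ (x : R) : 0 < x -> {for x, continuous Z} by move=> x0; exact: continuous_derivable (dZE _ x0).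
have cdY (x : R) : 0 < x -> {for x, continuous dY}.
  move=> x0; apply: continuousD; apply: continuousM.
  - apply: continuousN; apply: continuousM; [exact: cst_continuous|exact: cX].
  - exact: cZ.
  - by apply: continuousB; [exact: cst_continuous|exact: cX].
  - apply: continuousM; last exact: cVK.
    apply: continuousM; last exact: cst_continuous.
    by apply: continuous_derivable; apply: is_derive1X; apply: is_derive1N; exact: is_derive_id.
pose h x := x `^ (nu - 1) * g x.
have h0 (x : R) : 0 < x -> 0 <= h x by move=> x0; rewrite mulr_ge0 ?powR_ge0// g0.
(* It dominates [(K + 1)^2 + 1]: [Z] has [K + 1] terms, differentiating the cutoff brings out
   [K + 1], and [dZ] adds one. *)
pose C : R := (K.+2 ^ 2)%:R.
have Vh (x : R) j : 0 < x <= 1 -> (j <= K.+1)%N -> `|x ^+ K * V j x| <= M * (th * h x + th^-1).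
  move=> /[dup] x01 /andP[x0 x1] jK; apply: ler_sqrt_theta => //; first exact: h0.
  rewrite exprMn.
  apply: (@le_trans _ _ (x `^ (nu - 1) * (V j x ^+ 2 * x ^+ d))); last first.
    by rewrite /h [leRHS]mulrCA; apply: ler_wpM2l; rewrite ?powR_ge0 ?VM.
  rewrite [leRHS]mulrCA mulrC; apply: ler_wpM2l; first exact: sqr_ge0.
  rewrite -exprM -!powR_mulrn ?(ltW x0)// -powRD; last by rewrite (gt_eqF x0) implybT.
  by apply: ger_powR => //; rewrite mulnC -lerBrDr.
have xj1 (x : R) (j : nat) : 0 < x <= 1 -> `|(- x) ^+ j / j`!%:R| <= 1.
  move=> /andP[x0 x1]; rewrite normf_div normrX normrN (gtr0_norm x0) normr_nat.
  rewrite ler_pdivrMr ?ltr0n ?fact_gt0// mul1r.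
  by rewrite (le_trans (exprn_ile1 _ (ltW x0) x1))// ler1n fact_gt0.
have dYb (x : R) : 0 < x <= 1 -> `|dY x| <= C * (M * (th * h x + th^-1)).
  move=> /[dup] x01 /andP[x0 x1]; set B := M * _.
  have B0 : 0 <= B by exact: le_trans (Vh x 0%N x01 isT).
  have ZB : `|x ^+ K * Z x| <= K.+1%:R * B.
    rewrite /Z mulr_sumr (le_trans (ler_norm_sum _ _ _))//.
    rewrite -[K.+1 in leRHS]card_ord -sum1_card natr_sum mulr_suml.
    apply: ler_sum => j _; rewrite mulrCA normrM.
    apply: ler_pM => //; first exact: xj1.
    by apply: Vh => //; rewrite ltnW// ltnS -ltnS.
  have dZB : `|dZ x| <= B.
    have -> : `|dZ x| = `|x ^+ K * V K.+1 x| / K`!%:R.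
      by rewrite /dZ normrM normf_div normrX normrN normr_nat [in RHS]normrM normrX mulrAC.
    rewrite ler_pdivrMr ?ltr0n ?fact_gt0// (le_trans (Vh x K.+1 x01 (leqnn _)))//.
    by rewrite ler_peMr// ler1n fact_gt0.
  rewrite /dY (le_trans (ler_normD _ _))// mulNr normrN -mulrA normrM normr_nat.
  rewrite [X in _ + X]normrM.
  have x1K : `|1 - x ^+ K.+1| <= 1.
    rewrite ger0_norm ?subr_ge0 ?exprn_ile1 ?(ltW x0)//.
    by rewrite lerBlDr lerDl exprn_ge0// ltW.
  apply: (@le_trans _ _ (K.+1%:R * (K.+1%:R * B) + 1 * B)).
    by rewrite lerD// ?ler_wpM2l// ler_pM.
  rewrite mulrA -mulrDl; apply: ler_wpM2r => //.
  by rewrite -natrM natr1 /C ler_nat -addn1 -mulnn; lia.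
have itvS (e x : R) : 0 < e -> x \in `[e, 1] -> 0 < x <= 1.
  by move=> e0; rewrite in_itv/= => /andP[ex ->]; rewrite (lt_le_trans e0 ex).
have main (e : R) : 0 < e < 1 -> `|Y e| <= C * M * (th * I + th^-1).
  move=> /andP[e0 e1].
  have ch (x : R) : 0 < x -> {for x, continuous h}.
    move=> x0; apply: continuousM; last exact: cg.
    by apply: continuous_derivable; exact: is_derive1_powR.
  have YE : \int[lebesgue_measure]_(x in `[e, 1]) dY x = Y 1 - Y e.
    apply: Rintegral_FTC => // x /(itvS _ _ e0)/andP[x0 _]; [exact: dYE|exact: cdY].
  have Y1 : Y 1 = 0 by rewrite /Y expr1n subrr mul0r.
  have intd : lebesgue_measure.-integrable `[e, 1] (EFin \o dY).
    by apply: continuous_itv_integrable => x /(itvS _ _ e0)/andP[x0 _]; exact: cdY.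
  have inth : lebesgue_measure.-integrable `[e, 1] (EFin \o h).
    by apply: continuous_itv_integrable => x /(itvS _ _ e0)/andP[x0 _]; exact: ch.
  have intB : lebesgue_measure.-integrable `[e, 1]
      (EFin \o (fun x => C * (M * (th * h x + th^-1)))).
    apply: continuous_itv_integrable => x /(itvS _ _ e0)/andP[x0 _].
    apply: continuousM; first exact: cst_continuous.
    apply: continuousM; first exact: cst_continuous.
    apply: continuousD; last exact: cst_continuous.
    by apply: continuousM; [exact: cst_continuous|exact: ch].
  have -> : `|Y e| = `|\int[lebesgue_measure]_(x in `[e, 1]) dY x|.
    by rewrite YE Y1 sub0r normrN.
  apply: (le_trans (le_normr_Rintegral _ intd)) => //.
  apply: (@le_trans _ _ (\int[lebesgue_measure]_(x in `[e, 1])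
      (C * (M * (th * h x + th^-1))))).
    apply: le_Rintegral => //; first exact: integrable_norm.
    by move=> x /(itvS _ _ e0) x01; exact: dYb.
  under eq_Rintegral do rewrite mulrA mulrDr.
  rewrite RintegralD//; last 2 first.
  - apply: continuous_itv_integrable => x /(itvS _ _ e0)/andP[x0 _].
    apply: continuousM; first exact: cst_continuous.
    by apply: continuousM; [exact: cst_continuous|exact: ch].
  - by apply: continuous_itv_integrable => x _; exact: cst_continuous.
  rewrite Rintegral_itv_cst//.
  under eq_Rintegral do rewrite mulrA.
  rewrite RintegralZl// [leRHS]mulrDr -[X in X + _ <= _]mulrA.
  have CM0 : 0 <= C * M by rewrite mulr_ge0// ler0n.
  apply: lerD; first by rewrite !ler_wpM2l ?(ltW th0)// HI// e0.
  by rewrite ler_piMr ?mulr_ge0 ?invr_ge0 ?(ltW th0)// lerBlDr lerDl ltW.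
have Yv : Y x @[x --> 0^'+] --> v.
  (* Since every [V j] is bounded, the Taylor terms with [j >= 1] and the effect of the cutoff are
     both [O(x)]. *)
  have YV : Y x - V 0%N x @[x --> 0^'+] --> (0 : R).
    apply: norm_cvg0; apply: (@squeeze_cvgr _ _ _ _ (cst 0) (fun x => K.+1%:R * (b + b) * x)).
    - near=> x; rewrite normr_ge0/=.
      have x01 : 0 < x <= 1 by apply/andP; split; near: x; [exact: nbhs_right_gt|exact: nbhs_right_le].
      have /andP[x0 x1] := x01.
      have b0 : 0 <= b by apply: le_trans (Vb x 0%N x01 isT).
      have ZB : `|Z x| <= K.+1%:R * b.
        rewrite /Z (le_trans (ler_norm_sum _ _ _))//.
        rewrite -[K.+1 in leRHS]card_ord -sum1_card natr_sum mulr_suml.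
        apply: ler_sum => j _; rewrite normrM.
        apply: ler_pM => //; first exact: xj1.
        by apply: Vb => //; rewrite ltnW// ltnS -ltnS.
      have ZV : `|Z x - V 0%N x| <= K.+1%:R * b * x.
        rewrite /Z big_ord_recl/= expr0 divr1 mul1r addrAC subrr add0r.
        rewrite (le_trans (ler_norm_sum _ _ _))//.
        apply: (@le_trans _ _ (\sum_(i < K) b * x)).
          apply: ler_sum => j _; rewrite /bump/= add1n exprS factS natrM invfM.
          rewrite [(- x) * _]mulrC mulrACA mulrC !normrM mulrA; apply: ler_pM => //.
            rewrite -[leRHS]mulr1 -normrM ler_pM//; first by apply: Vb => //; rewrite ltnS ltnW.
            rewrite normf_div normr_nat normrX normrN (gtr0_norm x0).
            rewrite ler_pdivrMr ?ltr0n// mul1r (le_trans (exprn_ile1 _ (ltW x0) x1))//.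
            by rewrite ler1n.
          rewrite normrN (gtr0_norm x0) ler_piMr ?(ltW x0)// normfV normr_nat.
          by rewrite invf_le1 ?ltr0n ?fact_gt0// ler1n fact_gt0.
        rewrite sumr_const card_ord -[leLHS]mulr_natl -mulrA.
        by apply: ler_pM => //; rewrite ?ler_nat ?mulr_ge0 ?(ltW x0).
      have -> : Y x - V 0%N x = (Z x - V 0%N x) + - (x * (x ^+ K * Z x)).
        by rewrite /Y exprS; ring.
      rewrite (le_trans (ler_normD _ _))// mulrDr mulrDl lerD// normrN normrM gtr0_norm//.
      rewrite mulrC ler_wpM2r ?(ltW x0)// normrM.
      rewrite -[leRHS]mul1r ler_pM// normrX gtr0_norm// exprn_ile1// ltW.
    - exact: cvg_cst.
    - rewrite -[X in _ --> X](mulr0 (K.+1%:R * (b + b))); apply: cvgM; first exact: cvg_cst.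
      by apply: cvg_at_right_filter; exact: cvg_id.
  have -> : Y = (fun x => (Y x - V 0%N x) + V 0%N x).
    by apply/funext => x; rewrite subrK.
  by rewrite -[v]add0r; exact: cvgD.
have Yn : `|Y x| @[x --> 0^'+] --> `|v| by apply: cvg_norm; exact: Yv.
rewrite -(cvg_lim _ Yn)//; apply: limr_le; first by apply: cvgP; exact: Yn.
near=> x; apply: main; apply/andP; split; near: x; [exact: nbhs_right_gt|exact: nbhs_right_lt].
Unshelve. all: by end_near.
Qed.

Lemma Rintegral_by_parts (R : realType) (F G f g : R -> R) (a b : R) : a < b ->
  (forall x : R, is_derive x (1 : R) F (f x)) -> (forall x : R, is_derive x (1 : R) G (g x)) ->
  continuous f -> continuous g ->
  \int[lebesgue_measure]_(x in `[a, b]) (F x * g x) =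
  (F b * G b - F a * G a) - \int[lebesgue_measure]_(x in `[a, b]) (f x * G x).
Proof.
move=> ab dF dG cf cg.
have LR (H h : R -> R) : (forall x : R, is_derive x (1 : R) H (h x)) -> derivable_oo_LRcontinuous H a b.
  move=> dH; split.
  - by move=> x _; have := dH x => hh; exact: (@ex_derive _ _ _ _ _ _ _ hh).
  - by apply: cvg_at_right_filter; exact: (continuous_derivable (dH a)).
  - by apply: cvg_at_left_filter; exact: (continuous_derivable (dH b)).
have DE (H h : R -> R) : (forall x : R, is_derive x (1 : R) H (h x)) -> {in `]a, b[, H^`()%classic =1 h}.
  by move=> dH x _; rewrite derive1E; have := dH x => hh; exact: (@derive_val _ _ _ _ _ _ _ hh).
apply: Rintegration_by_parts => //.
- exact: continuous_subspaceT.
- exact: LR dF.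
- exact: DE.
- exact: continuous_subspaceT.
- exact: LR dG.
- exact: DE.
Qed.

(** * The one-dimensional heat kernel and smoothing by it *)

Section HeatKernel.
Variables (R : realType) (nu : R).
Hypothesis nu_gt0 : 0 < nu.
Implicit Types (x s y L : R) (g : R -> R).

Local Notation mu := lebesgue_measure.

(* [heatk x s y] is [x^(-1/2) exp (- nu (s - y)^2 / x)]: up to the factor
   [sqrt (nu / pi)] the heat kernel at time [x / (4 nu)]. *)
Definition heatk x s y : R := expR (- (ln x / 2) - nu * (s - y) ^+ 2 / x).

Lemma heatk_ge0 x s y : 0 <= heatk x s y. Proof. exact: expR_ge0. Qed.

Lemma is_derive_heatk_time x s y : 0 < x ->
  is_derive x (1 : R) (fun z => heatk z s y)
    (heatk x s y * (nu * (s - y) ^+ 2 / x ^+ 2 - (2 * x)^-1)).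
Proof.
move=> x0.
have d1 : is_derive x (1 : R) (fun z : R => - (2^-1 * ln z) + - ((nu * (s - y) ^+ 2) * z^-1))
    (- (2^-1 * x^-1) + - ((nu * (s - y) ^+ 2) * (- x ^- 2 *: 1))).
  have x_neq0 : x != 0 by rewrite gt_eqF.
  apply: (is_derive1D (is_derive1N (is_derive1Z _ (is_derive1_ln x0)))).
  exact: (is_derive1N (is_derive1Z _ (@is_deriveV _ id x 1 1 x_neq0 (is_derive_id x 1)))).
have d2 := is_derive1_comp (is_derive_expR _) d1.
rewrite (_ : (fun z => heatk z s y) = expR \o (fun z : R => - (2^-1 * ln z) + - ((nu * (s - y) ^+ 2) * z^-1))); last first.
  by apply/funext => z; rewrite /heatk/= mulrC.
apply: (is_derive1_eq d2); rewrite /heatk [2^-1 * _]mulrC /GRing.scale/=; congr (_ * _).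
have x_neq0 : x != 0 by rewrite gt_eqF.
by field.
Qed.

Lemma is_derive_heatk_space x s y : x != 0 ->
  is_derive y (1 : R) (fun z => heatk x s z) (heatk x s y * (2 * nu * (s - y) / x)).
Proof.
move=> x0.
have d0 : is_derive y (1 : R) (fun z : R => (- z + s) ^+ 2) (2%:R * (- y + s) ^+ 1 * (- 1 + 0)).
  exact: (is_derive1X 2 (is_derive1D (is_derive1N (is_derive_id y 1)) (is_derive_cst s y 1))).
have d1 := is_derive1D (is_derive_cst (- (ln x / 2)) y 1) (is_derive1Z (- (nu / x)) d0).
have d2 := is_derive1_comp (is_derive_expR _) d1.
rewrite (_ : (fun z => heatk x s z) = expR \o (fun z : R => cst (- (ln x / 2)) z + - (nu / x) * (- z + s) ^+ 2)); last first.
  apply/funext => z; rewrite /heatk/= /cst; congr expR; congr (_ + _).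
  by field.
apply: (is_derive1_eq d2); rewrite /heatk /cst; congr (_ * _).
  by congr expR; congr (_ + _); field.
by field.
Qed.

(** The heat equation: apart from [4 * nu], the right-hand side is the time derivative found in
    [is_derive_heatk_time]. *)
Lemma is_derive_heatk_space2 x s y : x != 0 ->
  is_derive y (1 : R) (fun z => heatk x s z * (2 * nu * (s - z) / x))
    (4 * nu * (heatk x s y * (nu * (s - y) ^+ 2 / x ^+ 2 - (2 * x)^-1))).
Proof.
move=> x0.
have d0 : is_derive y (1 : R) (fun z : R => (2 * nu / x) * (- z + s)) ((2 * nu / x) * (- 1 + 0)).
  exact: (is_derive1Z _ (is_derive1D (is_derive1N (is_derive_id y 1)) (is_derive_cst s y 1))).
have d1 := is_derive1M (is_derive_heatk_space s y x0) d0.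
rewrite (_ : (fun z => heatk x s z * _) = fun z => heatk x s z * ((2 * nu / x) * (- z + s))); last first.
  by apply/funext => z; congr (_ * _); field.
apply: (is_derive1_eq d1).
rewrite -mulrA -mulrDr [4 * nu * _]mulrCA; congr (_ * _).
by field.
Qed.

Lemma heatk_pdf x s y : 0 < x ->
  Num.sqrt (nu / pi) * heatk x s y = normal_pdf s (Num.sqrt (x / (2 * nu))) y.
Proof.
move=> x0; have s0 : Num.sqrt (x / (2 * nu)) != 0.
  by rewrite gt_eqF// sqrtr_gt0 divr_gt0// mulr_gt0.
rewrite normal_pdfE// /normal_peak /normal_fun sqr_sqrtr; last first.
  by rewrite divr_ge0 ?mulr_ge0 ?ltW.
rewrite /heatk expRD mulrA; congr (_ * _); last first.
  congr expR; rewrite -(opprB y s) sqrrN -mulr_natr mulNr; congr (- _).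
  have x_neq0 : x != 0 by rewrite gt_eqF.
  have nu_neq0 : nu != 0 by rewrite gt_eqF.
  by field; rewrite nu_neq0 x_neq0.
rewrite expRN.
have -> : expR (ln x / 2) = Num.sqrt x.
  by rewrite -powR12_sqrt ?(ltW x0)// /powR gt_eqF// mulrC.
have nu_neq0 : nu != 0 by rewrite gt_eqF.
have -> : x / (2 * nu) * pi *+ 2 = (nu / pi)^-1 * x.
  by rewrite -mulr_natr invf_div; field.
have A : 0 <= nu / pi by rewrite divr_ge0 ?pi_ge0 ?(ltW nu_gt0).
have A' : 0 <= (nu / pi)^-1 by rewrite invr_ge0.
by rewrite [in RHS](sqrtrM _ A') (sqrtrV A) invfM invrK.
Qed.

Lemma integrable_heatk x s : 0 < x ->
  mu.-integrable [set: R] (EFin \o (fun y => Num.sqrt (nu / pi) * heatk x s y)).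
Proof.
move=> x0; have := integrable_normal_pdf s (Num.sqrt (x / (2 * nu))).
by apply: eq_integrable => // y _; rewrite /= heatk_pdf.
Qed.

Lemma Rintegral_heatk x s : 0 < x ->
  \int[mu]_y (Num.sqrt (nu / pi) * heatk x s y) = 1.
Proof.
move=> x0; under eq_Rintegral do rewrite heatk_pdf//.
by rewrite /Rintegral integral_normal_pdf.
Qed.

(** The average runs over a compact interval, outside which the functions to be smoothed vanish;
    differentiation under the integral and integration by parts then need no control at infinity. *)
Definition heat g L x s : R :=
  \int[mu]_(y in `[- L, L]) (g y * (Num.sqrt (nu / pi) * heatk x s y)).

Lemma continuous_heatk x s : x != 0 -> continuous (heatk x s).
Proof. by move=> x0 y; exact: continuous_derivable (is_derive_heatk_space s y x0). Qed.


Lemma heatE g L x s : (forall y, y \notin `[- L, L] -> g y = 0) ->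
  heat g L x s = \int[mu]_y (g y * (Num.sqrt (nu / pi) * heatk x s y)).
Proof.
move=> gL; rewrite /heat Rintegral_mkcond; apply: eq_Rintegral => y _.
rewrite /patch; case: ifPn => // yL; rewrite gL ?mul0r//.
by apply: contraNN yL => yL; rewrite inE.
Qed.

Lemma integrable_heat g (B : R) x s : measurable_fun [set: R] g ->
  (forall y, `|g y| <= B) -> 0 < x ->
  mu.-integrable [set: R] (EFin \o (fun y => g y * (Num.sqrt (nu / pi) * heatk x s y))).
Proof.
move=> mg gB x0.
have := @integrableMr _ _ _ mu _ measurableT g _ mg _ (integrable_heatk s x0).
apply; exists B; split; first exact: num_real.
by move=> z Bz y _ /=; rewrite (le_trans (gB y))// ltW.
Qed.

Lemma heat_le g (B : R) L x s : measurable_fun [set: R] g ->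
  (forall y, y \notin `[- L, L] -> g y = 0) ->
  (forall y, `|g y| <= B) -> 0 < x -> `|heat g L x s| <= B.
Proof.
move=> mg gL gB x0; rewrite heatE//.
have ig := integrable_heat s mg gB x0.
rewrite (le_trans (le_normr_Rintegral _ ig))//.
rewrite -[leRHS]mulr1 -(Rintegral_heatk s x0) -RintegralZl//; last exact: integrable_heatk.
apply: le_Rintegral => //; first exact: integrable_norm.
  by have := integrableZl measurableT B (integrable_heatk s x0); apply: eq_integrable.
move=> y _; rewrite normrM ler_pM// ger0_norm// mulr_ge0 ?heatk_ge0//.
Qed.

(** Doubling the time absorbs the distance: the kernel at [2 x] is the kernel at [x] times
    [exp (a^2) / sqrt 2], and [a <= exp (a^2)]. As the doubled kernel has known mass, the mean
    distance to [s] is [O(sqrt x)] without computing a moment. *)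
Lemma heatk_dist x s y : 0 < x ->
  `|s - y| * heatk x s y <= Num.sqrt (4 * x / nu) * heatk (2 * x) s y.
Proof.
move=> x0; set a := `|s - y| / Num.sqrt (2 * x / nu).
have n0 : 0 < 2 * x / nu by rewrite divr_gt0// mulr_gt0.
have -> : Num.sqrt (4 * x / nu) = Num.sqrt 2 * Num.sqrt (2 * x / nu).
  by rewrite -sqrtrM//; congr Num.sqrt; field; rewrite gt_eqF.
have nu_neq0 : nu != 0 by rewrite gt_eqF.
have x_neq0 : x != 0 by rewrite gt_eqF.
have -> : heatk (2 * x) s y = (Num.sqrt 2)^-1 * (heatk x s y * expR (a ^+ 2)).
  rewrite /heatk lnM ?posrE// mulrDl opprD -addrA expRD expRN; congr (_^-1 * _).
    by rewrite -powR12_sqrt// /powR gt_eqF// mulrC.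
  rewrite -expRD; congr expR; rewrite -addrA; congr (_ + _).
  rewrite /a expr_div_n real_normK ?num_real// sqr_sqrtr ?(ltW n0)//.
  by field; rewrite nu_neq0 x_neq0.
have S20 : Num.sqrt 2 != 0 :> R by rewrite gt_eqF// sqrtr_gt0.
have -> : Num.sqrt 2 * Num.sqrt (2 * x / nu) * ((Num.sqrt 2)^-1 * (heatk x s y * expR (a ^+ 2))) =
    heatk x s y * (Num.sqrt (2 * x / nu) * expR (a ^+ 2)) by field.
rewrite mulrC.
apply: ler_wpM2l; first exact: heatk_ge0.
rewrite -ler_pdivrMl ?sqrtr_gt0// mulrC -/a.
have := expR_ge1Dx (a ^+ 2); have := sqr_ge0 (a - 1); rewrite !expr2; nra.
Qed.

Lemma heat_dist g (B lip : R) L x s : measurable_fun [set: R] g ->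
  (forall y, y \notin `[- L, L] -> g y = 0) ->
  (forall y, `|g y| <= B) -> (forall y z, `|g y - g z| <= lip * `|z - y|) -> 0 < x ->
  `|heat g L x s - g s| <= lip * Num.sqrt (4 * x / nu).
Proof.
move=> mg gL gB glip x0; rewrite heatE//.
have ig := integrable_heat s mg gB x0.
have ik := integrable_heatk s x0.
have lip0 : 0 <= lip.
  by have := le_trans (normr_ge0 _) (glip 0 1); rewrite subr0 normr1 mulr1.
have igs : mu.-integrable [set: R] (EFin \o (fun y => g s * (Num.sqrt (nu / pi) * heatk x s y))).
  by have := integrableZl measurableT (g s) ik; apply: eq_integrable.
rewrite -[X in _ - X]mulr1 -(Rintegral_heatk s x0) -RintegralZl// -RintegralB//.
have x20 : 0 < 2 * x by rewrite mulr_gt0.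
have ikk : mu.-integrable [set: R] (EFin \o (fun y => lip * Num.sqrt (4 * x / nu) * (Num.sqrt (nu / pi) * heatk (2 * x) s y))).
  by have := integrableZl measurableT (lip * Num.sqrt (4 * x / nu)) (integrable_heatk s x20); apply: eq_integrable.
have iB : mu.-integrable [set: R] (EFin \o (fun y => g y * (Num.sqrt (nu / pi) * heatk x s y) - g s * (Num.sqrt (nu / pi) * heatk x s y))).
  by have := integrableB measurableT ig igs; apply: eq_integrable.
rewrite (le_trans (le_normr_Rintegral _ iB))//.
apply: (@le_trans _ _ (\int[mu]_y (lip * Num.sqrt (4 * x / nu) * (Num.sqrt (nu / pi) * heatk (2 * x) s y)))); last first.
  by rewrite RintegralZl ?Rintegral_heatk ?mulr1//; exact: integrable_heatk.
apply: le_Rintegral => //; first exact: integrable_norm.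
move=> y _; rewrite -mulrBl normrM [X in _ * X]ger0_norm ?mulr_ge0 ?heatk_ge0//.
rewrite mulrCA [leRHS]mulrCA; apply: ler_wpM2l => //.
have H : lip * (`|s - y| * heatk x s y) <= lip * (Num.sqrt (4 * x / nu) * heatk (2 * x) s y).
  by rewrite ler_wpM2l// heatk_dist.
apply: (@le_trans _ _ (lip * (`|s - y| * heatk x s y))); last by rewrite -[leRHS]mulrA.
by rewrite mulrA ler_wpM2r ?heatk_ge0.
Qed.

Lemma heat_cvg0 g (B lip : R) L s : measurable_fun [set: R] g ->
  (forall y, y \notin `[- L, L] -> g y = 0) ->
  (forall y, `|g y| <= B) -> (forall y z, `|g y - g z| <= lip * `|z - y|) ->
  heat g L x s @[x --> 0^'+] --> g s.
Proof.
move=> mg gL gB glip.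
have H : heat g L x s - g s @[x --> 0^'+] --> (0 : R).
  apply: norm_cvg0; apply: (@squeeze_cvgr _ _ _ _ (cst 0) (fun x => lip * Num.sqrt (4 * x / nu))).
  - near=> x; rewrite normr_ge0/=.
    have x0 : 0 < x by near: x; exact: nbhs_right_gt.
    exact: (heat_dist s mg gL gB glip x0).
  - exact: cvg_cst.
  - rewrite -[X in _ --> X](mulr0 lip); apply: cvgM; first exact: cvg_cst.
    apply: cvg_at_right_filter.
    have c : {for 0, continuous (fun x : R => Num.sqrt (4 * x / nu))}.
      apply: continuous_comp; last exact: sqrt_continuous.
      apply: continuousM; last exact: cst_continuous.
      exact: mulrl_continuous.
    by move: c; rewrite /prop_for /continuous_at mulr0 mul0r sqrtr0.
rewrite (_ : (fun x => heat g L x s) = fun x => (heat g L x s - g s) + g s); last first.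
  by apply/funext => x; rewrite subrK.
by rewrite -[X in _ --> X]add0r; apply: cvgD => //; exact: cvg_cst.
Unshelve. all: by end_near.
Qed.

(** Differentiating under the integral hits the kernel, the heat equation trades this for two space
    derivatives, and two integrations by parts move them onto [g]; the conditions at [L] and [- L]
    remove the boundary terms. *)
Lemma is_derive_heat g g1 g2 L x s : 0 < L -> 0 < x ->
  (forall y, is_derive y (1 : R) g (g1 y)) ->
  (forall y, is_derive y (1 : R) g1 (g2 y)) ->
  continuous g2 ->
  g L = 0 -> g (- L) = 0 -> g1 L = 0 -> g1 (- L) = 0 ->
  is_derive x (1 : R) (fun z => heat g L z s) ((4 * nu)^-1 * heat g2 L x s).
Proof.
move=> L0 x0 dg dg1 cg2 gL gNL g1L g1NL.
set cN := Num.sqrt (nu / pi).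
have cN0 : 0 <= cN by exact: sqrtr_ge0.
have cg : continuous g by move=> y; exact: continuous_derivable (dg y).
have cg1 : continuous g1 by move=> y; exact: continuous_derivable (dg1 y).
have LL : - L <= L by rewrite ge0_cp// ltW.
have [c cL gc] : exists2 c, c \in `[- L, L] & forall t, t \in `[- L, L] -> `|g t| <= `|g c|.
  apply: (@EVT_max _ (fun y => `|g y|)) => //; apply: continuous_subspaceT => y.
  by apply: continuous_comp; [exact: cg|exact: norm_continuous].
pose kt (z y : R) := heatk z s y * (nu * (s - y) ^+ 2 / z ^+ 2 - (2 * z)^-1).
pose f (z y : R) := g y * (cN * heatk z s y).
have df (z y : R) : 0 < z -> is_derive z (1 : R) (f ^~ y) (g y * (cN * kt z y)).
  by move=> z0; do 2!apply: is_derive1Z; exact: is_derive_heatk_time.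
(* Dominates the time derivative of the integrand for all times in []x / 2, 2 x[]: the negative
   quadratic exponent is dropped and the remaining powers of the time are taken at [x / 2]. *)
pose K := `|g c| * (cN * (expR (- (ln (x / 2) / 2)) * (nu * (`|s| + L) ^+ 2 / (x / 2) ^+ 2 + x^-1))).
have x20 : 0 < x / 2 by rewrite divr_gt0.
have Ix : `](x / 2), (2 * x)[%classic x.
  by rewrite /= in_itv/= ltr_pdivrMr// ltr_pMr// ltr1n/= ltr_pMl// ltr1n.
have Ipos (z : R) : `](x / 2), (2 * x)[%classic z -> (x / 2 < z) /\ 0 < z.
  by rewrite /= in_itv/= => /andP[xz _]; split=> //; exact: lt_trans xz.
have intf (z : R) : `](x / 2), (2 * x)[%classic z -> mu.-integrable `[- L, L] (EFin \o f z).
  move=> /Ipos[_ z0]; apply: continuous_itv_integrable => y _.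
  apply: continuousM; first exact: cg.
  by apply: continuousM; [exact: cst_continuous|apply: continuous_heatk; rewrite gt_eqF].
have derf (z y : R) : `](x / 2), (2 * x)[%classic z -> `[- L, L]%classic y -> derivable (f ^~ y) z 1.
  by move=> /Ipos[_ z0] _; have := df z y z0 => h; exact: (@ex_derive _ _ _ _ _ _ _ h).
have partE (z y : R) : 0 < z -> partial1of2 f z y = g y * (cN * kt z y).
  move=> z0; rewrite /partial1of2 derive1E; have := df z y z0 => h.
  exact: (@derive_val _ _ _ _ _ _ _ h).
have K0 : 0 <= K.
  rewrite /K !mulr_ge0 ?expR_ge0// addr_ge0 ?invr_ge0 ?(ltW x0)//.
  by rewrite divr_ge0 ?sqr_ge0// mulr_ge0 ?sqr_ge0 ?(ltW nu_gt0).
have G_ub (z y : R) : `](x / 2), (2 * x)[%classic z -> `[- L, L]%classic y ->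
    `|partial1of2 f z y| <= cst K y.
  move=> /Ipos[xz z0] /= yL; rewrite partE// /K !normrM (ger0_norm cN0).
  have z_neq0 : z != 0 by rewrite gt_eqF.
  apply: ler_pM; rewrite ?gc ?mulr_ge0//; apply: ler_wpM2l => //.
  apply: ler_pM => //.
    rewrite ger0_norm ?heatk_ge0// ler_expR -[leRHS]subr0 lerB//.
      by rewrite lerN2 ler_pM2r// ler_ln ?posrE// ltW.
    by rewrite divr_ge0 ?(ltW z0)// mulr_ge0 ?sqr_ge0 ?(ltW nu_gt0).
  rewrite (le_trans (ler_normB _ _))// lerD//.
    rewrite ger0_norm; last by rewrite divr_ge0 ?sqr_ge0// mulr_ge0 ?sqr_ge0 ?(ltW nu_gt0).
    apply: ler_pM; [exact: (mulr_ge0 (ltW nu_gt0) (sqr_ge0 _))|by rewrite invr_ge0 sqr_ge0| |].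
      rewrite ler_pM2l// -real_normK ?num_real// lerXn2r ?nnegrE ?addr_ge0 ?(ltW L0)//.
      rewrite (le_trans (ler_normB _ _))// lerD2l ler_norml.
      by move: yL; rewrite in_itv/=.
    by rewrite lef_pV2 ?posrE ?exprn_gt0// lerXn2r ?nnegrE ?ltW.
  rewrite ger0_norm ?invr_ge0 ?mulr_ge0 ?(ltW z0)// lef_pV2 ?posrE ?mulr_gt0//.
  by rewrite mulrC -ler_pdivrMr// ltW.
have intG : mu.-integrable `[- L, L] (EFin \o cst K).
  by apply: continuous_itv_integrable => y _; exact: cst_continuous.
have D := @derivable_under_integral R _ _ mu f `[- L, L]%classic (measurable_itv _) x _ _ Ix intf derf (cst K) (fun=> K0) intG G_ub.
have DE := @differentiation_under_integral R _ _ mu f `[- L, L]%classic (measurable_itv _) x _ _ Ix intf derf (cst K) (fun=> K0) intG G_ub.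
apply: DeriveDef; first exact: D.
rewrite -derive1E DE.
under eq_Rintegral => y _ do rewrite partE//.
have x_neq0 : x != 0 by rewrite gt_eqF.
have ck : continuous (heatk x s) by exact: continuous_heatk.
have cNL : - L < L by rewrite gt0_cp.
pose k1 (y : R) := heatk x s y * (2 * nu * (s - y) / x).
have dk (y : R) : is_derive y (1 : R) (heatk x s) (k1 y) by exact: is_derive_heatk_space.
have dk1 (y : R) : is_derive y (1 : R) k1 (4 * nu * kt x y) by exact: is_derive_heatk_space2.
have ck1 : continuous k1 by move=> y; exact: continuous_derivable (dk1 y).
have cL1 (c0 y : R) : {for y, continuous (fun y : R => c0 * (s - y))}.
  apply: continuousM; first exact: cst_continuous.
  by apply: continuousB; [exact: cst_continuous|exact: cvg_id].
have ckt (y : R) : {for y, continuous (fun y : R => 4 * nu * kt x y)}.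
  apply: continuousM; first exact: cst_continuous.
  apply: continuousM; first exact: ck.
  apply: continuousB; last exact: cst_continuous.
  apply: continuousM; last exact: cst_continuous.
  apply: continuousM; first exact: cst_continuous.
  have -> : (fun y0 : R => (s - y0) ^+ 2) = (fun y0 => (1 * (s - y0)) * (1 * (s - y0))).
    by apply/funext => y0; rewrite mul1r expr2.
  by apply: continuousM; exact: cL1.
have P1 := Rintegral_by_parts cNL dg dk1 cg1 ckt.
have P2 := Rintegral_by_parts cNL dg1 dk cg2 ck1.
rewrite gL gNL !mul0r subrr sub0r P2 g1L g1NL !mul0r subrr sub0r opprK in P1.
have nu4 : 4 * nu != 0 by rewrite gt_eqF// mulr_gt0.
apply: (mulfI nu4); rewrite mulVKf//.
have ikt : mu.-integrable `[- L, L] (EFin \o (fun y => g y * (cN * kt x y))).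
  apply: continuous_itv_integrable => y _.
  rewrite (_ : (fun _ => _) = (fun y => (cN / (4 * nu)) * (g y * (4 * nu * kt x y)))); last first.
    by apply/funext => z; field; rewrite gt_eqF.
  apply: continuousM; first exact: cst_continuous.
  by apply: continuousM; [exact: cg|exact: ckt].
have ig2 : mu.-integrable `[- L, L] (EFin \o (fun y => g2 y * heatk x s y)).
  by apply: continuous_itv_integrable => y _; apply: continuousM; [exact: cg2|exact: ck].
rewrite -RintegralZl//.
under eq_Rintegral => y _ do rewrite mulrCA [4 * nu * _]mulrCA mulrCA.
rewrite RintegralZl//; last first.
  apply: continuous_itv_integrable => y _; apply: continuousM; [exact: cg|exact: ckt].
rewrite P1 -RintegralZl//; apply: eq_Rintegral => y _.
by rewrite mulrCA.
Qed.

End HeatKernel.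

(** * Cutoff functions with finitely many derivatives *)

Section BumpChain.
Variable R : realType.
Local Notation mu := lebesgue_measure.

Lemma antiderivative_exists (f : R -> R) : continuous f ->
  (forall y, y <= 0 -> f y = 0) ->
  exists F : R -> R, (forall x : R, is_derive x (1 : R) F (f x)) /\
    (forall x, x <= 0 -> F x = 0).
Proof.
move=> cf f0; pose F x := \int[mu]_(t in `]-oo, x]) f t; exists F.
have fi (u : R) : mu.-integrable `]-oo, u] (EFin \o f).
  apply/integrable_mkcond => //.
  have i0 : mu.-integrable `[0, u] (EFin \o f).
    by apply: continuous_itv_integrable => x _; exact: cf.
  move/integrable_mkcond : i0 => /(_ (measurable_itv _)); apply: eq_integrable => // x _.
  rewrite !patchE; case: ifPn => xu; case: ifPn => // xu'.
    have := set_mem xu; rewrite /= in_itv/= => /andP[_ xu2].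
    by move/negP: xu'; case; rewrite inE/= in_itv.
  have := set_mem xu'; rewrite /= in_itv/= => xu2.
  rewrite /= f0// leNgt; apply/negP => x0; move/negP: xu; apply.
  by rewrite inE/= in_itv/= (ltW x0).
split=> x.
  have xx1 : x < x + 1 by rewrite ltrDl.
  have [D DE] := continuous_FTC1 xx1 (fi (x + 1)) (ltNyr _) (cf x).
  by apply: DeriveDef; [exact: D|rewrite -derive1E].
move=> x0; rewrite /F (@eq_Rintegral _ _ _ _ _ (cst 0)).
  by rewrite /Rintegral integral0.
by move=> y; rewrite inE/= in_itv/= => yx; rewrite f0// (le_trans yx).
Qed.

(** With [F] a primitive of the previous step, [F y - F (y - 1)] is its average over [[y - 1, y]]:
    again a step, with one more derivative and a transition longer by [1]. The induction starts from
    a ramp. *)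
Lemma step_chain (n : nat) : exists (N M : R) (f : nat -> R -> R),
  [/\ 0 <= N, 0 <= M,
      (forall m (y : R), (m < n)%N -> is_derive y (1 : R) (f m) (f m.+1 y)),
      (forall m, (m <= n)%N -> continuous (f m)) &
      [/\ forall m y, (m <= n)%N -> `|f m y| <= M,
          forall m y, (m <= n)%N -> y <= 0 -> f m y = 0,
          forall y, N <= y -> f 0%N y = 1 &
          forall m y, (0 < m <= n)%N -> N <= y -> f m y = 0]].
Proof.
elim: n => [|n [N [M [f [N0 M0 df cf [fM f0 fN1 fN]]]]]].
  exists 1, 1, (fun _ y => Num.min 1 (Num.max 0 y)); split=> //.
    move=> _ _ y; apply: continuous_min; first exact: cst_continuous.
    by apply: continuous_max; [exact: cst_continuous|exact: cvg_id].
  split.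
  - move=> _ y _; rewrite ger0_norm ?le_min ?ler01 ?le_max ?lexx//.
    by rewrite ge_min lexx.
  - by move=> _ y _ y0; rewrite max_l// min_r.
  - by move=> y y1; rewrite max_r ?(le_trans ler01)// min_l.
  - by move=> [|m].
have [F [dF F0]] := antiderivative_exists (cf 0%N isT) (fun y => f0 0%N y isT).
pose h m (y : R) := if m is m'.+1 then f m' y - f m' (y - 1) else F y - F (y - 1).
have dG (G dG : R -> R) (y : R) : (forall z : R, is_derive z (1 : R) G (dG z)) ->
    is_derive y (1 : R) (fun z => G z - G (z - 1)) (dG y - dG (y - 1)).
  by move=> DG; exact: (is_derive1D (DG y) (is_derive1N (is_derive1_comp_shift (DG (y - 1))))).
have cs (a y : R) (g : R -> R) : continuous g -> {for y, continuous (fun z => g (z + a))}.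
  move=> cg; apply: continuous_comp; last exact: cg.
  exact: continuous_derivable (is_derive1_shift a y).
have FM y : exists c, y - 1 < c /\ F y - F (y - 1) = f 0%N c.
  have y1 : y - 1 < y by rewrite ltrBlDr ltrDl.
  have [|c + ->] := @MVT _ F (f 0%N) _ _ y1 (fun x _ => dF x).
    by apply: continuous_subspaceT => x; exact: continuous_derivable (dF x).
  rewrite in_itv/= => /andP[yc _]; exists c; split => //.
  by rewrite opprB addrCA subrr addr0 mulr1.
exists (N + 1), (M + M), h; split.
- by rewrite addr_ge0.
- by rewrite addr_ge0.
- case=> [|m] y mn /=; first exact: (dG F (f 0%N) y dF).
  exact: (dG (f m) (f m.+1) y (fun z => df m z mn)).
- case=> [_|m mn] y.
    by apply: (continuous_derivable (dG F _ y dF)).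
  exact: (cvgB (cf m mn y) (cs (-1) y _ (cf m mn))).
- split.
  + case=> [|m] y mn /=.
      by have [c [_ ->]] := FM y; rewrite (le_trans (fM _ _ _))// lerDl.
    by rewrite (le_trans (ler_normB _ _))// lerD ?fM.
  + move=> m y mn y0; have y10 : y - 1 <= 0 by rewrite lerBlDr add0r (le_trans y0).
    by case: m mn => [|m] mn /=; rewrite ?F0 ?f0// subrr.
  + move=> y Ny /=; have [c [yc ->]] := FM y; apply: fN1.
    by rewrite ltW// (le_lt_trans _ yc)// lerBrDr.
  + case=> [//|m] y /= mn Ny.
    have Ny1 : N <= y - 1 by rewrite lerBrDr.
    have Ny2 : N <= y by rewrite (le_trans Ny1)// lerBlDr lerDl.
    case: m mn => [|m] mn; first by rewrite !fN1// subrr.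
    by rewrite !fN// subrr.
Qed.

(** The functions [f 1, ..., f n] are the successive derivatives of [f 0], carried along explicitly.
    All of them vanish at [L] and [- L] too, as the integrations by parts require. *)
Definition bump_chain (n : nat) (L M : R) (f : nat -> R -> R) : Prop :=
  [/\ forall m (y : R), (m < n)%N -> is_derive y (1 : R) (f m) (f m.+1 y),
      forall m, (m <= n)%N -> continuous (f m),
      forall m y, (m <= n)%N -> `|f m y| <= M &
      forall m y, (m <= n)%N -> y \notin `]- L, L[ -> f m y = 0].

Lemma bump_chain_exists (n : nat) (rho : R) : 0 <= rho ->
  exists (L M : R) (f : nat -> R -> R),
    [/\ 0 < L, 0 <= M, bump_chain n L M f & forall y, `|y| <= rho -> f 0%N y = 1].
Proof.
move=> rho0; have [N [M [f [N0 M0 df cf [fM f0 fN1 fN]]]]] := step_chain n.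
(* A step rising on the left minus a step rising on the right: for [|y| <= rho] the first has
   already reached [1] and the second is still [0]. *)
pose h m (y : R) := f m (y + (rho + (N + 1))) - f m (y - (rho + 1)).
have cs (a y : R) (g : R -> R) : continuous g -> {for y, continuous (fun z => g (z + a))}.
  move=> cg; apply: continuous_comp; last exact: cg.
  exact: continuous_derivable (is_derive1_shift a y).
exists (rho + (N + 1)), (M + M), h; split.
- by rewrite ltr_wpDl// ltr_wpDl.
- by rewrite addr_ge0.
- split.
  + move=> m y mn.
    have h1 := is_derive1_comp_shift (df m (y + (rho + (N + 1))) mn).
    have h2 := is_derive1_comp_shift (df m (y - (rho + 1)) mn).
    exact: (is_derive1D h1 (is_derive1N h2)).
  + move=> m mn y.
    exact: (cvgB (cs (rho + (N + 1)) y _ (cf m mn)) (cs (- (rho + 1)) y _ (cf m mn))).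
  + by move=> m y mn; rewrite (le_trans (ler_normB _ _))// lerD ?fM.
  + move=> m y mn; rewrite in_itv/= negb_and -!leNgt => /orP[yL|Ly].
      rewrite /h !f0 ?subrr//.
        by rewrite (le_trans (lerD yL (lexx _)))//; lra.
      by rewrite addrC -lerBrDl sub0r.
    rewrite /h; have a1 : N <= y + (rho + (N + 1)) by lra.
    have a2 : N <= y - (rho + 1) by lra.
    case: m mn => [|m] mn; first by rewrite !fN1// subrr.
    by rewrite !fN// subrr.
- move=> y; rewrite ler_norml => /andP[y1 y2].
  rewrite /h fN1; last by lra.
  by rewrite f0 ?subr0//; lra.
Qed.

(** Leibniz's rule; at [m = 0] the meaningless [m.-1] is multiplied by [0]. Each multiplication
    costs a factor [L + n], whence the geometric growth in the degree of the monomial. *)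
Lemma bump_chain_mulX (n : nat) (L M : R) (f : nat -> R -> R) : 0 <= L -> 0 <= M ->
  bump_chain n L M f ->
  bump_chain n L ((L + n%:R) * M) (fun m y => y * f m y + m%:R * f m.-1 y).
Proof.
move=> L0 M0 [df cf fM fL]; split.
- move=> m y mn.
  have h1 := is_derive1M (is_derive_id y 1) (df m y mn).
  case: m mn h1 => [|m] mn h1.
    under [fun y0 => _]eq_fun do rewrite mul0r addr0.
    by apply: (is_derive1_eq h1); rewrite /=; ring.
  have h2 := is_derive1Z m.+1%:R (df m y (ltnW mn)).
  apply: (is_derive1_eq (is_derive1D h1 h2)); rewrite /= -[m.+2%:R]natr1.
  ring.
- move=> m mn; have mn1 : (m.-1 <= n)%N by rewrite (leq_trans (leq_pred _)).
  have c1 (y : R) : {for y, continuous (fun z : R => z * f m z)}.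
    by apply: continuous1M; [exact: continuous1_id|exact: cf].
  have c2 (y : R) : {for y, continuous (fun z : R => m%:R * f m.-1 z)}.
    by apply: continuous1M; [exact: continuous1_cst|exact: cf].
  by move=> y; have := continuous1D (c1 y) (c2 y).
- move=> m y mn.
  have [yL|yL] := boolP (y \in `]- L, L[); last first.
    by rewrite !fL ?mulr0 ?addr0 ?normr0 ?mulr_ge0 ?addr_ge0// (leq_trans (leq_pred _)).
  rewrite (le_trans (ler_normD _ _))// mulrDl !normrM lerD//.
    rewrite ler_pM ?fM// ler_norml.
    by move: yL; rewrite in_itv/= => /andP[/ltW-> /ltW->].
  by rewrite normr_nat ler_pM ?ler_nat ?fM// (leq_trans (leq_pred _)).
- by move=> m y mn yL; rewrite !fL ?mulr0 ?addr0// (leq_trans (leq_pred _)).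
Qed.

Lemma bump_chain_mulXn (n : nat) (L M : R) (f : nat -> R -> R) (k : nat) :
  0 <= L -> 0 <= M -> bump_chain n L M f ->
  exists2 g, bump_chain n L ((L + n%:R) ^+ k * M) g & forall y, g 0%N y = y ^+ k * f 0%N y.
Proof.
move=> L0 M0 bf; elim: k => [|k [g bg gE]].
  by exists f => [|y]; rewrite expr0 mul1r.
eexists.
  rewrite exprS -mulrA; apply: bump_chain_mulX bg => //.
  by rewrite mulr_ge0 ?exprn_ge0 ?addr_ge0.
by move=> y /=; rewrite mul0r addr0 gE mulrA exprS.
Qed.

End BumpChain.

(** * Positivity of Gaussian quadratic forms *)

Section GaussianForm.
Variables (R : realType) (d : nat) (nu : R).
Hypothesis nu_gt0 : 0 < nu.
Implicit Types (t u y : 'rV[R]_d) (x : R).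

Definition sqdist t u : R := \sum_(i < d) (t 0 i - u 0 i) ^+ 2.

Definition gauss x t u : R := expR (- (nu * sqdist t u / x)).

Definition qform (k : 'rV[R]_d -> 'rV[R]_d -> R) (n : nat) (c : 'I_n -> R)
    (t : 'I_n -> 'rV[R]_d) : R :=
  \sum_(i < n) \sum_(j < n) c i * c j * k (t i) (t j).

Lemma sqdistC t u : sqdist t u = sqdist u t.
Proof. by apply: eq_bigr => i _; rewrite -sqrrN opprB. Qed.

Lemma sqdist_ge0 t u : 0 <= sqdist t u.
Proof. by apply: sumr_ge0 => i _; exact: sqr_ge0. Qed.

Lemma sqdist0 t : sqdist t t = 0.
Proof. by rewrite /sqdist big1// => i _; rewrite subrr expr0n. Qed.

(** One factor of the dot product is split over the coordinates and absorbed into the coefficients;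
    for exponent [0] the form is the square of the sum of the coefficients. *)
Lemma qform_dot_exp_ge0 (k n : nat) (c : 'I_n -> R) (t : 'I_n -> 'rV[R]_d) :
  0 <= qform (fun t u => (\sum_(l < d) t 0 l * u 0 l) ^+ k) c t.
Proof.
elim: k c => [|k IH] c.
  rewrite /qform (_ : (\sum_i _) = (\sum_i c i) ^+ 2) ?sqr_ge0//.
  rewrite expr2 mulr_suml; apply: eq_bigr => i _; rewrite mulr_sumr.
  by apply: eq_bigr => j _; rewrite expr0 mulr1.
rewrite /qform (_ : (\sum_i _) = \sum_(l < d) qform (fun t u => (\sum_(l < d) t 0 l * u 0 l) ^+ k) (fun i => c i * t i 0 l) t).
  by apply: sumr_ge0 => l _; exact: IH.
rewrite /qform [RHS]exchange_big; apply: eq_bigr => i _ /=.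
rewrite [RHS]exchange_big/=; apply: eq_bigr => j _.
rewrite exprS mulr_suml mulr_sumr; apply: eq_bigr => l _.
by ring.
Qed.

(** Expanding the squared distance factors the kernel as [e t * e u] times the exponential of a
    positive multiple of the dot product, whose power series has nonnegative coefficients. *)
Lemma qform_gauss_ge0 x (n : nat) (c : 'I_n -> R) (t : 'I_n -> 'rV[R]_d) : 0 < x ->
  0 <= qform (gauss x) c t.
Proof.
move=> x0; pose dot t u := \sum_(l < d) t 0 l * u 0 l.
pose e t := expR (- (nu * dot t t / x)).
have x_neq0 : x != 0 by rewrite gt_eqF.
have gE t1 u : gauss x t1 u = e t1 * e u * expR (2 * nu / x * dot t1 u).
  rewrite /gauss /e -!expRD; congr expR.
  have -> : sqdist t1 u = dot t1 t1 + dot u u - 2 * dot t1 u.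
    rewrite /sqdist /dot mulr_sumr -big_split -sumrB/=.
    by apply: eq_bigr => l _; ring.
  by field.
have cvgE (a : R) : series (exp_coeff a) m @[m --> \oo] --> expR a.
  exact: is_cvg_series_exp_coeff.
have H : (fun m => \sum_(i < n) \sum_(j < n) (c i * c j) * (e (t i) * e (t j) * series (exp_coeff (2 * nu / x * dot (t i) (t j))) m)) @ \oo --> qform (gauss x) c t.
  rewrite /qform; apply: cvg_sum_seq => i; apply: cvg_sum_seq => j; rewrite gE.
  by apply: cvgM; [exact: cvg_cst|apply: cvgM; [exact: cvg_cst|exact: cvgE]].
rewrite -(cvg_lim _ H)//; apply: limr_ge; first by apply: cvgP; exact: H.
near=> m.
rewrite (_ : (\sum_i _) = \sum_(0 <= k < m) (2 * nu / x) ^+ k / k`!%:R * qform (fun t u => (\sum_(l < d) t 0 l * u 0 l) ^+ k) (fun i => c i * e (t i)) t).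
  apply: sumr_ge0 => k _; rewrite mulr_ge0 ?qform_dot_exp_ge0// mulr_ge0 ?invr_ge0//.
  by rewrite exprn_ge0// divr_ge0 ?mulr_ge0 ?ltW.
under [RHS]eq_bigr do rewrite /qform mulr_sumr.
rewrite [RHS]exchange_big; apply: eq_bigr => i _ /=.
under [RHS]eq_bigr do rewrite mulr_sumr.
rewrite [RHS]exchange_big; apply: eq_bigr => j _ /=.
under [RHS]eq_bigr do rewrite -/(dot (t i) (t j)).
set D := dot (t i) (t j); rewrite /series/= mulr_sumr mulr_sumr; apply: eq_bigr => k _.
rewrite exp_coeffE/= exprMn; ring.
Unshelve. all: by end_near.
Qed.

(** Positivity for the configuration enlarged by [y] with coefficient [- l], where [l] is the sum on
    the left: it reads [Q - 2 l^2 + l^2 >= 0]. *)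
Lemma gauss_CauchySchwarz x y (n : nat) (c : 'I_n -> R) (t : 'I_n -> 'rV[R]_d) : 0 < x ->
  (\sum_(i < n) c i * gauss x (t i) y) ^+ 2 <= qform (gauss x) c t.
Proof.
move=> x0; set l := \sum_(i < n) _.
pose c' (i : 'I_n.+1) := oapp c (- l) (unlift ord0 i).
pose t' (i : 'I_n.+1) := oapp t y (unlift ord0 i).
have := qform_gauss_ge0 c' t' x0; rewrite /qform big_ord_recl/= big_ord_recl/=.
rewrite /c' /t' unlift_none/= {1}/gauss sqdist0 mulr0 mul0r oppr0 expR0 mulr1.
under eq_bigr do rewrite liftK/=.
under [X in _ + X]eq_bigr do rewrite big_ord_recl/= unlift_none liftK/=.
rewrite big_split/=.
have -> : \sum_(i < n) - l * c i * gauss x y (t i) = - l * l.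
  rewrite /l mulr_sumr; apply: eq_bigr => i _.
  by rewrite mulrA /gauss sqdistC.
have -> : \sum_(i < n) c i * - l * gauss x (t i) y = - l * l.
  rewrite {2}/l mulr_sumr; apply: eq_bigr => i _.
  by rewrite mulrA [_ * c i]mulrC.
have -> : \sum_(i < n) \sum_(i0 < n) c i * oapp c (- l) (unlift ord0 (lift ord0 i0)) * gauss x (t i) (oapp t y (unlift ord0 (lift ord0 i0))) = qform (gauss x) c t.
  by apply: eq_bigr => i _; apply: eq_bigr => j _; rewrite liftK.
rewrite /qform; nra.
Qed.

End GaussianForm.

(** * Bounding monomial sums by smoothing every coordinate *)

Section MonomialBound.
Variables (R : realType) (d : nat) (nu : R).
Hypothesis nu_gt0 : 0 < nu.
Local Notation mu := lebesgue_measure.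
Local Notation cN := (Num.sqrt (nu / pi)).

Lemma Rintegral_lincomb (n : nat) (w : 'I_n -> R) (f : 'I_n -> R -> R) (a b : R) :
  (forall i (x : R), x \in `[a, b] -> {for x, continuous (f i)}) ->
  \sum_(i < n) w i * \int[mu]_(x in `[a, b]) f i x =
  \int[mu]_(x in `[a, b]) \sum_(i < n) w i * f i x.
Proof.
move=> cf; elim: (index_enum _) => [|i s IH].
  rewrite big_nil; under eq_Rintegral do rewrite big_nil.
  by rewrite /Rintegral integral0.
rewrite big_cons IH; under [RHS]eq_Rintegral do rewrite big_cons.
rewrite RintegralD//.
- by rewrite RintegralZl//; apply: continuous_itv_integrable => x; exact: cf.
- by apply: continuous_itv_integrable => x xab; apply: continuous1M; [exact: continuous1_cst|exact: cf].
- apply: continuous_itv_integrable => x xab; apply: continuous_at_sum => j.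
  by apply: continuous1M; [exact: continuous1_cst|exact: cf].
Qed.

Lemma prod_heatk (x : R) (t y : 'rV[R]_d) : 0 < x ->
  (\prod_(i < d) heatk nu x (t 0 i) (y 0 i)) = expR (- (ln x / 2)) ^+ d * gauss nu x t y.
Proof.
move=> x0; rewrite /heatk.
under eq_bigr do rewrite expRD.
rewrite big_split/= prodr_const card_ord; congr (_ * _).
rewrite /gauss /sqdist -expR_sum; congr expR.
by rewrite mulr_sumr mulr_suml -sumrN; apply: eq_bigr.
Qed.

(* Coordinates are smoothed one after the other: [P r] has the first [r] of them
   integrated out, the others being frozen at [y]. *)
Lemma heat_prod_bound (L x : R) (M : 'I_d -> R) (g : 'I_d -> R -> R) (n : nat)
    (c : 'I_n -> R) (t : 'I_n -> 'rV[R]_d) :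
  0 < L -> 0 < x -> (forall i, continuous (g i)) -> (forall i y, `|g i y| <= M i) ->
  `|\sum_(a < n) c a * \prod_(i < d) heat nu (g i) L x (t a 0 i)| <=
    (\prod_(i < d) (M i * cN * (2 * L))) *
    (expR (- (ln x / 2)) ^+ d * Num.sqrt (qform (gauss nu x) c t)).
Proof.
move=> L0 x0 cg gM.
have M0 i : 0 <= M i by exact: le_trans (normr_ge0 _) (gM i 0).
have cN0 : 0 <= cN by exact: sqrtr_ge0.
set S := expR _ ^+ d * _.
have S0 : 0 <= S by rewrite mulr_ge0 ?sqrtr_ge0// exprn_ge0 ?expR_ge0.
pose B i := M i * cN * (2 * L).
have B0 i : 0 <= B i by rewrite !mulr_ge0// ltW.
pose F r a y (i : 'I_d) := if (i < r)%N then heat nu (g i) L x (t a 0 i) else heatk nu x (t a 0 i) (y i).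
suff P r : (r <= d)%N -> forall y : 'I_d -> R,
    `|\sum_(a < n) c a * \prod_(i < d) F r a y i| <= \prod_(i < d | (i < r)%N) B i * S.
  have := P d (leqnn _) (fun=> 0).
  under [X in _ <= X * _ -> _]eq_bigl do rewrite ltn_ord.
  apply: le_trans; rewrite le_eqVlt; apply/orP; left; apply/eqP.
  congr (`|_|); apply: eq_bigr => a _; congr (_ * _).
  by apply: eq_bigr => i _; rewrite /F ltn_ord.
elim: r => [_ y|r IH rd y].
  rewrite [\prod_(i < d | (i < 0)%N) B i]big_pred0// mul1r /F/=; pose yv : 'rV[R]_d := \row_i y i.
  have -> : \sum_(a < n) c a * \prod_(i < d) heatk nu x (t a 0 i) (y i) =
      expR (- (ln x / 2)) ^+ d * \sum_(a < n) c a * gauss nu x (t a) yv.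
    rewrite mulr_sumr; apply: eq_bigr => a _; rewrite [RHS]mulrCA; congr (_ * _).
    rewrite -prod_heatk//; apply: eq_bigr => i _.
    by rewrite /yv mxE.
  rewrite normrM ger0_norm ?exprn_ge0 ?expR_ge0// ler_wpM2l ?exprn_ge0 ?expR_ge0//.
  by rewrite -sqrtr_sqr ler_sqrt ?qform_gauss_ge0// gauss_CauchySchwarz.
pose i0 := Ordinal rd.
rewrite (bigD1 i0)/= ?ltnSn//.
rewrite [X in _ * X * S](eq_bigl (fun i : 'I_d => (i < r)%N)); last first.
  move=> i; rewrite ltnS leq_eqVlt -(inj_eq val_inj)/=.
  by have [->|] := eqVneq (val i) r; rewrite ?ltnn ?andbT.
pose w a := c a * \prod_(i < d | i != i0) F r.+1 a y i.
have -> : \sum_(a < n) c a * \prod_(i < d) F r.+1 a y i = \sum_(a < n) w a * heat nu (g i0) L x (t a 0 i0).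
  apply: eq_bigr => a _; rewrite (bigD1 i0)//= {1}/F /= ltnSn /w.
  by rewrite -mulrA; congr (_ * _); rewrite mulrC.
have ck s z : {for z, continuous (heatk nu x s)}.
  by apply: continuous_heatk; rewrite gt_eqF.
rewrite /heat Rintegral_lincomb; last first.
  move=> a z _; apply: continuous1M; first exact: cg.
  by apply: continuous1M; [exact: continuous1_cst|exact: ck].
have cint (z : R) : {for z, continuous (fun z => \sum_(a < n) w a * (g i0 z * (cN * heatk nu x (t a 0 i0) z)))}.
  apply: continuous_at_sum => a; apply: continuous1M; first exact: continuous1_cst.
  apply: continuous1M; first exact: cg.
  by apply: continuous1M; [exact: continuous1_cst|exact: ck].
have iint := @continuous_itv_integrable _ _ (- L) L (fun z _ => cint z).
rewrite (le_trans (le_normr_Rintegral _ iint))//.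
have LL : - L < L by rewrite gt0_cp.
have -> : B i0 * \prod_(i < d | (i < r)%N) B i * S =
    \int[mu]_(z in `[- L, L]) (M i0 * cN * (\prod_(i < d | (i < r)%N) B i * S)).
  rewrite Rintegral_itv_cst// opprK /B; ring.
apply: le_Rintegral => //.
- exact: integrable_norm.
- by apply: continuous_itv_integrable => z _; exact: cst_continuous.
move=> z _.
pose y' i := if i == i0 then z else y i.
have -> : \sum_(a < n) w a * (g i0 z * (cN * heatk nu x (t a 0 i0) z)) =
    g i0 z * cN * \sum_(a < n) c a * \prod_(i < d) F r a y' i.
  rewrite mulr_sumr; apply: eq_bigr => a _; rewrite [in RHS](bigD1 i0)//=.
  rewrite {1}/F /= ltnn {1}/y' eqxx /w.
  have -> : \prod_(i < d | i != i0) F r.+1 a y i = \prod_(i < d | i != i0) F r a y' i.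
    apply: eq_bigr => i ii0; rewrite /F ltnS leq_eqVlt /y' (negbTE ii0).
    by move: ii0; rewrite -(inj_eq val_inj)/= => /negbTE ->.
  move: (\prod_(i < d | i != i0) _) (g i0 z) (heatk _ _ _ _) => p q s.
  ring.
rewrite normrM normrM (ger0_norm cN0); apply: ler_pM => //.
- by rewrite ler_wpM2r.
- by apply: IH; exact: ltnW.
Qed.

Lemma is_derive1_prod (I : eqType) (s : seq I) (F dF : I -> R -> R) (x : R) : uniq s ->
  (forall i, is_derive x (1 : R) (F i) (dF i x)) ->
  is_derive x (1 : R) (fun y => \prod_(i <- s) F i y)
    (\sum_(j <- s) \prod_(i <- s) (if i == j then dF i x else F i x)).
Proof.
move=> + dFi; elim: s => [_|i s IH /= /andP[si us]].
  rewrite big_nil (_ : (fun _ => _) = cst 1); last by apply/funext => y; rewrite big_nil.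
  exact: is_derive_cst.
rewrite (_ : (fun _ => _) = (fun y => F i y * \prod_(j <- s) F j y)); last first.
  by apply/funext => y; rewrite big_cons.
apply: (is_derive1_eq (is_derive1M (dFi i) (IH us))).
rewrite big_cons big_cons eqxx; congr (_ * _ + _).
  rewrite big_seq [RHS]big_seq; apply: eq_bigr => j js.
  by rewrite (_ : (j == i) = false)//; apply: contraNF si => /eqP <-.
rewrite mulr_sumr; apply: eq_big_seq => j js.
rewrite big_cons (_ : (i == j) = false)//.
by apply: contraNF si => /eqP ->.
Qed.

Lemma is_derive_heat_chain (n m : nat) (L M x s : R) (f : nat -> R -> R) :
  0 < L -> 0 < x -> bump_chain n L M f -> (m.+2 <= n)%N ->
  is_derive x (1 : R) (fun z => heat nu (f m) L z s) ((4 * nu)^-1 * heat nu (f m.+2) L x s).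
Proof.
move=> L0 x0 [df cf _ fL] mn.
have LN : L \notin `]- L, L[ by rewrite in_itv/= ltxx andbF.
have NLN : - L \notin `]- L, L[ by rewrite in_itv/= ltxx.
have m1 : (m.+1 <= n)%N := ltnW mn.
have m0 : (m <= n)%N := ltnW m1.
apply: (@is_derive_heat _ _ nu_gt0 (f m) (f m.+1) (f m.+2)) => //.
- by move=> y; exact: df.
- by move=> y; exact: df.
- exact: cf.
- exact: fL.
- exact: fL.
- exact: fL.
- exact: fL.
Qed.

Section Chain.
Variables (N : nat) (L : R) (M : 'I_d -> R) (f : 'I_d -> nat -> R -> R).
Variables (n : nat) (c : 'I_n -> R) (t : 'I_n -> 'rV[R]_d).
Hypothesis L_gt0 : 0 < L.
Hypothesis chain_f : forall i, bump_chain N L (M i) (f i).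
Local Notation kappa := ((4 * nu)^-1).

Let incr (J : 'I_d -> nat) (i : 'I_d) : 'I_d -> nat := fun j => (J j + (j == i))%N.

(** The [m]-th time derivative of the case [m = 0]. [J i] counts how often the heat equation has
    been applied to coordinate [i]; each time costs two space derivatives, hence the index
    [2 * J i], and a factor [kappa]. *)
Fixpoint heat_chain (m : nat) (J : 'I_d -> nat) (x : R) : R :=
  if m is m'.+1 then kappa * \sum_(i < d) heat_chain m' (incr J i) x
  else \sum_(a < n) c a * \prod_(i < d) heat nu (f i (2 * J i)) L x (t a 0 i).

Lemma is_derive_heat_chain_time (m : nat) (J : 'I_d -> nat) (x : R) : 0 < x ->
  (forall i, 2 * (J i + m.+1) <= N)%N ->
  is_derive x (1 : R) (heat_chain m J) (heat_chain m.+1 J x).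
Proof.
move=> x0; elim: m J => [|m IH] J JN.
  have dheat a i : is_derive x (1 : R) (fun z => heat nu (f i (2 * J i)) L z (t a 0 i))
      (kappa * heat nu (f i (2 * J i).+2) L x (t a 0 i)).
    by apply: (is_derive_heat_chain _ L_gt0 x0 (chain_f i)); have := JN i; lia.
  have h := is_derive1_sum (index_enum 'I_n) (fun a => is_derive1Z (c a)
    (is_derive1_prod (F := fun i z => heat nu (f i (2 * J i)) L z (t a 0 i))
      (dF := fun i z => kappa * heat nu (f i (2 * J i).+2) L z (t a 0 i))
      (index_enum_uniq _) (dheat a))).
  apply: (is_derive1_eq h); rewrite /heat_chain.
  under eq_bigr do rewrite mulr_sumr.
  rewrite exchange_big/= mulr_sumr; apply: eq_bigr => j _.
  rewrite mulr_sumr; apply: eq_bigr => a _; rewrite mulrCA; congr (_ * _).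
  rewrite (bigD1 j)//= [in RHS](bigD1 j)//= eqxx -mulrA; congr (_ * (_ * _)).
    by rewrite /incr eqxx addn1 mulnS.
  apply: eq_bigr => i ij.
  by rewrite (negbTE ij) /incr (negbTE ij) addn0.
have h := is_derive1Z kappa (is_derive1_sum (index_enum 'I_d) (fun i => IH (incr J i) _)).
by apply: h => i j; have := JN j; rewrite /incr; case: (j == i) => /=; lia.
Qed.

Let M_ge0 i : 0 <= M i.
Proof. by case: (chain_f i) => _ _ fM _; exact: le_trans (normr_ge0 _) (fM 0%N 0 isT). Qed.

Let B := \prod_(i < d) (M i * cN * (2 * L)).

Let B_ge0 : 0 <= B.
Proof.
apply: prodr_ge0 => i _; rewrite !mulr_ge0// ltW//.
Qed.

Let K0 : 0 <= kappa * d%:R.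
Proof. by rewrite mulr_ge0// invr_ge0 mulr_ge0// ltW. Qed.

Lemma heat_chain_rec_bound (C : R) (x : R) :
  (forall J, (forall i, 2 * J i <= N)%N ->
    `|\sum_(a < n) c a * \prod_(i < d) heat nu (f i (2 * J i)) L x (t a 0 i)| <= C) ->
  forall (m : nat) (J : 'I_d -> nat), (forall i, 2 * (J i + m) <= N)%N ->
  `|heat_chain m J x| <= (kappa * d%:R) ^+ m * C.
Proof.
move=> HC; elim=> [|m IH] J JN.
  rewrite mul1r; apply: HC => i; by have := JN i; rewrite addn0.
rewrite /= normrM ger0_norm ?invr_ge0 ?mulr_ge0 ?(ltW nu_gt0)//.
rewrite exprS -mulrA -mulrA ler_wpM2l ?invr_ge0 ?mulr_ge0 ?(ltW nu_gt0)//.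
rewrite (le_trans (ler_norm_sum _ _ _))//.
apply: (@le_trans _ _ (\sum_(i < d) (kappa * d%:R) ^+ m * C)); last first.
  by rewrite sumr_const card_ord [leRHS]mulr_natl.
apply: ler_sum => i _; apply: IH => j; have := JN j; rewrite /incr.
by case: (j == i) => /=; lia.
Qed.

(** The hypothesis of [chain_bound] on [V j ^+ 2 * x ^+ d]: the prefactor [A ^+ d] with
    [A = x^(-1/2)] cancels [x ^+ d] after squaring. The base [1 + kappa * d] makes the bound
    monotone in [m]. *)
Lemma heat_chain_bound (m : nat) (J : 'I_d -> nat) (x : R) : 0 < x ->
  (forall i, 2 * (J i + m) <= N)%N ->
  (heat_chain m J x) ^+ 2 * x ^+ d <= ((1 + kappa * d%:R) ^+ m * B) ^+ 2 * qform (gauss nu x) c t.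
Proof.
move=> x0 JN; set A := expR (- (ln x / 2)).
have A2x : A ^+ 2 * x = 1.
  rewrite /A -expRM_natr -{2}(lnK x0) -expRD -[RHS]expR0; congr expR.
  by rewrite mulNr divfK// addNr.
have A0 : 0 <= A ^+ d by rewrite exprn_ge0 ?expR_ge0.
set S := A ^+ d * Num.sqrt (qform (gauss nu x) c t).
have S0 : 0 <= S by rewrite mulr_ge0.
have H : `|heat_chain m J x| <= (kappa * d%:R) ^+ m * (B * S).
  apply: heat_chain_rec_bound => // J' JN'.
  apply: heat_prod_bound => //.
    by move=> i; case: (chain_f i) => _ cf _ _; exact: cf.
  by move=> i y; case: (chain_f i) => _ _ fM _; exact: fM.
have {}H : `|heat_chain m J x| <= (1 + kappa * d%:R) ^+ m * B * S.
  apply: le_trans H _; rewrite -mulrA ler_wpM2r ?mulr_ge0// lerXn2r ?nnegrE ?addr_ge0 ?K0//.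
  by rewrite lerDr.
have -> : qform (gauss nu x) c t = S ^+ 2 * x ^+ d.
  rewrite exprMn mulrAC -exprM mulnC exprM -exprMn A2x expr1n mul1r.
  by rewrite sqr_sqrtr// qform_gauss_ge0.
rewrite mulrA ler_wpM2r ?exprn_ge0 ?(ltW x0)// -exprMn -(real_normK (num_real (heat_chain m J x))).
by rewrite lerXn2r ?nnegrE// ?mulr_ge0// exprn_ge0// addr_ge0.
Qed.

Lemma heat_chain_bounded (m : nat) (J : 'I_d -> nat) (x : R) : 0 < x ->
  (forall i, 2 * (J i + m) <= N)%N ->
  `|heat_chain m J x| <= (1 + kappa * d%:R) ^+ m * \sum_(a < n) `|c a| * \prod_(i < d) M i.
Proof.
move=> x0 JN; set C := \sum_(a < n) _.
have C0 : 0 <= C by apply: sumr_ge0 => a _; rewrite mulr_ge0// prodr_ge0.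
apply: (@le_trans _ _ ((kappa * d%:R) ^+ m * C)); last first.
  by rewrite ler_wpM2r// lerXn2r ?nnegrE ?addr_ge0 ?K0// lerDr.
apply: heat_chain_rec_bound => // J' JN'.
rewrite (le_trans (ler_norm_sum _ _ _))//; apply: ler_sum => a _.
rewrite normrM ler_wpM2l// normr_prod; apply: ler_prod => i _.
rewrite normr_ge0/=; case: (chain_f i) => _ cf fM fL.
apply: heat_le => //.
- by apply: continuous_measurable_fun; exact: cf.
- move=> y yL; apply: fL => //; apply: contra yL; exact: subset_itv_oo_cc.
- by move=> y; exact: fM.
Qed.

Lemma heat_chain_cvg : (0 < N)%N ->
  heat_chain 0 (fun=> 0%N) x @[x --> 0^'+] -->
  \sum_(a < n) c a * \prod_(i < d) f i 0%N (t a 0 i).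
Proof.
move=> N0; rewrite /heat_chain; apply: cvg_sum_seq => a.
apply: cvgM; first exact: cvg_cst.
apply: cvg_prod_seq => i; rewrite muln0; case: (chain_f i) => df cf fM fL.
have lip (y z : R) : `|f i 0%N y - f i 0%N z| <= M i * `|z - y|.
  wlog yz : y z / y <= z.
    by move=> H; have [/H//|/ltW/H] := leP y z; rewrite distrC [`|_ - y|]distrC.
  have [|e _ E] := @MVT_segment _ (f i 0%N) (f i 1%N) _ _ yz (fun x _ => df 0%N x N0).
    by apply: continuous_subspaceT; exact: cf.
  by rewrite distrC E normrM ler_wpM2r// fM.
apply: (heat_cvg0 nu_gt0 (B := M i)) lip.
- by apply: continuous_measurable_fun; exact: cf.
- move=> y yL; apply: fL => //; apply: contra yL; exact: subset_itv_oo_cc.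
- by move=> y; exact: fM.
Qed.

End Chain.

Definition mono (m : 'I_d -> nat) (t : 'rV[R]_d) : R := \prod_(i < d) t 0 i ^+ m i.

(** At the sites the monomial is unchanged by the cutoff, which equals [1] on [[- rho, rho]]. The
    sum is thus the value at time [0] of the heat flow of a product of compactly supported
    functions, and [chain_bound] applies to its time derivatives. *)
Lemma mono_bound (rho : R) : 0 <= rho -> exists C A : R, [/\ 0 <= C, 1 <= A &
  forall (n : nat) (c : 'I_n -> R) (t : 'I_n -> 'rV[R]_d) (m : 'I_d -> nat) (I th : R),
  (forall a i, `|t a 0 i| <= rho) ->
  (forall e : R, 0 < e < 1 ->
    \int[mu]_(x in `[e, 1]) (x `^ (nu - 1) * qform (gauss nu x) c t) <= I) ->
  0 < th -> `|\sum_(a < n) c a * mono m (t a)| <= C * A ^+ (\sum_(i < d) m i) * (th * I + th^-1)].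
Proof.
move=> rho0.
have [K nuK] : exists K : nat, nu - 1 <= (2 * K)%:R - d%:R.
  exists (Num.bound (`|nu| + d%:R)).
  have := archi_boundP (addr_ge0 (normr_ge0 nu) (ler0n R d)).
  set b := (Num.bound _)%:R => Kb; have := ler_norm nu.
  rewrite natrM -/b; have : 0 <= b by rewrite ler0n.
  lra.
(* Each time derivative uses two space derivatives; the chain runs to order [K + 2] because the
   continuity of [V K.+1] is obtained by differentiating it. *)
pose N := (2 * K.+2)%N.
have [L [M0 [chi [L0 M00 bchi chi1]]]] := bump_chain_exists N rho0.
pose kd := 1 + (4 * nu)^-1 * d%:R.
have kd1 : 1 <= kd by rewrite lerDl mulr_ge0// invr_ge0 mulr_ge0// ltW.
pose A := 1 + (L + N%:R).
have A1 : 1 <= A by rewrite lerDl addr_ge0 ?ltW.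
pose C1 := (M0 * cN * (2 * L)) ^+ d.
have A0 : 0 <= A := le_trans ler01 A1.
have cN0 : 0 <= cN by exact: sqrtr_ge0.
have L20 : 0 <= 2 * L by rewrite mulr_ge0// ltW.
have C10 : 0 <= C1 by rewrite exprn_ge0// !mulr_ge0// ltW.
exists ((K.+2 ^ 2)%:R * (kd ^+ K.+1 * C1)), A; split => //.
  by rewrite mulr_ge0// mulr_ge0// exprn_ge0// (le_trans ler01).
move=> n c t m I th trho HI th0.
have /choice[f Hf] : forall i : 'I_d, exists g, bump_chain N L ((L + N%:R) ^+ m i * M0) g /\
    (forall y, g 0%N y = y ^+ m i * chi 0%N y).
  by move=> i; have [g bg gE] := bump_chain_mulXn (m i) (ltW L0) M00 bchi; exists g.
pose M i := (L + N%:R) ^+ m i * M0.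
have bf i : bump_chain N L (M i) (f i) by case: (Hf i).
have LN0 : 0 <= L + N%:R by rewrite addr_ge0// ltW.
have Mge i : 0 <= M i by rewrite mulr_ge0// exprn_ge0.
have -> : \sum_(a < n) c a * mono m (t a) = \sum_(a < n) c a * \prod_(i < d) f i 0%N (t a 0 i).
  apply: eq_bigr => a _; congr (_ * _); apply: eq_bigr => i _.
  by rewrite (proj2 (Hf i)) chi1// mulr1.
pose V j := heat_chain L f c t j (fun=> 0%N).
pose MM := kd ^+ K.+1 * (C1 * A ^+ (\sum_(i < d) m i)).
have MM0 : 0 <= MM by rewrite !mulr_ge0// exprn_ge0// (le_trans ler01).
have BMM : \prod_(i < d) (M i * cN * (2 * L)) <= C1 * A ^+ (\sum_(i < d) m i).
  rewrite /M (eq_bigr (fun i => (M0 * cN * (2 * L)) * (L + N%:R) ^+ m i)); last first.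
    by move=> i _; ring.
  rewrite big_split/= prodr_const card_ord -/C1 ler_wpM2l//.
  rewrite -prodrXr; apply: ler_prod => i _.
  apply/andP; split; first by rewrite exprn_ge0.
  by rewrite lerXn2r ?nnegrE// /A lerDr.
have B0 : 0 <= \prod_(i < d) (M i * cN * (2 * L)).
  by apply: prodr_ge0 => i _; exact: mulr_ge0 (mulr_ge0 (Mge i) cN0) L20.
have kdj j : (j <= K.+1)%N -> kd ^+ j <= kd ^+ K.+1 by move=> jK; rewrite ler_weXn2l.
have cgauss (x : R) : 0 < x -> {for x, continuous (fun x => qform (gauss nu x) c t)}.
  move=> x0; apply: continuous_at_sum => i; apply: continuous_at_sum => j.
  apply: continuous1M; first exact: continuous1_cst.
  apply: (@continuous_comp _ _ _ (fun x : R => - (nu * sqdist (t i) (t j) / x)) expR); last exact: continuous_expR.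
  apply: continuousN; apply: continuous1M; first exact: continuous1_cst.
  by apply: continuousV; [rewrite gt_eqF|exact: continuous1_id].
have VN (x : R) j : 0 < x -> (j <= K.+1)%N -> is_derive x (1 : R) (V j) (V j.+1 x).
  move=> x0 jK; apply: (is_derive_heat_chain_time c t L0 bf) => // i.
  by rewrite add0n /N leq_mul2l.
have JN j : (j <= K.+1)%N -> forall i : 'I_d, (2 * (0 + j) <= N)%N.
  by move=> jK i; rewrite add0n /N leq_mul2l/= (leq_trans jK).
have nC : (K.+2 ^ 2)%:R * (kd ^+ K.+1 * C1) * A ^+ (\sum_(i < d) m i) * (th * I + th^-1) =
    (K.+2 ^ 2)%:R * MM * (th * I + th^-1) by rewrite /MM !mulrA.
rewrite nC.
apply: (@chain_bound R K d nu MM (kd ^+ K.+1 * \sum_(a < n) `|c a| * \prod_(i < d) M i)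
  (\sum_(a < n) c a * \prod_(i < d) f i 0%N (t a 0 i)) I V (fun x => qform (gauss nu x) c t)) => //.
- by move=> x x0; exact: qform_gauss_ge0.
- by move=> x j x0 jK; apply: VN => //; exact: leqW.
- by move=> x x0; exact: (continuous_derivable (VN x K.+1 x0 (leqnn _))).
- move=> x j /andP[x0 _] jK; rewrite (le_trans (heat_chain_bound c t L0 bf x0 (JN j jK)))//.
  rewrite ler_wpM2r ?qform_gauss_ge0// lerXn2r ?nnegrE// ?mulr_ge0 ?exprn_ge0// ?(le_trans ler01)//.
  by rewrite ler_pM// ?exprn_ge0 ?(le_trans ler01)// kdj.
- move=> x j /andP[x0 _] jK; rewrite (le_trans (heat_chain_bounded c t L0 bf x0 (JN j jK)))//.
  apply: ler_wpM2r; last exact: kdj.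
  apply: sumr_ge0 => a _; apply: mulr_ge0 => //.
  by apply: prodr_ge0 => i _; exact: Mge.
- exact: heat_chain_cvg.
Qed.

End MonomialBound.

(** * Integrals over the open half-line *)

Section HalfLine.
Variable R : realType.
Local Notation mu := lebesgue_measure.
Local Notation I0 := (`]0, +oo[%classic : set R).
Implicit Types f : R -> R.

Lemma itv0y_bigcup (a : R) : 0 < a ->
  I0 = \bigcup_n (`[a / n.+1%:R, +oo[%classic : set R).
Proof.
move=> a0; apply/seteqP; split => x /=.
  rewrite in_itv/= andbT => x0; exists (Num.bound (a / x)) => //=.
  rewrite in_itv/= andbT ler_pdivrMr ?ltr0n// mulrC -ler_pdivrMr//.
  have := archi_boundP (divr_ge0 (ltW a0) (ltW x0)).
  by move=> /ltW/le_trans; apply; rewrite ler_nat.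
move=> [n _]/=; rewrite !in_itv/= !andbT; apply: lt_le_trans.
by rewrite divr_gt0// ltr0n.
Qed.

Lemma measurable_I0 f : (forall x : R, 0 < x -> {for x, continuous f}) ->
  measurable_fun I0 f.
Proof.
move=> cf; apply: open_continuous_measurable_fun; first exact: interval_open.
by move=> x; rewrite inE/= in_itv/= andbT => /cf.
Qed.

Lemma cvg_integral_I0 (a : R) f : 0 < a ->
  (forall x : R, 0 < x -> {for x, continuous f}) -> (forall x, 0 < x -> 0 <= f x) ->
  (\int[mu]_(x in `[(a / n.+1%:R)%R, +oo[) (f x)%:E @[n --> \oo] -->
    \int[mu]_(x in I0) (f x)%:E)%E.
Proof.
move=> a0 cf f0; rewrite (itv0y_bigcup a0).
have sub n : `[a / n.+1%:R, +oo[%classic `<=` I0.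
  move=> x /=; rewrite !in_itv/= !andbT; apply: lt_le_trans.
  by rewrite divr_gt0// ltr0n.
apply: ge0_nondecreasing_set_cvg_integral.
- move=> n m nm; rewrite subsetEset; apply: subset_itvr.
  rewrite bnd_simp ler_pM2l// lef_pV2 ?posrE ?ltr0n// ler_nat.
  by rewrite ltnS.
- by [].
- move=> n; apply/measurable_EFinP; apply: (measurable_funS _ (sub n)) => //.
  exact: measurable_I0.
- move=> n x /sub; rewrite /= in_itv/= andbT lee_fin; exact: f0.
Qed.

(** Substitution on the half-lines that start at [1 / n] and [l / n], followed by monotone
    convergence. *)
Lemma integral_I0_scale (l : R) f : 0 < l ->
  (forall x : R, 0 < x -> {for x, continuous f}) -> (forall x, 0 < x -> 0 <= f x) ->
  (\int[mu]_(x in I0) (f (l * x) * l)%:E = \int[mu]_(x in I0) (f x)%:E)%E.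
Proof.
move=> l0 cf f0.
have dl (x : R) : is_derive x (1 : R) (fun y : R => l * y) l.
  by apply: (is_derive1_eq (is_derive1Z l (is_derive_id x 1))); rewrite mulr1.
have cl (x : R) : {for x, continuous (fun y : R => l * y)} by exact: mulrl_continuous.
have D1 : (fun y : R => l * y)^`()%classic = cst l.
  by apply/funext => x; rewrite derive1E; have := dl x => h; exact: (@derive_val _ _ _ _ _ _ _ h).
have H1 := @cvg_integral_I0 1 (fun x => f (l * x) * l) ltr01.
have H2 := cvg_integral_I0 l0 cf f0.
have {}H1 := H1 _ _.
have c1 (x : R) : 0 < x -> {for x, continuous (fun x => f (l * x) * l)}.
  move=> x0; apply: continuous1M; last exact: continuous1_cst.
  by apply: (continuous_comp (cl x)); apply: cf; rewrite mulr_gt0.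
have p1 (x : R) : 0 < x -> 0 <= f (l * x) * l.
  by move=> x0; rewrite mulr_ge0 ?(ltW l0)// f0// mulr_gt0.
have {}H1 := H1 c1 p1.
have E n : (\int[mu]_(x in `[(l / n.+1%:R)%R, +oo[) (f x)%:E =
    \int[mu]_(x in `[(1 / n.+1%:R)%R, +oo[) (f (l * x) * l)%:E)%E.
  have a0 : 0 < 1 / n.+1%:R :> R by rewrite divr_gt0// ltr0n.
  have -> : l / n.+1%:R = (fun y : R => l * y) (1 / n.+1%:R) by rewrite mul1r.
  rewrite increasing_ge0_integration_by_substitutiony.
  - by apply: eq_integral => x _; rewrite D1.
  - by move=> x y _ _ xy; rewrite ltr_pM2l.
  - by rewrite D1 => x _; exact: cst_continuous.
  - by rewrite D1; exact: is_cvg_cst.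
  - by rewrite D1; exact: is_cvg_cst.
  - split; first by move=> x _; have := dl x => h; exact: (@ex_derive _ _ _ _ _ _ _ h).
    by apply: cvg_at_right_filter; exact: cl.
  - by under eq_fun do rewrite mulrC; apply/gt0_cvgMly => //; exact: cvg_id.
  - apply: continuous_in_subspaceT => x; rewrite inE/= in_itv/= andbT => x0; apply: cf.
    by rewrite (lt_le_trans _ x0)// mulr_gt0.
  - move=> x; rewrite in_itv/= andbT => x0; apply: f0.
    by rewrite (lt_trans _ x0)// mulr_gt0.
have {}H2 : (\int[mu]_(x in `[(1 / n.+1%:R)%R, +oo[) (f (l * x) * l)%:E @[n --> \oo] -->
    \int[mu]_(x in I0) (f x)%:E)%E.
  by move: H2; under eq_fun do rewrite E.
exact: (cvg_unique _ H1 H2).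
Qed.

Lemma powRN_cvgy (q : R) : 0 < q -> x `^ (- q) @[x --> +oo%R] --> (0 : R).
Proof.
move=> q0; apply/cvgrPdist_le => e e0; near=> x.
have x0 : 0 < x by near: x; exact: nbhs_pinfty_gt.
rewrite sub0r normrN ger0_norm ?powR_ge0// powRN invf_ple ?posrE ?powR_gt0//.
have -> : e^-1 = (e^-1 `^ q^-1) `^ q.
  by rewrite -powRrM mulVf ?gt_eqF// powRr1// invr_ge0 ltW.
apply: ge0_ler_powR; rewrite ?nnegrE ?powR_ge0 ?(ltW q0) ?(ltW x0)//.
Unshelve. all: by end_near.
Qed.

Lemma integral_I0_powR_lty (f : R -> R) (p q C : R) : 0 < p -> 0 < q -> 0 <= C ->
  (forall x : R, 0 < x -> {for x, continuous f}) -> (forall x, 0 < x -> 0 <= f x) ->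
  (forall x, 0 < x <= 1 -> f x <= C * x `^ (p - 1)) ->
  (forall x, 1 <= x -> f x <= C * x `^ (- q - 1)) ->
  (\int[mu]_(x in I0) (f x)%:E <= (C / p + C / q)%:E)%E.
Proof.
move=> p0 q0 C0 cf f0 f1 f2.
have cpow r (x : R) : 0 < x -> {for x, continuous (fun y => C * y `^ r)}.
  move=> x0; apply: continuous1M; first exact: continuous1_cst.
  exact: continuous_derivable (is_derive1_powR _ x0).
have cvgf := cvg_integral_I0 ltr01 cf f0.
rewrite -(cvg_lim _ cvgf)//; apply: lime_le; first by apply: cvgP; exact: cvgf.
apply: nearW => n; set e := 1 / n.+1%:R.
have e0 : 0 < e by rewrite divr_gt0// ltr0n.
have e1 : e <= 1 by rewrite ler_pdivrMr ?ltr0n// mul1r ler1n.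
have mf (A : set R) : measurable A -> A `<=` I0 -> measurable_fun A (fun x => (f x)%:E).
  move=> mA AI; apply/measurable_EFinP; apply: (measurable_funS _ AI) => //.
  exact: measurable_I0.
have sub1 : `[e, 1[%classic `<=` I0.
  by move=> x /=; rewrite !in_itv/= andbT => /andP[ex _]; exact: lt_le_trans ex.
have sub2 : `[1, +oo[%classic `<=` I0.
  by move=> x /=; rewrite !in_itv/= !andbT => /(lt_le_trans ltr01).
have -> : `[e, +oo[%classic = `[e, 1[%classic `|` `[1, +oo[%classic.
  by rewrite (@itv_bndbnd_setU _ _ _ (BLeft (1 : R)))// ?bnd_simp.
rewrite ge0_integral_setU//=; last 3 first.
- by apply: mf; [exact: measurableU|move=> x [/sub1|/sub2]].
- by move=> x [/sub1|/sub2]; rewrite /= in_itv/= andbT lee_fin; exact: f0.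
- rewrite disj_set2E; apply/eqP/seteqP; split => // x /= [].
  by rewrite !in_itv/= andbT => /andP[_ +]; rewrite ltNge => /negP.
rewrite EFinD; apply: leeD.
  apply: (@le_trans _ _ (\int[mu]_(x in `[e, 1%R]) (C * x `^ (p - 1))%:E)%E).
    rewrite integral_itv_bndo_bndc; last by apply: mf.
    apply: ge0_le_integral => //.
    + by move=> x; rewrite /= in_itv/= lee_fin => /andP[ex _]; exact: f0 (lt_le_trans e0 ex).
    + apply: mf => //; move=> x /=; rewrite !in_itv/= andbT => /andP[ex _]; exact: lt_le_trans ex.
    + apply/measurable_EFinP; apply: measurable_funS (measurable_I0 (cpow (p - 1))) => //.
      by move=> x /=; rewrite !in_itv/= andbT => /andP[ex _]; exact: lt_le_trans ex.
    + move=> x; rewrite /= in_itv/= lee_fin => /andP[ex x1]; apply: f1.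
      by rewrite x1 (lt_le_trans e0 ex).
  have [e1'|] := ltP e 1; last first.
    move=> e1'; have -> : e = 1 by apply/eqP; rewrite eq_le e1 e1'.
    by rewrite set_itv1 integral_set1 lee_fin divr_ge0// ltW.
  have intC : mu.-integrable `[e, 1] (EFin \o (fun x => C * x `^ (p - 1))).
    apply: continuous_itv_integrable => x; rewrite in_itv/= => /andP[ex _].
    exact: cpow (lt_le_trans e0 ex).
  rewrite -[leLHS]fineK; last exact: integrable_fin_num intC.
  have h1 (x : R) : x \in `[e, 1] -> is_derive x (1 : R) (fun x => C / p * x `^ p) (C * x `^ (p - 1)).
    rewrite in_itv/= => /andP[ex _].
    apply: (is_derive1_eq (is_derive1Z _ (is_derive1_powR p (lt_le_trans e0 ex)))).
    by rewrite mulrA divfK// gt_eqF.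
  have h2 (x : R) : x \in `[e, 1] -> {for x, continuous (fun x => C * x `^ (p - 1))}.
    by rewrite in_itv/= => /andP[ex _]; exact: cpow (lt_le_trans e0 ex).
  have := Rintegral_FTC e1' h1 h2; rewrite /Rintegral => ->.
  by rewrite lee_fin powR1 mulr1 lerBlDr lerDl mulr_ge0 ?powR_ge0// divr_ge0// ltW.
apply: (@le_trans _ _ (\int[mu]_(x in `[1%R, +oo[) (C * x `^ (- q - 1))%:E)%E).
  apply: ge0_le_integral => //.
  + by move=> x /sub2; rewrite /= in_itv/= andbT lee_fin; exact: f0.
  + exact: mf.
  + apply/measurable_EFinP; apply: measurable_funS (measurable_I0 (cpow (- q - 1))) => //.
  + by move=> x; rewrite /= in_itv/= lee_fin andbT; exact: f2.
rewrite (@ge0_continuous_FTC2y _ (fun x => C * x `^ (- q - 1)) (fun x => - (C / q) * x `^ (- q)) 1 0).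
- by rewrite powR1 mulr1 -EFinB sub0r opprK.
- by move=> x _; rewrite mulr_ge0 ?powR_ge0.
- apply: continuous_in_subspaceT => x; rewrite inE/= in_itv/= andbT => x1.
  exact: cpow (lt_le_trans ltr01 x1).
- rewrite -[X in _ --> X](mulr0 (- (C / q))); apply: cvgM; [exact: cvg_cst|exact: powRN_cvgy].
- move=> x x1; have := is_derive1Z (- (C / q)) (is_derive1_powR (- q) (lt_trans ltr01 x1)).
  by move=> h; exact: (@ex_derive _ _ _ _ _ _ _ h).
- apply: cvg_at_right_filter.
  exact: (continuous_derivable (is_derive1Z (- (C / q)) (is_derive1_powR (- q) ltr01))).
- move=> x; rewrite in_itv/= andbT => x1.
  have h := is_derive1Z (- (C / q)) (is_derive1_powR (- q) (lt_trans ltr01 x1)).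
  rewrite derive1E (@derive_val _ _ _ _ _ _ _ h) mulrA; congr (_ * _).
  by rewrite mulrN mulNr opprK divfK// gt_eqF.
Qed.

Lemma itv_subset_I0 (a b : R) : 0 < a -> `[a, b]%classic `<=` I0.
Proof.
by move=> a0 x; rewrite /= !in_itv/= andbT => /andP[ax _]; exact: lt_le_trans ax.
Qed.

Lemma integral_I0_gt0 (f : R -> R) (a b m : R) : 0 < a -> a < b -> 0 < m ->
  (forall x : R, 0 < x -> {for x, continuous f}) -> (forall x, 0 < x -> 0 <= f x) ->
  (forall x, a <= x <= b -> m <= f x) -> (0 < \int[mu]_(x in I0) (f x)%:E)%E.
Proof.
move=> a0 ab m0 cf f0 fm.
have mf (A : set R) : measurable A -> A `<=` I0 -> measurable_fun A (fun x => (f x)%:E).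
  move=> mA AI; apply/measurable_EFinP; apply: (measurable_funS _ AI) => //.
  exact: measurable_I0.
have sub := itv_subset_I0 (b := b) a0.
apply: (@lt_le_trans _ _ (\int[mu]_(x in `[a, b]) (f x)%:E)%E); last first.
  apply: ge0_subset_integral => //; first exact: mf.
  by move=> x; rewrite /= in_itv/= andbT lee_fin; exact: f0.
apply: (@lt_le_trans _ _ (\int[mu]_(x in `[a, b]) m%:E)%E).
  by rewrite integral_cst//= lebesgue_measure_itv/= lte_fin ab -EFinB -EFinM lte_fin mulr_gt0// subr_gt0.
apply: ge0_le_integral => //.
- by move=> x _; rewrite lee_fin ltW.
- exact: mf.
Qed.

End HalfLine.

(** * Gamma and Beta integrals *)

Section GammaBeta.
Variable R : realType.
Local Notation mu := lebesgue_measure.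
Local Notation I0 := (`]0, +oo[%classic : set R).
Implicit Types a p q b x : R.

Let gam p (x : R) : R := x `^ (p - 1) * expR (- x).

Let cgam p x : 0 < x -> {for x, continuous (gam p)}.
Proof.
move=> x0; apply: continuous1M; first exact: continuous_derivable (is_derive1_powR _ x0).
apply: (@continuous_comp _ _ _ (fun y : R => - y) expR); last exact: continuous_expR.
exact: opp_continuous.
Qed.

Let gam_ge0 p x : 0 <= gam p x.
Proof. by rewrite mulr_ge0 ?powR_ge0 ?expR_ge0. Qed.

Lemma Gamma_integral_lty p : 0 < p -> (\int[mu]_(x in I0) (gam p x)%:E < +oo)%E.
Proof.
(* An integer at least [p + 1], so that [x^(p + 1) <= x^n <= n! exp x] for [x >= 1]; the integrand
   then decays like [x^(-2)]. *)
move=> p0; pose n := Num.bound (`|p| + 1).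
have nb : p + 1 <= n%:R.
  have := archi_boundP (addr_ge0 (normr_ge0 p) ler01); rewrite -/n.
  by have := ler_norm p; lra.
have n1 : 1 <= n`!%:R :> R by rewrite ler1n fact_gt0.
apply: (le_lt_trans (@integral_I0_powR_lty _ (gam p) p 1 n`!%:R p0 ltr01 _ _ _ _ _)).
- by rewrite ler0n.
- by move=> x x0; exact: cgam.
- by move=> x _; exact: gam_ge0.
- move=> x /andP[x0 _]; rewrite /gam mulrC ler_wpM2r ?powR_ge0// (le_trans _ n1)//.
  by rewrite -expR0 ler_expR oppr_le0 ltW.
- move=> x x1; have x0 : 0 < x by exact: lt_le_trans x1.
  rewrite /gam expRN ler_pdivrMr ?expR_gt0//.
  have H : x `^ (p + 1) <= n`!%:R * expR x.
    apply: (@le_trans _ _ (x `^ n%:R)); first exact: ler_powR.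
    rewrite powR_mulrn ?(ltW x0)//.
    have [m nm] : exists m, n = m.+1.
      by exists n.-1; rewrite prednK.
    rewrite nm -ler_pdivrMl ?ltr0n ?fact_gt0// mulrC.
    by apply: le_trans (expR_ge1Dxn m (ltW x0)); rewrite lerDr.
  have -> : x `^ (p - 1) = x `^ (p + 1) * x `^ (- 1 - 1).
    by rewrite -powRD; [congr (_ `^ _); ring|rewrite (gt_eqF x0) implybT].
  by rewrite mulrAC ler_wpM2r ?powR_ge0.
- exact: ltry.
Qed.

Lemma GammaE p : 0 < p -> (\int[mu]_(x in I0) (gam p x)%:E = (Gamma p)%:E)%E.
Proof.
move=> p0; rewrite /Gamma /Rintegral fineK// ge0_fin_numE ?Gamma_integral_lty//.
by apply: integral_ge0 => x _; rewrite lee_fin gam_ge0.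
Qed.

Lemma Gamma_gt0 p : 0 < p -> 0 < Gamma p.
Proof.
move=> p0; rewrite -lte_fin -GammaE//.
apply: (@integral_I0_gt0 _ _ 1 2 (expR (- (`|p - 1| * ln 2) - 2))) => //.
- by rewrite ltr1n.
- exact: expR_gt0.
- by move=> x x0; exact: cgam.
- move=> x /andP[x1 x2]; have x0 : 0 < x by exact: lt_le_trans x1.
  rewrite /gam /powR (gt_eqF x0) -expRD ler_expR lerB//.
  have l0 : 0 <= ln x by rewrite ln_ge0.
  have l2 : ln x <= ln 2 by rewrite ler_ln ?posrE.
  rewrite lerNl (le_trans (ler_norm _))// normrN normrM (ger0_norm l0).
  by rewrite ler_wpM2l.
Qed.

Lemma Gamma_scale p (l : R) : 0 < p -> 0 < l ->
  (\int[mu]_(x in I0) (x `^ (p - 1) * expR (- (l * x)))%:E = (l `^ (- p) * Gamma p)%:E)%E.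
Proof.
move=> p0 l0; rewrite EFinM -GammaE//.
rewrite -(integral_I0_scale l0); last 2 first.
- by move=> x x0; exact: cgam.
- by move=> x _; exact: gam_ge0.
rewrite -ge0_integralZl_EFin//.
- apply: eq_integral => x; rewrite inE/= in_itv/= andbT => x0.
  rewrite -EFinM; congr EFin; rewrite /gam powRM ?ltW//.
  have -> : l `^ (- p) * (l `^ (p - 1) * x `^ (p - 1) * expR (- (l * x)) * l) =
     (l `^ (- p) * l `^ (p - 1) * l) * (x `^ (p - 1) * expR (- (l * x))) by ring.
  have l_neq0 : l != 0 by rewrite gt_eqF.
  rewrite -powRD ?l_neq0 ?implybT// -{3}(powRr1 (ltW l0)) -powRD ?l_neq0 ?implybT//.
  have -> : - p + (p - 1) + 1 = 0 by ring.
  by rewrite powRr0 mul1r.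
- by move=> x _; rewrite lee_fin mulr_ge0 ?gam_ge0// ltW.
- apply/measurable_EFinP; apply: measurable_I0 => x x0.
  apply: continuous1M; last exact: continuous1_cst.
  apply: (@continuous_comp _ _ _ (fun y : R => l * y) (gam p)); first exact: mulrl_continuous.
  by apply: cgam; rewrite mulr_gt0.
- exact: powR_ge0.
Qed.

(** Tonelli for [x^(p - 1) y^(p + q - 1) exp (- y (x + b))] on the quadrant: integrating [y] first
    yields [Gamma (p + q)] times the integrand, integrating [x] first leaves a Gamma integral of
    exponent [q]. The factor [ii] is the indicator of the half-line, so that both integrations run
    over the whole line. *)
Lemma Beta_integral p q b : 0 < p -> 0 < q -> 0 < b ->
  (\int[mu]_(x in I0) (x `^ (p - 1) * (x + b) `^ (- (p + q)))%:E =
    (b `^ (- q) * Gamma p * Gamma q / Gamma (p + q))%:E)%E.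
Proof.
move=> p0 q0 b0; have pq0 : 0 < p + q by rewrite addr_gt0.
have mI0 : measurable I0 by exact: measurable_itv.
have mexp (c : R) : measurable_fun [set: R] (fun y => expR (- (c * y))).
  apply: continuous_measurable_fun => y.
  apply: (continuous_comp (f := fun y : R => - (c * y)) (g := expR)); last exact: continuous_expR.
  by apply: continuousN; exact: mulrl_continuous.
have [ii [mii ii0 iiT iiF]] : exists ii : R -> R, [/\ measurable_fun [set: R] ii,
    forall x, 0 <= ii x, forall x, x \in I0 -> ii x = 1 & forall x, x \notin I0 -> ii x = 0].
  exists \1_I0; split; first exact: measurable_indic.
  - by move=> x; rewrite indicE ler0n.
  - by move=> x xI; rewrite indicE xI.
  - by move=> x xI; rewrite indicE (negbTE xI).
pose F (z : R * R) : \bar R := (ii z.1 * ii z.2 *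
  (z.1 `^ (p - 1) * z.2 `^ (p + q - 1) * expR (- (z.2 * (z.1 + b)))))%:E.
have mF : measurable_fun setT F.
  apply/measurable_EFinP; apply: measurable_funM.
    by apply: measurable_funM; apply: measurableT_comp.
  apply: measurable_funM.
    apply: measurable_funM.
      by apply: (@measurableT_comp _ _ _ _ _ _ (fun y : R => y `^ (p - 1))).
    by apply: (@measurableT_comp _ _ _ _ _ _ (fun y : R => y `^ (p + q - 1))).
  apply: measurableT_comp => //; apply: measurableT_comp => //.
  apply: measurable_funM => //; exact: measurable_funD.
have F0 z : (0 <= F z)%E.
  rewrite lee_fin; apply: mulr_ge0; first exact: mulr_ge0 (ii0 _) (ii0 _).
  exact: mulr_ge0 (mulr_ge0 (powR_ge0 _ _) (powR_ge0 _ _)) (expR_ge0 _).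
have T := @fubini_tonelli _ _ _ _ R mu mu F mF F0.
have I0E (f : R -> \bar R) : (\int[mu]_(x in I0) f x = \int[mu]_x ((ii x)%:E * f x))%E.
  rewrite integral_mkcond; apply: eq_integral => x _; rewrite patchE.
  case: ifPn => xI.
    rewrite (iiT _ xI).
    rewrite mul1e.
    reflexivity.
  rewrite (iiF _ xI).
  rewrite mul0e.
  reflexivity.
have inner1 (x : R) : (\int[mu]_y F (x, y) =
    (ii x)%:E * (Gamma (p + q) * (x `^ (p - 1) * (x + b) `^ (- (p + q))))%:E)%E.
  have [xI|xI] := boolP (x \in I0); last first.
    rewrite (iiF _ xI) mul0e; apply: integral0_eq => y _.
    by rewrite /F/= (iiF _ xI) !mul0r.
  have x0 : 0 < x by have := set_mem xI; rewrite /= in_itv/= andbT.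
  rewrite (iiT _ xI) mul1e.
  have -> : (Gamma (p + q) * (x `^ (p - 1) * (x + b) `^ (- (p + q))))%:E =
      ((x `^ (p - 1))%:E * ((x + b) `^ (- (p + q)) * Gamma (p + q))%:E)%E.
    by rewrite -EFinM; congr EFin; ring.
  have xb0 : 0 < x + b by rewrite addr_gt0.
  have -> : (\int[mu]_y F (x, y) = \int[mu]_y ((x `^ (p - 1))%:E *
      ((ii y)%:E * (y `^ (p + q - 1) * expR (- ((x + b) * y)))%:E)))%E.
    apply: eq_integral => y _; rewrite /F (iiT _ xI) -EFinM; congr EFin.
    by rewrite [y * _]mulrC /=; ring.
  rewrite (@ge0_integralZl_EFin _ _ _ mu _ measurableT).
  - by rewrite -I0E Gamma_scale.
  - move=> y _; apply: mule_ge0; rewrite lee_fin; first exact: ii0.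
    exact: mulr_ge0 (powR_ge0 _ _) (expR_ge0 _).
  - apply/measurable_EFinP; apply: measurable_funM; first exact: mii.
    by apply: measurable_funM; [exact: measurable_powR|exact: mexp].
  - exact: powR_ge0.
have inner2 (y : R) : (\int[mu]_x F (x, y) =
    (ii y)%:E * (Gamma p * (y `^ (q - 1) * expR (- (b * y))))%:E)%E.
  have [yI|yI] := boolP (y \in I0); last first.
    rewrite (iiF _ yI) mul0e; apply: integral0_eq => x _.
    by rewrite /F/= (iiF _ yI) mulr0 !mul0r.
  have y0 : 0 < y by have := set_mem yI; rewrite /= in_itv/= andbT.
  rewrite (iiT _ yI) mul1e.
  have -> : (Gamma p * (y `^ (q - 1) * expR (- (b * y))))%:E =
      ((y `^ (p + q - 1) * expR (- (b * y)))%:E * (y `^ (- p) * Gamma p)%:E)%E.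
    rewrite -EFinM; congr EFin.
    have -> : y `^ (q - 1) = y `^ (p + q - 1) * y `^ (- p).
      by rewrite -powRD; [congr (_ `^ _); ring|rewrite (gt_eqF y0) implybT].
    ring.
  have -> : (\int[mu]_x F (x, y) = \int[mu]_x ((y `^ (p + q - 1) * expR (- (b * y)))%:E *
      ((ii x)%:E * (x `^ (p - 1) * expR (- (y * x)))%:E)))%E.
    apply: eq_integral => x _; rewrite /F (iiT _ yI) -EFinM; congr EFin.
    rewrite /= mulrDr opprD expRD [y * b]mulrC; ring.
  rewrite (@ge0_integralZl_EFin _ _ _ mu _ measurableT).
  - by rewrite -I0E Gamma_scale.
  - move=> x _; apply: mule_ge0; rewrite lee_fin; first exact: ii0.
    exact: mulr_ge0 (powR_ge0 _ _) (expR_ge0 _).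
  - apply/measurable_EFinP; apply: measurable_funM; first exact: mii.
    by apply: measurable_funM; [exact: measurable_powR|exact: mexp].
  - by rewrite mulr_ge0 ?powR_ge0 ?expR_ge0.
have G0 : 0 < Gamma (p + q) by exact: Gamma_gt0.
have cB (x : R) : 0 < x -> {for x, continuous (fun x => x `^ (p - 1) * (x + b) `^ (- (p + q)))}.
  move=> x0; apply: continuous1M; first exact: continuous_derivable (is_derive1_powR _ x0).
  apply: (continuous_derivable (is_derive1_comp_shift (is_derive1_powR (- (p + q)) _))).
  by rewrite addr_gt0.
have T1 : (\int[mu]_x \int[mu]_y F (x, y) =
    (Gamma (p + q))%:E * \int[mu]_(x in I0) (x `^ (p - 1) * (x + b) `^ (- (p + q)))%:E)%E.
  under eq_integral => x _ do rewrite inner1.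
  rewrite -I0E.
  under eq_integral do rewrite EFinM.
  rewrite (@ge0_integralZl_EFin _ _ _ mu _ mI0).
  - reflexivity.
  - by move=> x _; rewrite lee_fin; exact: mulr_ge0 (powR_ge0 _ _) (powR_ge0 _ _).
  - by apply/measurable_EFinP; exact: measurable_I0.
  - exact: ltW.
have T2 : (\int[mu]_y \int[mu]_x F (x, y) = (Gamma p * (b `^ (- q) * Gamma q))%:E)%E.
  under eq_integral => y _ do rewrite inner2.
  rewrite -I0E; under eq_integral do rewrite EFinM.
  rewrite (@ge0_integralZl_EFin _ _ _ mu _ mI0).
  - by rewrite Gamma_scale.
  - by move=> x _; rewrite lee_fin; exact: mulr_ge0 (powR_ge0 _ _) (expR_ge0 _).
  - apply/measurable_EFinP; apply: measurable_funTS; apply: measurable_funM.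
      exact: measurable_powR.
    exact: mexp.
  - exact: ltW (Gamma_gt0 p0).
rewrite T1 T2 in T.
have -> : (\int[mu]_(x in I0) (x `^ (p - 1) * (x + b) `^ (- (p + q)))%:E =
    ((Gamma (p + q))^-1)%:E * ((Gamma (p + q))%:E * \int[mu]_(x in I0) (x `^ (p - 1) * (x + b) `^ (- (p + q)))%:E))%E.
  by rewrite muleA -EFinM mulVf ?gt_eqF// mul1e.
rewrite T -EFinM; congr EFin.
by rewrite mulrC [Gamma p * _]mulrCA !mulrA.
Qed.

End GammaBeta.

Section RintegralSum.
Variable R : realType.

Lemma Rintegral_sumZ (dT : measure_display) (T : measurableType dT)
    (m : {measure set T -> \bar R}) (D : set T) n (a : 'I_n -> R) (h : 'I_n -> T -> R) :
  measurable D -> (forall i, m.-integrable D (EFin \o h i)) ->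
  m.-integrable D (EFin \o (fun x => \sum_(i < n) a i * h i x)) /\
  \int[m]_(x in D) (\sum_(i < n) a i * h i x) = \sum_(i < n) a i * \int[m]_(x in D) h i x.
Proof.
move=> mD ih.
have ia i : m.-integrable D (EFin \o (fun x => a i * h i x)).
  rewrite (_ : EFin \o _ = (fun x => (a i)%:E * (EFin \o h i) x)%E); last first.
    by apply/funext => x; rewrite /= EFinM.
  by apply: integrableZl => //; exact: ih.
elim: (index_enum _) => [|i s [IH1 IH2]].
  rewrite big_nil; under [in X in _ /\ X]eq_Rintegral do rewrite big_nil.
  split; last by rewrite /Rintegral integral0.
  rewrite (_ : EFin \o _ = cst 0%E); first exact: integrable0.
  by apply/funext => x; rewrite /= big_nil.
rewrite big_cons -IH2 -RintegralZl//.
under [in X in _ /\ X]eq_Rintegral do rewrite big_cons.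
rewrite RintegralD//; split => //.
rewrite (_ : EFin \o _ = ((EFin \o (fun x => a i * h i x)%R) \+
  (EFin \o (fun x => \sum_(j <- s) a j * h j x)%R))%E); last first.
  by apply/funext => x; rewrite /= big_cons EFinD.
exact: integrableD.
Qed.

End RintegralSum.

(** * Mixtures of Gaussian kernels over the scale *)

Section Mixture.
Variables (R : realType) (d : nat) (nu : R).
Hypothesis nu_gt0 : 0 < nu.
Local Notation mu := lebesgue_measure.
Local Notation I0 := (`]0, +oo[%classic : set R).
Implicit Types (t u : 'rV[R]_d) (x : R) (w f g : R -> R).

Definition weight w : Prop :=
  [/\ forall x : R, 0 < x -> {for x, continuous w}, forall x, 0 < x -> 0 <= w x &
      mu.-integrable I0 (EFin \o w)].

Definition mass w : R := \int[mu]_(x in I0) w x.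

Definition mix w t u : R := \int[mu]_(x in I0) (w x * gauss nu x t u).

Lemma continuous_gauss t u x : 0 < x -> {for x, continuous (fun y => gauss nu y t u)}.
Proof.
move=> x0.
apply: (@continuous_comp _ _ _ (fun x : R => - (nu * sqdist t u / x)) expR); last exact: continuous_expR.
apply: continuousN; apply: continuous1M; first exact: continuous1_cst.
by apply: continuousV; [rewrite gt_eqF|exact: continuous1_id].
Qed.

Lemma continuous_qform_gauss n (c : 'I_n -> R) (t : 'I_n -> 'rV[R]_d) x : 0 < x ->
  {for x, continuous (fun y => qform (gauss nu y) c t)}.
Proof.
move=> x0; apply: continuous_at_sum => i; apply: continuous_at_sum => j.
by apply: continuous1M; [exact: continuous1_cst|exact: continuous_gauss].
Qed.

Lemma gauss_le1 x t u : 0 < x -> gauss nu x t u <= 1.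
Proof.
move=> x0; rewrite /gauss -expR0 ler_expR oppr_le0.
exact: divr_ge0 (mulr_ge0 (ltW nu_gt0) (sqdist_ge0 _ _)) (ltW x0).
Qed.

Lemma weight_integrableM w g (M : R) : weight w ->
  (forall x : R, 0 < x -> {for x, continuous g}) -> (forall x, 0 < x -> `|g x| <= M) ->
  mu.-integrable I0 (EFin \o (fun x => w x * g x)).
Proof.
move=> [cw w0 iw] cg gM.
have mI0 : measurable I0 by exact: measurable_itv.
apply: (@le_integrable _ _ _ mu _ mI0 _ (EFin \o (fun x => w x * M))).
- apply/measurable_EFinP; apply: measurable_I0 => x x0.
  by apply: continuous1M; [exact: cw|exact: cg].
- move=> x; rewrite /= in_itv/= andbT => x0; rewrite lee_fin !normrM.
  apply: ler_wpM2l => //; exact: le_trans (gM x x0) (ler_norm _).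
- have -> : (EFin \o (fun x => w x * M)) = (fun x => (EFin \o w) x * M%:E)%E.
    by apply/funext => x; rewrite /= EFinM.
  by apply: integrableZr.
Qed.

Lemma qform_gauss_le n (c : 'I_n -> R) (t : 'I_n -> 'rV[R]_d) x : 0 < x ->
  `|qform (gauss nu x) c t| <= \sum_(i < n) \sum_(j < n) `|c i * c j|.
Proof.
move=> x0; apply: le_trans (ler_norm_sum _ _ _) _; apply: ler_sum => i _.
apply: le_trans (ler_norm_sum _ _ _) _; apply: ler_sum => j _.
rewrite normrM (@ger0_norm _ (gauss _ _ _ _)) ?expR_ge0//.
by rewrite ler_piMr ?normr_ge0 ?gauss_le1.
Qed.

Lemma integrable_weight_gauss w t u : weight w ->
  mu.-integrable I0 (EFin \o (fun x => w x * gauss nu x t u)).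
Proof.
move=> ww; apply: (@weight_integrableM _ _ 1 ww).
  by move=> x; exact: continuous_gauss.
by move=> x x0; rewrite ger0_norm ?expR_ge0// gauss_le1.
Qed.

Lemma integrable_weight_qform w n (c : 'I_n -> R) (t : 'I_n -> 'rV[R]_d) : weight w ->
  mu.-integrable I0 (EFin \o (fun x => w x * qform (gauss nu x) c t)).
Proof.
move=> ww; apply: (weight_integrableM ww).
  by move=> x; exact: continuous_qform_gauss.
by move=> x x0; exact: qform_gauss_le.
Qed.

Lemma qform_mix w n (c : 'I_n -> R) (t : 'I_n -> 'rV[R]_d) : weight w ->
  qform (mix w) c t = \int[mu]_(x in I0) (w x * qform (gauss nu x) c t).
Proof.
move=> ww.
have H i j : mu.-integrable I0 (EFin \o (fun x => w x * gauss nu x (t i) (t j))).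
  exact: integrable_weight_gauss.
have H2 i := @Rintegral_sumZ R _ _ mu I0 n (fun j => c i * c j) _ (measurable_itv _) (H i).
have [_ H3] := @Rintegral_sumZ R _ _ mu I0 n (fun=> 1) _ (measurable_itv _) (fun i => proj1 (H2 i)).
rewrite /qform /mix (eq_bigr _ (fun i _ => esym (proj2 (H2 i)))).
rewrite (eq_bigr _ (fun i _ => esym (mul1r _))) -H3; apply: eq_Rintegral => x _.
rewrite mulr_sumr; apply: eq_bigr => i _; rewrite mul1r mulr_sumr; apply: eq_bigr => j _.
by rewrite mulrCA.
Qed.

Lemma qform_mix_ge0 w n (c : 'I_n -> R) (t : 'I_n -> 'rV[R]_d) : weight w ->
  0 <= qform (mix w) c t.
Proof.
move=> ww; rewrite qform_mix//; apply: Rintegral_ge0 => x.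
rewrite /= in_itv/= andbT => x0; case: ww => _ w0 _.
by rewrite mulr_ge0 ?w0// qform_gauss_ge0.
Qed.

Lemma mixC w t u : mix w t u = mix w u t.
Proof. by apply: eq_Rintegral => x _; rewrite /gauss sqdistC. Qed.

Lemma mix_diag w t : mix w t t = mass w.
Proof.
apply: eq_Rintegral => x _.
by rewrite /gauss sqdist0 mulr0 mul0r oppr0 expR0 mulr1.
Qed.

(** A zero integral forces the continuous nonnegative [G] to vanish on []0, 1[]; but as [x] tends to
    [0] the kernels between distinct sites disappear and [G x] tends to the sum of the
    [c i ^+ 2]. *)
Lemma qform_mix_eq0 w n (c : 'I_n -> R) (t : 'I_n -> 'rV[R]_d) : weight w ->
  (forall x, 0 < x <= 1 -> 0 < w x) ->
  injective t -> qform (mix w) c t = 0 -> forall i, c i = 0.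
Proof.
move=> ww wpos tinj; rewrite qform_mix// => Q0.
case: (ww) => cw w0 iw.
have mI0 : measurable I0 by exact: measurable_itv.
pose G x := qform (gauss nu x) c t.
have cG (x : R) : 0 < x -> {for x, continuous (fun x => w x * G x)}.
  by move=> x0; apply: continuous1M; [exact: cw|exact: continuous_qform_gauss].
have G0 x : 0 < x -> 0 <= G x by move=> x0; exact: qform_gauss_ge0.
have GE (x : R) : 0 < x -> x < 1 -> G x = 0.
  move=> x0 x1; apply/eqP; rewrite eq_le G0// andbT leNgt; apply/negP => Gx.
  have wG : 0 < w x * G x by rewrite mulr_gt0 ?wpos ?x0 ?ltW.
  have /cvgrPdist_lt /(_ (w x * G x / 2)) := cG x x0.
  rewrite divr_gt0// => /(_ isT) /nbhs_ballP[e /= e0 He].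
  have lt1 : (0 < \int[mu]_(x in I0) (w x * G x)%:E)%E.
    apply: (@integral_I0_gt0 _ _ x (x + e / 2) (w x * G x / 2)) => //.
    - by rewrite ltrDl divr_gt0.
    - by rewrite divr_gt0.
    - by move=> y y0; rewrite mulr_ge0 ?w0 ?G0.
    - move=> y /andP[xy yx]; have /He : ball x e y.
        rewrite /ball/= distrC ger0_norm ?subr_ge0//.
        by rewrite ltrBlDl (le_lt_trans yx)// ltrD2l ltr_pdivrMr// ltr_pMr// ltr1n.
      by rewrite /= ltr_norml => /andP[_]; lra.
  move: Q0; rewrite /Rintegral => Q0.
  have := integrable_fin_num _ (integrable_weight_qform c t ww).
  by move=> /(_ mI0)/fineK; rewrite /= Q0 => E; move: lt1; rewrite -E ltxx.
(* From [exp (- a / x) <= x / a] for [a > 0]. The diagonal terms of [M] are [0], since the inverse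
   of [0] is [0]. *)
pose M := \sum_(i < n) \sum_(j < n) `|c i * c j| * (nu * sqdist (t i) (t j))^-1.
have le_x x : 0 < x -> x < 1 -> \sum_i c i ^+ 2 <= M * x.
  move=> x0 x1; have := GE x x0 x1; rewrite /G /qform => E.
  rewrite -[leLHS]subr0 -[X in _ - X]E -sumrB /M mulr_suml; apply: ler_sum => i _.
  rewrite (bigD1 i)//= {1}/gauss sqdist0 mulr0 mul0r oppr0 expR0 mulr1 -expr2.
  rewrite opprD addrA subrr sub0r [in leRHS](bigD1 i)//= sqdist0 mulr0 invr0 mulr0 add0r.
  rewrite -sumrN mulr_suml; apply: ler_sum => j ji.
  have D0 : 0 < sqdist (t i) (t j).
    rewrite lt_neqAle sqdist_ge0 andbT eq_sym psumr_eq0; last by move=> k _; exact: sqr_ge0.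
    apply/negP => /allP H; move/eqP: ji; apply; apply: tinj; apply/rowP => k.
    have := H k (mem_index_enum k); rewrite /= sqrf_eq0 subr_eq0.
    by move/eqP => ->.
  rewrite -mulrN; apply: le_trans (ler_norm _) _; rewrite normrM normrN -mulrA.
  apply: ler_wpM2l => //; rewrite /gauss ger0_norm ?expR_ge0// expRN.
  rewrite -[X in _ <= _ * X]invrK -invfM lef_pV2 ?posrE ?expR_gt0 ?divr_gt0 ?mulr_gt0 ?invr_gt0//.
  by apply: le_trans (expR_ge1Dx _); rewrite lerDr.
have S0 : \sum_i c i ^+ 2 = 0.
  apply/eqP; rewrite eq_le sumr_ge0 ?andbT; last by move=> i _; exact: sqr_ge0.
  apply/ler_addgt0Pr => e e0; rewrite add0r.
  have M0 : 0 <= M.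
    apply: sumr_ge0 => i _; apply: sumr_ge0 => j _; apply: mulr_ge0 => //.
    by rewrite invr_ge0 mulr_ge0 ?sqdist_ge0// ltW.
  pose x := Num.min (1 / 2) (e / (M + 1)).
  have x0 : 0 < x by rewrite lt_min !divr_gt0// ltr_wpDl.
  have x1 : x < 1 by rewrite gt_min ltr_pdivrMr// mul1r ltr1n.
  apply: (le_trans (le_x x x0 x1)).
  apply: (@le_trans _ _ (M * (e / (M + 1)))).
    by rewrite ler_wpM2l// ge_min lexx orbT.
  rewrite mulrCA ler_piMr ?(ltW e0)// ler_pdivrMr ?ltr_wpDl// mul1r lerDl.
  exact: ler01.
move=> i; apply/eqP; rewrite -sqrf_eq0; move/eqP: S0.
by rewrite psumr_eq0 => [/allP/(_ i (mem_index_enum i))//|j _]; exact: sqr_ge0.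
Qed.

(** The kernel decreases with the distance, so dominated convergence along the squared distances
    [1 / (n + 1)], with [w] as the dominating function, is enough. *)
Lemma mix_continuous_diag w (e : R) : weight w -> 0 < e ->
  exists2 eta : R, 0 < eta & forall t u, sqdist t u < eta -> mass w - mix w t u <= e.
Proof.
move=> ww e0; case: (ww) => cw w0 iw.
have mI0 : measurable I0 by exact: measurable_itv.
pose h n x := w x * expR (- (nu * n.+1%:R^-1 / x)).
have ch n (x : R) : 0 < x -> {for x, continuous (fun x => expR (- (nu * n.+1%:R^-1 / x)))}.
  move=> x0.
  apply: (@continuous_comp _ _ _ (fun x : R => - (nu * n.+1%:R^-1 / x)) expR); last exact: continuous_expR.
  apply: continuousN; apply: continuous1M; first exact: continuous1_cst.
  by apply: continuousV; [rewrite gt_eqF|exact: continuous1_id].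
have hle n x : 0 < x -> expR (- (nu * n.+1%:R^-1 / x)) <= 1.
  move=> x0; rewrite -expR0 ler_expR oppr_le0.
  by rewrite divr_ge0 ?mulr_ge0 ?invr_ge0 ?ltW// ltr0n.
have ih n : mu.-integrable I0 (EFin \o h n).
  apply: (@weight_integrableM _ _ 1 ww); first exact: ch.
  by move=> x x0; rewrite ger0_norm ?expR_ge0// hle.
have hcvg (x : R) : 0 < x -> h n x @[n --> \oo] --> w x.
  move=> x0; rewrite -[X in _ --> X]mulr1; apply: cvgM; first exact: cvg_cst.
  rewrite -[X in _ --> X](@expR0 R); apply: continuous_cvg; first exact: continuous_expR.
  rewrite -oppr0; apply: cvgN; rewrite -(mul0r x^-1); apply: cvgM; last exact: cvg_cst.
  rewrite -(mulr0 nu); apply: cvgM; first exact: cvg_cst.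
  exact: cvg_harmonic.
have C : (\int[mu]_(x in I0) (h n x)%:E @[n --> \oo] --> \int[mu]_(x in I0) (w x)%:E)%E.
  apply: (@dominated_cvg _ _ _ mu I0 mI0 (fun n x => (h n x)%:E) (EFin \o w) (EFin \o w)).
  - by move=> n; case/integrableP: (ih n).
  - move=> x; rewrite /= in_itv/= andbT => x0.
    by apply: cvg_EFin; [exact: nearW|exact: hcvg].
  - by [].
  - exact: iw.
  - move=> n x; rewrite /= in_itv/= andbT => x0; rewrite lee_fin /h normrM.
    rewrite !ger0_norm ?expR_ge0 ?w0//.
    by rewrite ler_piMr ?w0 ?hle.
have C' : \int[mu]_(x in I0) h n x @[n --> \oo] --> mass w.
  apply: fine_cvg; by rewrite fineK//; apply: (integrable_fin_num _ iw).
have /cvgrPdist_le/(_ e e0) [N _ /(_ N (leqnn N)) HN] := C'.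
exists (N.+1%:R^-1); first by rewrite invr_gt0 ltr0n.
move=> t u tu; apply: le_trans (le_trans (ler_norm _) HN); rewrite lerB//.
apply: le_Rintegral => //; first exact: integrable_weight_gauss.
move=> x; rewrite /= in_itv/= andbT => x0; rewrite ler_wpM2l ?w0//.
rewrite ler_expR lerN2 ler_wpM2r ?invr_ge0 ?(ltW x0)//.
by rewrite ler_wpM2l ?ltW.
Qed.

End Mixture.

(** * From moments to the comparison of two mixtures *)

Section Comparison.
Variables (R : realType) (d : nat) (nu : R).
Hypothesis nu_gt0 : 0 < nu.
Local Notation mu := lebesgue_measure.
Local Notation I0 := (`]0, +oo[%classic : set R).
Implicit Types (m : 'I_d -> nat) (w : R -> R).

Definition moment m n (c : 'I_n -> R) (t : 'I_n -> 'rV[R]_d) : R :=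
  \sum_(a < n) c a * mono m (t a).

(** For [m = m' = 0] this is, up to the factor [(- nu / x)^p / p!], the term of order [p] in the
    expansion of the Gaussian form. The monomials are the accumulators of the recursion that removes
    the squared distances. *)
Definition pow_form (p : nat) m m' n (c : 'I_n -> R) (t : 'I_n -> 'rV[R]_d) : R :=
  \sum_(a < n) \sum_(b < n)
    (c a * mono m (t a)) * (c b * mono m' (t b)) * sqdist (t a) (t b) ^+ p.

Definition mincr m (i : 'I_d) : 'I_d -> nat := fun j => (m j + (j == i))%N.

Lemma mono_incr m i (t : 'rV[R]_d) : mono (mincr m i) t = mono m t * t 0 i.
Proof.
rewrite /mono /mincr; under eq_bigr do rewrite exprD.
rewrite big_split/=; congr (_ * _).
rewrite (bigD1 i)//= eqxx expr1 big1 ?mulr1// => j /negbTE ->.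
by rewrite expr0.
Qed.

Lemma mono0 (t : 'rV[R]_d) : mono (fun=> 0%N) t = 1.
Proof. by rewrite /mono big1// => i _; rewrite expr0. Qed.

Lemma sum_mincr m i : (\sum_j mincr m i j = (\sum_j m j).+1)%N.
Proof.
rewrite /mincr big_split/= (bigD1 i (F := fun j => nat_of_bool (j == i)))//= eqxx.
by rewrite [X in (_ + (_ + X))%N]big1 ?addn0 ?addn1// => j /negbTE ->.
Qed.

(** In each coordinate [(t_i - u_i)^2 = t_i^2 - 2 t_i u_i + u_i^2], each factor going to the
    monomial of its own site; repeated, this leaves products of two moments. *)
Lemma pow_formS p m m' n (c : 'I_n -> R) (t : 'I_n -> 'rV[R]_d) :
  pow_form p.+1 m m' c t = \sum_(i < d)
    (pow_form p (mincr (mincr m i) i) m' c t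
     - 2 * pow_form p (mincr m i) (mincr m' i) c t
     + pow_form p m (mincr (mincr m' i) i) c t).
Proof.
rewrite (eq_bigr (fun i => \sum_(a < n) \sum_(b < n)
    (c a * mono m (t a)) * (c b * mono m' (t b)) * ((t a 0 i - t b 0 i) ^+ 2 * sqdist (t a) (t b) ^+ p))).
  rewrite exchange_big; apply: eq_bigr => a _ /=.
  rewrite exchange_big; apply: eq_bigr => b _ /=.
  by rewrite -mulr_sumr -mulr_suml exprS.
move=> i _; rewrite /pow_form mulr_sumr -sumrB -big_split; apply: eq_bigr => a _ /=.
rewrite mulr_sumr -sumrB -big_split; apply: eq_bigr => b _ /=.
rewrite !mono_incr; ring.
Qed.

Lemma pow_form0 m m' n (c : 'I_n -> R) (t : 'I_n -> 'rV[R]_d) :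
  pow_form 0 m m' c t = moment m c t * moment m' c t.
Proof.
rewrite /moment mulr_suml; apply: eq_bigr => a _; rewrite mulr_sumr.
by apply: eq_bigr => b _; rewrite expr0 mulr1.
Qed.

(** Removing one squared distance has total weight [4 = 1 + 2 + 1] in each of the [d] coordinates
    and adds two to the total degree. The degrees are tracked against [N] because [mix_comparison]
    controls finitely many moments only. *)
Lemma pow_form_le (r A : R) N n (c : 'I_n -> R) (t : 'I_n -> 'rV[R]_d) :
  0 <= r -> 1 <= A ->
  (forall m, (\sum_i m i <= N)%N -> `|moment m c t| <= r * A ^+ (\sum_i m i)) ->
  forall p m m', (\sum_i m i + 2 * p <= N)%N -> (\sum_i m' i + 2 * p <= N)%N ->
  `|pow_form p m m' c t| <= r ^+ 2 * (4 * d%:R * A ^+ 2) ^+ p * A ^+ (\sum_i m i + \sum_i m' i).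
Proof.
move=> r0 A1 H; elim=> [|p IH] m m' mN m'N.
  rewrite pow_form0 normrM expr0 mulr1 exprD expr2.
  apply: (@le_trans _ _ ((r * A ^+ (\sum_i m i)) * (r * A ^+ (\sum_i m' i)))).
    by apply: ler_pM => //; apply: H; move: mN m'N; rewrite muln0 !addn0.
  by rewrite le_eqVlt; apply/orP; left; apply/eqP; ring.
rewrite pow_formS; apply: (le_trans (ler_norm_sum _ _ _)).
set B := r ^+ 2 * (4 * d%:R * A ^+ 2) ^+ p * A ^+ ((\sum_i m i + \sum_i m' i).+2).
have hS : (2 * p.+1 = (2 * p).+2)%N by rewrite !mul2n.
apply: (@le_trans _ _ (\sum_(i < d) (4 * B))).
  apply: ler_sum => i _.
  have b1 : `|pow_form p (mincr (mincr m i) i) m' c t| <= B.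
    have h1 : (\sum_j mincr (mincr m i) i j + 2 * p <= N)%N.
      by rewrite !sum_mincr; move: mN; rewrite hS !addSn !addnS.
    have h2 : (\sum_j m' j + 2 * p <= N)%N.
      by apply: leq_trans m'N; rewrite leq_add2l leq_mul2l/=.
    by have := IH _ _ h1 h2; rewrite !sum_mincr !addSn.
  have b2 : `|pow_form p (mincr m i) (mincr m' i) c t| <= B.
    have h1 : (\sum_j mincr m i j + 2 * p <= N)%N.
      by rewrite !sum_mincr; apply: leq_trans mN; rewrite hS !addSn !addnS ltnW.
    have h2 : (\sum_j mincr m' i j + 2 * p <= N)%N.
      by rewrite !sum_mincr; apply: leq_trans m'N; rewrite hS !addSn !addnS ltnW.
    by have := IH _ _ h1 h2; rewrite !sum_mincr !addSn !addnS.
  have b3 : `|pow_form p m (mincr (mincr m' i) i) c t| <= B.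
    have h1 : (\sum_j m j + 2 * p <= N)%N.
      by apply: leq_trans mN; rewrite leq_add2l leq_mul2l/=.
    have h2 : (\sum_j mincr (mincr m' i) i j + 2 * p <= N)%N.
      by rewrite !sum_mincr; move: m'N; rewrite hS !addSn !addnS.
    by have := IH _ _ h1 h2; rewrite !sum_mincr !addnS.
  apply: (le_trans (ler_normD _ _)).
  apply: (@le_trans _ _ (`|pow_form p (mincr (mincr m i) i) m' c t| + `|2 * pow_form p (mincr m i) (mincr m' i) c t| + B)).
    by apply: lerD => //; exact: ler_normB.
  by rewrite normrM (ger0_norm (ler0n R 2)); lra.
rewrite sumr_const card_ord -[_ *+ d]mulr_natr.
rewrite le_eqVlt; apply/orP; left; apply/eqP.
by rewrite /B [_ ^+ p.+1]exprS -[(_ + _).+2]addn2 exprD; ring.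
Qed.

Lemma cvg_qform_gauss (x : R) n (c : 'I_n -> R) (t : 'I_n -> 'rV[R]_d) :
  \sum_(0 <= p < P) (- (nu / x)) ^+ p / p`!%:R * pow_form p (fun=> 0%N) (fun=> 0%N) c t
    @[P --> \oo] --> qform (gauss nu x) c t.
Proof.
have -> : (fun P => \sum_(0 <= p < P) (- (nu / x)) ^+ p / p`!%:R * pow_form p (fun=> 0%N) (fun=> 0%N) c t) =
    (fun P => \sum_(i < n) \sum_(j < n) (c i * c j) * series (exp_coeff (- (nu / x) * sqdist (t i) (t j))) P).
  apply/funext => P; rewrite /pow_form; under eq_bigr do rewrite mulr_sumr.
  rewrite exchange_big; apply: eq_bigr => i _ /=.
  under eq_bigr do rewrite mulr_sumr.
  rewrite exchange_big; apply: eq_bigr => j _ /=.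
  rewrite /series/= mulr_sumr; apply: eq_bigr => k _.
  by rewrite exp_coeffE/= exprMn !mono0; ring.
rewrite /qform; apply: cvg_sum_seq => i; apply: cvg_sum_seq => j.
apply: cvgM; first exact: cvg_cst.
rewrite /gauss; have -> : - (nu * sqdist (t i) (t j) / x) = - (nu / x) * sqdist (t i) (t j) by ring.
exact: is_cvg_series_exp_coeff.
Qed.

Lemma series_exp_coeff_le (x : R) P : 0 <= x -> series (exp_coeff x) P <= expR x.
Proof.
move=> x0; apply: nondecreasing_cvgn_le; last exact: is_cvg_series_exp_coeff.
apply: nondecreasing_series => i _ _; exact: exp_coeff_ge0.
Qed.

(** Two bounds are balanced: the terms below [P] use the possibly small [E1], the others the
    unconditional [E2] together with the remainder of an exponential series. Uniformity in [x] comes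
    from [nu / x <= nu / delta]. *)
Lemma qform_gauss_far (x delta E1 q1 E2 q2 : R) P n (c : 'I_n -> R) (t : 'I_n -> 'rV[R]_d) :
  0 < delta <= x -> 0 <= E1 -> 0 <= q1 -> 0 <= E2 -> 0 <= q2 ->
  (forall p, (p < P)%N -> `|pow_form p (fun=> 0%N) (fun=> 0%N) c t| <= E1 * q1 ^+ p) ->
  (forall p, `|pow_form p (fun=> 0%N) (fun=> 0%N) c t| <= E2 * q2 ^+ p) ->
  `|qform (gauss nu x) c t| <= E1 * expR (nu / delta * q1) +
    E2 * (expR (nu / delta * q2) - series (exp_coeff (nu / delta * q2)) P).
Proof.
move=> /andP[d0 dx] E10 q10 E20 q20 F1 F2; set v := nu / delta.
have x0 : 0 < x by exact: lt_le_trans dx.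
have v0 : 0 <= v by exact: divr_ge0 (ltW nu_gt0) (ltW d0).
have vx : `|- (nu / x)| <= v.
  rewrite normrN ger0_norm; last exact: divr_ge0 (ltW nu_gt0) (ltW x0).
  by rewrite /v ler_pM2l// lef_pV2 ?posrE.
have C : `|\sum_(0 <= p < M) (- (nu / x)) ^+ p / p`!%:R * pow_form p (fun=> 0%N) (fun=> 0%N) c t|
    @[M --> \oo] --> `|qform (gauss nu x) c t|.
  by apply: cvg_norm; exact: cvg_qform_gauss.
rewrite -(cvg_lim _ C)//; apply: limr_le; first by apply: cvgP; exact: C.
near=> M; have PM : (P <= M)%N by near: M; exact: nbhs_infty_ge.
apply: (le_trans (ler_norm_sum _ _ _)).
have term p K q : `|pow_form p (fun=> 0%N) (fun=> 0%N) c t| <= K * q ^+ p ->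
    `|(- (nu / x)) ^+ p / p`!%:R * pow_form p (fun=> 0%N) (fun=> 0%N) c t| <= K * exp_coeff (v * q) p.
  move=> h; rewrite normrM normrM normrX.
  have -> : K * exp_coeff (v * q) p = v ^+ p / p`!%:R * (K * q ^+ p).
    by rewrite exp_coeffE/= exprMn; ring.
  apply: ler_pM => //.
  rewrite normfV normr_nat ler_wpM2r ?invr_ge0 ?ler0n//.
  by rewrite lerXn2r ?nnegrE.
rewrite (big_cat_nat (n := P))//=; apply: lerD.
  apply: (@le_trans _ _ (E1 * series (exp_coeff (v * q1)) P)); last first.
    by rewrite ler_wpM2l// series_exp_coeff_le// mulr_ge0.
  rewrite /series/= mulr_sumr 2!big_mkord; apply: ler_sum => p _; apply: term; exact: F1.
apply: (@le_trans _ _ (E2 * (series (exp_coeff (v * q2)) M - series (exp_coeff (v * q2)) P))).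
  rewrite /series/= [X in _ * (X - _)](big_cat_nat (n := P))//= addrAC subrr add0r mulr_sumr.
  by apply: ler_sum => p _; apply: term; exact: F2.
by rewrite ler_wpM2l// lerB// series_exp_coeff_le// mulr_ge0.
Unshelve. all: by end_near.
Qed.

(** The free parameter is optimized at [th = I^(-1/2)]; when [I = 0] it is made arbitrarily
    large. *)
Lemma ler_theta_sqr (y K I : R) : 0 <= y -> 0 <= K -> 0 <= I ->
  (forall th, 0 < th -> y <= K * (th * I + th^-1)) -> y ^+ 2 <= 4 * K ^+ 2 * I.
Proof.
move=> y0 K0 I0 H; have [I0'|I_gt0] := eqVneq I 0.
  suff -> : y = 0 by rewrite expr0n/= !mulr_ge0// sqr_ge0.
  apply/eqP; rewrite eq_le y0 andbT; apply/ler_addgt0Pr => e e0; rewrite add0r.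
  have K1 : 0 < K + 1 by rewrite ltr_wpDl.
  have := H ((K + 1) / e) (divr_gt0 K1 e0); rewrite I0' mulr0 add0r invf_div.
  move/le_trans; apply; rewrite mulrCA ler_piMr ?(ltW e0)// ler_pdivrMr// mul1r.
  by rewrite lerDl.
have {}I_gt0 : 0 < I by rewrite lt_neqAle eq_sym I_gt0.
pose s := Num.sqrt I; have s0 : 0 < s by rewrite sqrtr_gt0.
have sE : I = s ^+ 2 by rewrite sqr_sqrtr.
have := H s^-1; rewrite invr_gt0 invrK => /(_ s0).
have -> : s^-1 * I + s = 2 * s by rewrite sE; field; rewrite gt_eqF.
move=> h; have -> : 4 * K ^+ 2 * I = (K * (2 * s)) ^+ 2 by rewrite sE; ring.
by rewrite lerXn2r ?nnegrE ?mulr_ge0// ltW.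
Qed.

Definition in_box (rho : R) n (t : 'I_n -> 'rV[R]_d) : Prop := forall a i, `|t a 0 i| <= rho.

(** As the weight dominates [c0 x^(nu - 1)] on []0, 1]], the value [I = Q / c0] is admissible in
    [mono_bound] whatever the truncation [e]. *)
Lemma moment_bound w (c0 rho : R) : weight w -> 0 < c0 -> 0 <= rho ->
  (forall x, 0 < x <= 1 -> c0 * x `^ (nu - 1) <= w x) ->
  exists C A : R, [/\ 0 <= C, 1 <= A & forall n (c : 'I_n -> R) (t : 'I_n -> 'rV[R]_d) m,
    in_box rho t ->
    moment m c t ^+ 2 <= C * (A ^+ (\sum_i m i)) ^+ 2 * qform (mix nu w) c t].
Proof.
move=> ww c00 rho0 wc; have [C [A [C0 A1 H]]] := mono_bound d nu_gt0 rho0.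
have A0 : 0 <= A := le_trans ler01 A1.
exists (4 * C ^+ 2 / c0), A; split => //.
  exact: divr_ge0 (mulr_ge0 (ler0n _ _) (sqr_ge0 _)) (ltW c00).
move=> n c t m bt; set Q := qform (mix nu w) c t.
have Q0 : 0 <= Q by exact: qform_mix_ge0.
rewrite -[leLHS](real_normK (num_real _)).
have -> : 4 * C ^+ 2 / c0 * (A ^+ (\sum_i m i)) ^+ 2 * Q =
    4 * (C * A ^+ (\sum_i m i)) ^+ 2 * (Q / c0) by ring.
apply: ler_theta_sqr => //.
- by rewrite mulr_ge0 ?exprn_ge0.
- exact: divr_ge0 Q0 (ltW c00).
move=> th th0; apply: (H n c t m _ th bt) => // e /andP[e0 e1].
rewrite ler_pdivlMr// mulrC.
have sub := itv_subset_I0 (b := 1) e0.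
have mI0 : measurable I0 by exact: measurable_itv.
have me1 : measurable (`[e, 1]%classic : set R) by exact: measurable_itv.
have iq := integrable_weight_qform nu_gt0 c t ww.
have iq1 : mu.-integrable `[e, 1] (EFin \o (fun x => w x * qform (gauss nu x) c t)).
  by apply: (integrableS _ _ _ iq).
have ip : mu.-integrable `[e, 1] (EFin \o (fun x => x `^ (nu - 1) * qform (gauss nu x) c t)).
  apply: continuous_itv_integrable => x; rewrite in_itv/= => /andP[ex _].
  have x0 : 0 < x := lt_le_trans e0 ex.
  apply: continuous1M; first exact: continuous_derivable (is_derive1_powR _ x0).
  exact: continuous_qform_gauss.
rewrite -RintegralZl//.
apply: (@le_trans _ _ (\int[mu]_(x in `[e, 1]) (w x * qform (gauss nu x) c t))).
  apply: le_Rintegral => //.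
    rewrite (_ : EFin \o _ = (fun x => c0%:E * (EFin \o (fun x => x `^ (nu - 1) * qform (gauss nu x) c t)%R) x)%E).
      by apply: integrableZl.
    by apply/funext => x; rewrite /= EFinM.
  move=> x; rewrite /= in_itv/= => /andP[ex x1]; have x0 : 0 < x := lt_le_trans e0 ex.
  by rewrite mulrA ler_wpM2r ?qform_gauss_ge0// wc// x0.
rewrite /Q qform_mix// /Rintegral fine_le//.
- exact: integrable_fin_num iq1.
- exact: integrable_fin_num iq.
- apply: ge0_subset_integral => //; first by case/integrableP: iq.
  move=> x; rewrite /= in_itv/= andbT => x0; rewrite lee_fin.
  by case: ww => _ w0 _; rewrite mulr_ge0 ?w0 ?qform_gauss_ge0.
Qed.

(** Below [delta] the weights are relatively close; above it [|w1 - w0| <= w0 + w1] is integrated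
    against a uniform bound for the Gaussian form. *)
Lemma qform_mix_dist w0 w1 (e delta S : R) n (c : 'I_n -> R) (t : 'I_n -> 'rV[R]_d) :
  weight w0 -> weight w1 -> 0 < delta -> 0 <= e -> 0 <= S ->
  (forall x, 0 < x < delta -> `|w1 x - w0 x| <= e * w0 x) ->
  (forall x, delta <= x -> `|qform (gauss nu x) c t| <= S) ->
  `|qform (mix nu w1) c t - qform (mix nu w0) c t| <=
    e * qform (mix nu w0) c t + S * (mass w0 + mass w1).
Proof.
move=> ww0 ww1 d0 e0 S0 we GS; have mI0 : measurable I0 by exact: measurable_itv.
rewrite !qform_mix//.
have i0 := integrable_weight_qform nu_gt0 c t ww0.
have i1 := integrable_weight_qform nu_gt0 c t ww1.
case: (ww0) => cw0 p0 iw0; case: (ww1) => cw1 p1 iw1.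
have iZ (a : R) (f : R -> R) : mu.-integrable I0 (EFin \o f) -> mu.-integrable I0 (EFin \o (fun x => a * f x)).
  move=> fi; rewrite (_ : EFin \o _ = (fun x => a%:E * (EFin \o f) x)%E).
    by apply: integrableZl.
  by apply/funext => x; rewrite /= EFinM.
have iD (f g : R -> R) : mu.-integrable I0 (EFin \o f) -> mu.-integrable I0 (EFin \o g) -> mu.-integrable I0 (EFin \o (fun x => f x + g x)).
  by move=> fi gi; rewrite (_ : EFin \o _ = ((EFin \o f) \+ (EFin \o g))%E)//; exact: integrableD.
rewrite -RintegralB// /mass -RintegralD// -!RintegralZl//; last exact: iD.
rewrite -RintegralD//; last 2 first.
- exact: iZ.
- by apply: iZ; exact: iD.
have iB : mu.-integrable I0 (EFin \o (fun x => w1 x * qform (gauss nu x) c t - w0 x * qform (gauss nu x) c t)).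
  rewrite (_ : EFin \o _ = ((EFin \o (fun x => w1 x * qform (gauss nu x) c t)%R) \- (EFin \o (fun x => w0 x * qform (gauss nu x) c t)%R))%E)//.
  by apply: integrableB.
apply: le_trans; first by apply: le_normr_Rintegral => //; exact: iB.
apply: le_Rintegral => //.
- rewrite (_ : EFin \o _ = (abse \o (EFin \o (fun x => w1 x * qform (gauss nu x) c t - w0 x * qform (gauss nu x) c t)%R)))//.
  exact: integrable_abse.
- by apply: (iD); apply: iZ => //; exact: iD.
move=> x; rewrite /= in_itv/= andbT => x0.
have G0 := qform_gauss_ge0 nu_gt0 c t x0.
have w00 := p0 x x0; have w10 := p1 x x0.
rewrite -mulrBl normrM; have [xd|dx] := ltP x delta.
  rewrite (ger0_norm G0) mulrA ler_wpDr ?mulr_ge0 ?addr_ge0//.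
  by rewrite ler_wpM2r// we// x0.
rewrite ler_wpDl ?mulr_ge0// mulrC.
apply: ler_pM => //; first exact: GS.
by rewrite (le_trans (ler_normB _ _))// !ger0_norm// addrC.
Qed.

Section Weights.
Variables (w0 w1 : R -> R) (c0 rho : R).
Hypotheses (ww0 : weight w0) (ww1 : weight w1) (c0_gt0 : 0 < c0) (rho_ge0 : 0 <= rho).
Hypothesis w0_ge : forall x, 0 < x <= 1 -> c0 * x `^ (nu - 1) <= w0 x.
Hypothesis w01 : forall e : R, 0 < e -> exists2 delta, 0 < delta &
  forall x, 0 < x < delta -> `|w1 x - w0 x| <= e * w0 x.

Lemma pow_form_bound : exists C q : R, [/\ 0 <= C, 0 <= q &
  forall n (c : 'I_n -> R) (t : 'I_n -> 'rV[R]_d), in_box rho t ->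
  forall p, `|pow_form p (fun=> 0%N) (fun=> 0%N) c t| <= C * qform (mix nu w0) c t * q ^+ p].
Proof.
have [C [A [C0 A1 H]]] := moment_bound ww0 c0_gt0 rho_ge0 w0_ge.
exists C, (4 * d%:R * A ^+ 2); split => //.
  exact: mulr_ge0 (mulr_ge0 (ler0n _ _) (ler0n _ _)) (sqr_ge0 _).
move=> n c t bt p; have Q0 := qform_mix_ge0 nu_gt0 c t ww0.
have r0 := sqrtr_ge0 (C * qform (mix nu w0) c t).
have := @pow_form_le _ A (2 * p) n c t r0 A1 _ p (fun=> 0%N) (fun=> 0%N).
rewrite !big1// => /(_ _ (leqnn _) (leqnn _)); rewrite mulr1 sqr_sqrtr ?mulr_ge0//; apply.
move=> m _; rewrite -sqrtr_sqr -[A ^+ _]ger0_norm ?exprn_ge0 ?(le_trans ler01)//.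
rewrite -[X in _ * X]sqrtr_sqr -sqrtrM ?mulr_ge0// ler_wsqrtr//.
by rewrite mulrAC H.
Qed.

(** The far bound is used with [P = 0]: the whole expansion falls under the unconditional estimate,
    so no moment has to be small. *)
Lemma mix_dominated : exists2 L : R, 0 <= L &
  forall n (c : 'I_n -> R) (t : 'I_n -> 'rV[R]_d), in_box rho t ->
  qform (mix nu w1) c t <= L * qform (mix nu w0) c t.
Proof.
have [C [q [C0 q0 H]]] := pow_form_bound.
have [delta d0 wd] := w01 ltr01.
have M0 w : weight w -> 0 <= mass w.
  by move=> [_ p _]; apply: Rintegral_ge0 => x; rewrite /= in_itv/= andbT; exact: p.
exists (2 + C * expR (nu / delta * q) * (mass w0 + mass w1)).
  by rewrite addr_ge0 ?mulr_ge0 ?expR_ge0 ?addr_ge0 ?M0.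
move=> n c t bt; have Q0 := qform_mix_ge0 nu_gt0 c t ww0.
have CQ0 : 0 <= C * qform (mix nu w0) c t by rewrite mulr_ge0.
have S0 : 0 <= C * qform (mix nu w0) c t * expR (nu / delta * q).
  by rewrite mulr_ge0 ?expR_ge0.
have := qform_mix_dist (c := c) (t := t) ww0 ww1 d0 ler01 S0 wd.
set Q := qform (mix nu w0) c t in CQ0 S0 Q0 *; set Q' := qform (mix nu w1) c t.
have bound x : delta <= x -> `|qform (gauss nu x) c t| <= C * Q * expR (nu / delta * q).
  move=> dx; have dx' : 0 < delta <= x by rewrite d0.
  have := @qform_gauss_far x delta 0 0 (C * Q) q 0 n c t dx' (lexx _) (lexx _) CQ0 q0 _ (H n c t bt).
  by rewrite mul0r add0r /series/= big_geq// subr0; apply.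
move=> h; have {}h := h bound; have := ler_norm (Q' - Q) => h2.
have {}h := le_trans h2 h; rewrite mul1r in h.
rewrite mulrDl; move: h; rewrite lerBlDr => /le_trans; apply.
by rewrite le_eqVlt; apply/orP; left; apply/eqP; ring.
Qed.

Lemma mix_comparison (e : R) : 0 < e -> exists (N : nat) (eta : R), 0 < eta /\
  forall n (c : 'I_n -> R) (t : 'I_n -> 'rV[R]_d), in_box rho t ->
  (forall m, (\sum_i m i <= N)%N -> moment m c t ^+ 2 <= eta * qform (mix nu w0) c t) ->
  `|qform (mix nu w1) c t - qform (mix nu w0) c t| <= e * qform (mix nu w0) c t.
Proof.
move=> e0; have [C [q [C0 q0 H]]] := pow_form_bound.
(* Half of [e] goes to the scales below [delta]; above it, a quarter goes to the first [P] terms and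
   a quarter to the tail. [P] is fixed by the tail, and the first [P] terms involve only moments of
   degree at most [2 P], whence [N] and [eta]. *)
have e2 : 0 < e / 2 by rewrite divr_gt0.
have [delta d0 wd] := w01 e2.
have M0 w : weight w -> 0 <= mass w.
  by move=> [_ p _]; apply: Rintegral_ge0 => x; rewrite /= in_itv/= andbT; exact: p.
pose M := mass w0 + mass w1 + 1.
have M_gt0 : 0 < M by rewrite ltr_wpDl// addr_ge0 ?M0.
pose v := nu / delta * q.
pose e' := e / 4 / M / (C + 1).
have C1 : 0 < C + 1 by rewrite ltr_wpDl.
have e'0 : 0 < e' by rewrite !divr_gt0.
have : series (exp_coeff v) P @[P --> \oo] --> expR v by exact: is_cvg_series_exp_coeff.
move=> /cvgrPdist_le /(_ e' e'0) [P _ /(_ P (leqnn P)) HP].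
pose E := expR (nu / delta * (4 * d%:R)).
have E0 : 0 < E by exact: expR_gt0.
exists (2 * P)%N, (e / 4 / M / E); split; first by rewrite !divr_gt0.
set eta := e / 4 / M / E => n c t bt hm.
have eta0 : 0 < eta by rewrite !divr_gt0.
have Q0 := qform_mix_ge0 nu_gt0 c t ww0.
set Q := qform (mix nu w0) c t in hm Q0 *; set Q' := qform (mix nu w1) c t.
have CQ0 : 0 <= C * Q by rewrite mulr_ge0.
have etaQ0 : 0 <= eta * Q by exact: mulr_ge0 (ltW eta0) Q0.
have q10 : 0 <= 4 * d%:R :> R by rewrite mulr_ge0.
(* All moments of degree up to [2 P] obey the same bound [sqrt (eta * Q)], so the base [A] can be
   [1]. *)
have F1 p : (p < P)%N -> `|pow_form p (fun=> 0%N) (fun=> 0%N) c t| <= eta * Q * (4 * d%:R) ^+ p.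
  move=> pP.
  have := @pow_form_le _ 1 (2 * P) n c t (sqrtr_ge0 (eta * Q)) (lexx _) _ p (fun=> 0%N) (fun=> 0%N).
  have pP2 : (2 * p <= 2 * P)%N by rewrite leq_mul2l/= ltnW.
  rewrite !big1// => /(_ _ pP2 pP2); rewrite mulr1 sqr_sqrtr// expr1n mulr1; apply.
  move=> m mP; rewrite expr1n mulr1 -sqrtr_sqr ler_wsqrtr//; exact: hm.
have bound x : delta <= x -> `|qform (gauss nu x) c t| <= e / 2 / M * Q.
  move=> dx; have dx' : 0 < delta <= x by rewrite d0.
  apply: (le_trans (qform_gauss_far dx' etaQ0 q10 CQ0 q0 F1 (H n c t bt))).
  rewrite -/v -/E.
  have -> : e / 2 / M * Q = e / 4 / M * Q + e / 4 / M * Q.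
    by field; rewrite gt_eqF.
  apply: lerD.
    by rewrite /eta mulrAC divfK ?gt_eqF.
  apply: (@le_trans _ _ (C * Q * e')).
    by rewrite ler_wpM2l// (le_trans (ler_norm _)).
  have -> : C * Q * e' = (C / (C + 1)) * (e / 4 / M * Q) by rewrite /e'; ring.
  rewrite ler_piMl//; first exact: mulr_ge0 (divr_ge0 (divr_ge0 (ltW e0) (ler0n _ _)) (ltW M_gt0)) Q0.
  by rewrite ler_pdivrMr// mul1r lerDl.
have S0 : 0 <= e / 2 / M * Q by exact: mulr_ge0 (divr_ge0 (ltW e2) (ltW M_gt0)) Q0.
have := qform_mix_dist ww0 ww1 d0 (ltW e2) S0 wd bound.
move/le_trans; apply.
have -> : e * Q = e / 2 * Q + e / 2 / M * Q * M by field; rewrite gt_eqF.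
by rewrite lerD2l ler_wpM2l// lerDl.
Qed.

End Weights.

End Comparison.

(** * The CH correlation as a mixture of total mass one *)

Section CHWeight.
Variables (R : realType) (d : nat) (nu : R).
Hypothesis nu_gt0 : 0 < nu.
Local Notation mu := lebesgue_measure.
Local Notation I0 := (`]0, +oo[%classic : set R).
Implicit Types (a b x : R) (t u : 'rV[R]_d).

Definition ch_const a b : R := b `^ (2 * a) * Gamma (nu + a) / (Gamma nu * Gamma a).

Definition ch_weight a b x : R := x `^ (nu - 1) * (x + b ^+ 2) `^ (- (nu + a)).

Definition ch_density a b x : R := ch_const a b * ch_weight a b x.

(* Up to the factor [Gamma nu], the coefficient of [x `^ (nu - 1)] in the
   density at the origin, i.e. the parameter matched in part (b). *)
Definition micro a b : R := b `^ (- (2 * nu)) * Gamma (nu + a) / Gamma a.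

Definition ch (t1 : R * R) : 'rV[R]_d -> 'rV[R]_d -> R := fun t u => CH_corr nu t1 (eucl_dist t u).

Lemma ch_const_gt0 a b : 0 < a -> 0 < b -> 0 < ch_const a b.
Proof.
move=> a0 b0; rewrite /ch_const divr_gt0 ?mulr_gt0 ?powR_gt0 ?Gamma_gt0//.
by rewrite addr_gt0.
Qed.

Lemma micro_gt0 a b : 0 < a -> 0 < b -> 0 < micro a b.
Proof.
by move=> a0 b0; rewrite /micro divr_gt0 ?mulr_gt0 ?powR_gt0 ?Gamma_gt0// addr_gt0.
Qed.

Let cshift r b x : 0 < b -> 0 <= x -> {for x, continuous (fun x => (x + b ^+ 2) `^ r)}.
Proof.
move=> b0 x0; apply: (continuous_derivable (is_derive1_comp_shift (is_derive1_powR r _))).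
by rewrite ltr_wpDl// exprn_gt0.
Qed.

Let ch_weight_cont a b x : 0 < b -> 0 < x -> {for x, continuous (ch_weight a b)}.
Proof.
move=> b0 x0; apply: continuous1M; first exact: continuous_derivable (is_derive1_powR _ x0).
exact: cshift (ltW x0).
Qed.

Let ch_weight_ge0 a b x : 0 <= ch_weight a b x.
Proof. by rewrite mulr_ge0 ?powR_ge0. Qed.

Lemma weight_ch_weight a b : 0 < a -> 0 < b -> weight (ch_weight a b).
Proof.
move=> a0 b0; split => [x|x _|]; [exact: ch_weight_cont|exact: ch_weight_ge0|].
apply/integrableP; split.
  by apply/measurable_EFinP; apply: measurable_I0 => x; exact: ch_weight_cont.
under eq_integral do rewrite /= ger0_norm ?ch_weight_ge0//.
by rewrite Beta_integral ?exprn_gt0// ltry.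
Qed.

Lemma weightZ (k : R) (w : R -> R) : 0 <= k -> weight w -> weight (fun x => k * w x).
Proof.
move=> k0 [cw w0 iw]; split => [x x0|x x0|].
- by apply: continuous1M; [exact: continuous1_cst|exact: cw].
- by rewrite mulr_ge0// w0.
- rewrite (_ : EFin \o _ = (fun x => k%:E * (EFin \o w) x)%E).
    by apply: integrableZl.
  by apply/funext => x; rewrite /= EFinM.
Qed.

Lemma mixZ (k : R) (w : R -> R) t u : weight w -> mix nu (fun x => k * w x) t u = k * mix nu w t u.
Proof.
move=> ww; rewrite /mix -RintegralZl//; last exact: integrable_weight_gauss.
by apply: eq_Rintegral => x _; rewrite mulrA.
Qed.

Lemma massZ (k : R) (w : R -> R) : weight w -> mass (fun x => k * w x) = k * mass w.
Proof. by move=> [_ _ iw]; rewrite /mass RintegralZl. Qed.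

Lemma mass_ch_density a b : 0 < a -> 0 < b -> mass (ch_density a b) = 1.
Proof.
move=> a0 b0; rewrite massZ; last exact: weight_ch_weight.
have b2 : 0 < b ^+ 2 by rewrite exprn_gt0.
rewrite /mass /Rintegral Beta_integral//= /ch_const.
have G1 := Gamma_gt0 nu_gt0; have G2 := Gamma_gt0 a0.
have G3 := Gamma_gt0 (addr_gt0 nu_gt0 a0).
have -> : (b ^+ 2) `^ (- a) = (b `^ (2 * a))^-1.
  by rewrite -powR_mulrn ?(ltW b0)// -powRrM -powRN mulrN.
have B0 : 0 < b `^ (2 * a) by rewrite powR_gt0.
move: G1 G2 G3 B0; move: (Gamma nu) (Gamma a) (Gamma (nu + a)) (b `^ (2 * a)).
move=> ? ? ? ? /lt0r_neq0 H1 /lt0r_neq0 H2 /lt0r_neq0 H3 /lt0r_neq0 H4.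
by field; rewrite H1 H2 H3 H4.
Qed.

Lemma weight_ch_density a b : 0 < a -> 0 < b -> weight (ch_density a b).
Proof.
move=> a0 b0; apply: weightZ; last exact: weight_ch_weight.
by rewrite ltW ?ch_const_gt0.
Qed.

Lemma ch_mix a b : 0 < a -> 0 < b -> ch (a, b) = mix nu (ch_density a b).
Proof.
move=> a0 b0; apply/funext => t; apply/funext => u.
rewrite /ch /CH_corr /CH_cov /= mul1r.
rewrite mixZ; last exact: weight_ch_weight.
congr (_ * _); apply: eq_Rintegral => x _.
rewrite /gauss /eucl_dist sqr_sqrtr//.
by apply: sumr_ge0 => i _; exact: sqr_ge0.
Qed.

Lemma ch_density_ge a b : 0 < a -> 0 < b -> exists2 c : R, 0 < c &
  forall x, 0 < x <= 1 -> c * x `^ (nu - 1) <= ch_density a b x.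
Proof.
move=> a0 b0; exists (ch_const a b * (1 + b ^+ 2) `^ (- (nu + a))).
  by rewrite mulr_gt0 ?ch_const_gt0 ?powR_gt0// ltr_wpDl// exprn_gt0.
move=> x /andP[x0 x1]; rewrite /ch_density /ch_weight -mulrA.
rewrite ler_wpM2l ?(ltW (ch_const_gt0 _ _))// mulrC ler_wpM2l ?powR_ge0//.
have b2 : 0 < b ^+ 2 by rewrite exprn_gt0.
have p1 : 0 < x + b ^+ 2 by rewrite addr_gt0.
have p2 : 0 < 1 + b ^+ 2 by rewrite addr_gt0.
rewrite !powRN lef_pV2 ?posrE ?powR_gt0//.
apply: ge0_ler_powR; rewrite ?nnegrE ?(ltW p1) ?(ltW p2) ?lerD2r//.
by rewrite ltW// addr_gt0.
Qed.

Lemma ch_density_gt0 a b x : 0 < a -> 0 < b -> 0 < x -> 0 < ch_density a b x.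
Proof.
move=> a0 b0 x0; rewrite mulr_gt0 ?ch_const_gt0// mulr_gt0 ?powR_gt0//.
by rewrite addr_gt0// exprn_gt0.
Qed.

(** The factor [x^(nu - 1)] cancels in the ratio [r] of the rescaled densities, which therefore
    extends continuously to [0]; rescaling by the quotient of the [micro] values makes it [1]
    there. *)
Lemma ch_density_equiv a0 b0 a1 b1 : 0 < a0 -> 0 < b0 -> 0 < a1 -> 0 < b1 ->
  forall e : R, 0 < e -> exists2 delta, 0 < delta & forall x, 0 < x < delta ->
  `|micro a0 b0 / micro a1 b1 * ch_density a1 b1 x - ch_density a0 b0 x| <=
    e * ch_density a0 b0 x.
Proof.
move=> pa0 pb0 pa1 pb1 e e0.
pose K := micro a0 b0 / micro a1 b1 * ch_const a1 b1 / ch_const a0 b0.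
pose r x := K * ((x + b1 ^+ 2) `^ (- (nu + a1)) * (x + b0 ^+ 2) `^ (nu + a0)).
have cr : {for 0, continuous r}.
  apply: continuous1M; first exact: continuous1_cst.
  by apply: continuous1M; apply: cshift.
have r0 : r 0 = 1.
  rewrite /r /K /micro /ch_const !add0r.
  have sq b z : 0 < b -> (b ^+ 2) `^ z = b `^ (2 * z).
    by move=> bb; rewrite -powR_mulrn ?(ltW bb)// -powRrM.
  rewrite !sq//.
  have -> : b1 `^ (2 * - (nu + a1)) = b1 `^ (- (2 * nu)) / b1 `^ (2 * a1).
    rewrite -powRN -powRD; first by congr (_ `^ _); ring.
    by rewrite (gt_eqF pb1) implybT.
  have -> : b0 `^ (2 * (nu + a0)) = b0 `^ (2 * a0) / b0 `^ (- (2 * nu)).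
    rewrite -powRN -powRD; first by congr (_ `^ _); ring.
    by rewrite (gt_eqF pb0) implybT.
  have G1 := Gamma_gt0 nu_gt0; have G2 := Gamma_gt0 pa0; have G3 := Gamma_gt0 pa1.
  have G4 := Gamma_gt0 (addr_gt0 nu_gt0 pa0); have G5 := Gamma_gt0 (addr_gt0 nu_gt0 pa1).
  have B1 : 0 < b0 `^ (- (2 * nu)) by rewrite powR_gt0.
  have B2 : 0 < b1 `^ (- (2 * nu)) by rewrite powR_gt0.
  have B3 : 0 < b0 `^ (2 * a0) by rewrite powR_gt0.
  have B4 : 0 < b1 `^ (2 * a1) by rewrite powR_gt0.
  move: G1 G2 G3 G4 G5 B1 B2 B3 B4.
  move: (Gamma nu) (Gamma a0) (Gamma a1) (Gamma (nu + a0)) (Gamma (nu + a1)).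
  move: (b0 `^ (- (2 * nu))) (b1 `^ (- (2 * nu))) (b0 `^ (2 * a0)) (b1 `^ (2 * a1)).
  move=> ? ? ? ? ? ? ? ? ? /lt0r_neq0 H1 /lt0r_neq0 H2 /lt0r_neq0 H3 /lt0r_neq0 H4
    /lt0r_neq0 H5 /lt0r_neq0 H6 /lt0r_neq0 H7 /lt0r_neq0 H8 /lt0r_neq0 H9.
  by field; rewrite H1 H2 H3 H4 H5 H6 H7 H8 H9.
move/cvgrPdist_le: cr => /(_ e e0) /nbhs_ballP[delta /= d0 Hd].
exists delta => // x /andP[x0 xd].
have w0 := ch_density_gt0 pa0 pb0 x0.
have -> : micro a0 b0 / micro a1 b1 * ch_density a1 b1 x = r x * ch_density a0 b0 x.
  rewrite /r /K /ch_density /ch_weight.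
  have p0 : 0 < x + b0 ^+ 2 by rewrite addr_gt0// exprn_gt0.
  have M1 := micro_gt0 pa1 pb1; have C0 := ch_const_gt0 pa0 pb0.
  have B0 : 0 < (x + b0 ^+ 2) `^ (nu + a0) by rewrite powR_gt0.
  rewrite [(x + b0 ^+ 2) `^ (- _)]powRN.
  move: M1 C0 B0; move: (micro a1 b1) (ch_const a0 b0) ((x + b0 ^+ 2) `^ (nu + a0)).
  move=> ? ? ? /lt0r_neq0 H1 /lt0r_neq0 H2 /lt0r_neq0 H3.
  by field; rewrite H1 H2 H3.
have -> : r x * ch_density a0 b0 x - ch_density a0 b0 x = (r x - 1) * ch_density a0 b0 x by ring.
rewrite normrM (ger0_norm (ltW w0)) ler_wpM2r ?(ltW w0)//.
have := Hd x; rewrite /= r0 distrC; apply.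
by rewrite /ball/= sub0r normrN ger0_norm ?ltW.
Qed.

Lemma qformZ (k : R) (K K' : 'rV[R]_d -> 'rV[R]_d -> R) n (c : 'I_n -> R) (t : 'I_n -> 'rV[R]_d) :
  (forall t u, K' t u = k * K t u) -> qform K' c t = k * qform K c t.
Proof.
move=> KE; rewrite /qform mulr_sumr; apply: eq_bigr => i _.
by rewrite mulr_sumr; apply: eq_bigr => j _; rewrite KE mulrCA.
Qed.

Section TwoParameters.
Variables (a0 b0 a1 b1 rho : R).
Hypotheses (a0_gt0 : 0 < a0) (b0_gt0 : 0 < b0) (a1_gt0 : 0 < a1) (b1_gt0 : 0 < b1).
Hypothesis rho_ge0 : 0 <= rho.

Let k := micro a0 b0 / micro a1 b1.

Let k0 : 0 < k. Proof. by rewrite divr_gt0 ?micro_gt0. Qed.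

Let ww0 := weight_ch_density a0_gt0 b0_gt0.
Let ww1 : weight (fun x => k * ch_density a1 b1 x).
Proof. by apply: weightZ; [exact: ltW|exact: weight_ch_density]. Qed.

Let qE n (c : 'I_n -> R) (t : 'I_n -> 'rV[R]_d) :
  qform (mix nu (fun x => k * ch_density a1 b1 x)) c t = k * qform (ch (a1, b1)) c t.
Proof.
apply: qformZ => t1 u; rewrite ch_mix// mixZ//; exact: weight_ch_density.
Qed.

Lemma ch_comparison (e : R) : 0 < e -> exists (N : nat) (eta : R), 0 < eta /\
  forall n (c : 'I_n -> R) (t : 'I_n -> 'rV[R]_d), in_box rho t ->
  (forall m, (\sum_i m i <= N)%N -> moment m c t ^+ 2 <= eta * qform (ch (a0, b0)) c t) ->
  `|micro a0 b0 / micro a1 b1 * qform (ch (a1, b1)) c t - qform (ch (a0, b0)) c t| <=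
    e * qform (ch (a0, b0)) c t.
Proof.
have [c0 c00 wc] := ch_density_ge a0_gt0 b0_gt0.
move=> e0; have [N [eta [eta0 H]]] := mix_comparison d nu_gt0 ww0 ww1 c00 rho_ge0 wc
  (ch_density_equiv a0_gt0 b0_gt0 a1_gt0 b1_gt0) e0.
exists N, eta; split => // n c t bt; rewrite -/k -qE ch_mix//; exact: H.
Qed.

Lemma ch_dominated : exists2 L : R, 0 <= L &
  forall n (c : 'I_n -> R) (t : 'I_n -> 'rV[R]_d), in_box rho t ->
  qform (ch (a1, b1)) c t <= L * qform (ch (a0, b0)) c t.
Proof.
have [c0 c00 wc] := ch_density_ge a0_gt0 b0_gt0.
have [L L0 H] := mix_dominated d nu_gt0 ww0 ww1 c00 rho_ge0 wc
  (ch_density_equiv a0_gt0 b0_gt0 a1_gt0 b1_gt0).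
exists (k^-1 * L) => [|n c t bt]; first by rewrite mulr_ge0// invr_ge0 ltW.
have := H n c t bt; rewrite qE -(ch_mix a0_gt0 b0_gt0) => h.
by rewrite -mulrA (ler_pdivlMl _ _ k0).
Qed.

Lemma ch_moment_bound : exists C : ('I_d -> nat) -> R, forall m, 0 <= C m /\
  forall n (c : 'I_n -> R) (t : 'I_n -> 'rV[R]_d), in_box rho t ->
  moment m c t ^+ 2 <= C m * qform (ch (a0, b0)) c t.
Proof.
have [c0 c00 wc] := ch_density_ge a0_gt0 b0_gt0.
have [C [A [C0 A1 H]]] := moment_bound d nu_gt0 ww0 c00 rho_ge0 wc.
exists (fun m => C * (A ^+ (\sum_i m i)) ^+ 2) => m; split.
  by rewrite mulr_ge0// sqr_ge0.
by move=> n c t bt; rewrite ch_mix//; exact: H.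
Qed.

Lemma qform_ch_ge0 n (c : 'I_n -> R) (t : 'I_n -> 'rV[R]_d) : 0 <= qform (ch (a0, b0)) c t.
Proof. by rewrite ch_mix//; exact: qform_mix_ge0. Qed.

Lemma qform_ch_eq0 n (c : 'I_n -> R) (t : 'I_n -> 'rV[R]_d) : injective t ->
  qform (ch (a0, b0)) c t = 0 -> forall i, c i = 0.
Proof.
rewrite ch_mix//; apply: qform_mix_eq0 => //.
by move=> x /andP[x0 _]; exact: ch_density_gt0.
Qed.

Lemma ch_diag t : ch (a0, b0) t t = 1.
Proof. by rewrite ch_mix// mix_diag mass_ch_density. Qed.

Lemma ch_sym t u : ch (a0, b0) t u = ch (a0, b0) u t.
Proof. by rewrite (ch_mix a0_gt0 b0_gt0); exact: mixC. Qed.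

Lemma ch_continuous_diag (e : R) : 0 < e ->
  exists2 eta : R, 0 < eta & forall t u, sqdist t u < eta -> 1 - ch (a0, b0) t u <= e.
Proof.
move=> e0; have [eta eta0 H] := mix_continuous_diag d nu_gt0 ww0 e0.
exists eta => // t u tu; rewrite ch_mix//.
by have := H t u tu; rewrite mass_ch_density.
Qed.

End TwoParameters.

End CHWeight.

(** * Projections, innovations and energies for a positive bilinear form *)

Section Gram.
Variables (R : realType) (V : lmodType R) (B : V -> V -> R).
Hypothesis Blin : forall w (a : R) x y, B (a *: x + y) w = a * B x w + B y w.
Hypothesis Bsym : forall x y, B x y = B y x.
Hypothesis Bge0 : forall x, 0 <= B x x.
Variable z : nat -> V.

Definition comb n (a : 'cV[R]_n) : V := \sum_(i < n) a i 0 *: z i.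

Hypothesis zfree : forall n (a : 'cV[R]_n), B (comb a) (comb a) = 0 -> a = 0.

Definition lin (L : V -> R) : Prop := forall (a : R) x y, L (a *: x + y) = a * L x + L y.

Lemma lin0 L : lin L -> L 0 = 0.
Proof.
by move=> lL; have := lL 1 0 0; rewrite scaler0 addr0 mul1r; lra.
Qed.

Lemma linD L x y : lin L -> L (x + y) = L x + L y.
Proof. by move=> lL; have := lL 1 x y; rewrite scale1r mul1r. Qed.

Lemma linZ L a x : lin L -> L (a *: x) = a * L x.
Proof. by move=> lL; have := lL a x 0; rewrite lin0// !addr0. Qed.

Lemma linB L x y : lin L -> L (x - y) = L x - L y.
Proof. by move=> lL; rewrite linD// -scaleN1r linZ// mulN1r. Qed.

Lemma lin_comb L n (a : 'cV[R]_n) : lin L -> L (comb a) = \sum_(i < n) a i 0 * L (z i).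
Proof.
move=> lL; rewrite /comb; elim: (index_enum _) => [|i s IH].
  by rewrite !big_nil lin0.
by rewrite !big_cons linD// linZ// IH.
Qed.

Lemma lin_Br x : lin (B x).
Proof. by move=> a y w; rewrite Bsym Blin !(Bsym _ x). Qed.

Lemma lin_Bl x : lin (B^~ x).
Proof. by move=> a y w; rewrite Blin. Qed.

Lemma B_subsub x y : B (x - y) (x - y) = B x x - 2 * B x y + B y y.
Proof.
rewrite (linB _ _ (lin_Br _)) !(linB _ _ (lin_Bl _)) (Bsym y x).
by ring.
Qed.

Lemma B_CauchySchwarz x y : B x y ^+ 2 <= B x x * B y y.
Proof.
have H (a : R) : 0 <= B x x - 2 * a * B x y + a ^+ 2 * B y y.
  have := Bge0 (x - a *: y); rewrite B_subsub.
  rewrite (linZ _ _ (lin_Br _)) (linZ _ _ (lin_Br _)) (linZ _ _ (lin_Bl _)).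
  by rewrite !mulrA expr2.
have x0 := Bge0 x; have y0 := Bge0 y.
have [y00|y_neq0] := eqVneq (B y y) 0.
  rewrite y00 mulr0; have [->|xy0] := eqVneq (B x y) 0; first by rewrite expr0n.
  have := H ((B x x + 1) / (2 * B x y)); rewrite y00 mulr0 addr0.
  have -> : 2 * ((B x x + 1) / (2 * B x y)) * B x y = B x x + 1 by field.
  by lra.
have {}y_gt0 : 0 < B y y by rewrite lt_neqAle eq_sym y_neq0.
have := H (B x y / B y y).
have -> : B x x - 2 * (B x y / B y y) * B x y + (B x y / B y y) ^+ 2 * B y y =
    (B x x * B y y - B x y ^+ 2) / B y y by field.
by rewrite pmulr_lge0 ?invr_gt0// subr_ge0.
Qed.

Definition gram n : 'M[R]_n := \matrix_(i, j) B (z i) (z j).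

Definition vals n (L : V -> R) : 'cV[R]_n := \col_(i < n) L (z i).

(** The Riesz representer of [L] on the span of the first [n] vectors; [energy n L] is its squared
    norm. For [L = B x] it is the orthogonal projection of [x]; for the evaluation of combinations
    along a sample path, the energy is the quadratic form inside [sigma2_hat]. *)
Definition rep n (L : V -> R) : V := comb (invmx (gram n) *m vals n L).

Definition energy n (L : V -> R) : R := ((vals n L)^T *m invmx (gram n) *m vals n L) 0 0.

Definition res n x : V := x - rep n (B x).

Lemma B_comb n (a : 'cV[R]_n) (i : 'I_n) : B (z i) (comb a) = (gram n *m a) i 0.
Proof.
rewrite (lin_comb _ (lin_Br _)) mxE; apply: eq_bigr => j _.
by rewrite mxE mulrC.
Qed.

Lemma gram_unit n : gram n \in unitmx.
Proof.
rewrite -row_free_unit -kermx_eq0; apply/eqP/row_matrixP => i; rewrite row0.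
set u := row i _; have : u *m gram n = 0 by apply/sub_kermxP; exact: row_sub.
move=> uG; have gsym : (gram n)^T = gram n.
  by apply/matrixP => j k; rewrite !mxE Bsym.
have : u^T = 0.
  apply: zfree; rewrite (lin_comb _ (lin_Bl _)) big1// => j _.
  rewrite B_comb; have -> : gram n *m u^T = 0 by rewrite -{1}gsym -trmx_mul uG trmx0.
  by rewrite [X in _ * X]mxE mulr0.
by move/(congr1 trmx); rewrite trmxK trmx0.
Qed.

Lemma repE n L (i : nat) : (i < n)%N -> B (z i) (rep n L) = L (z i).
Proof.
move=> lt_in; have := B_comb (invmx (gram n) *m vals n L) (Ordinal lt_in).
by rewrite /= -/(rep n L) => ->; rewrite mulKVmx ?gram_unit// mxE.
Qed.

(* [y] lies in the span of the first [n] vectors; only this consequence of it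
   is ever used. *)
Definition represented n y := forall L, lin L -> L y = B y (rep n L).

Lemma represented_z n i : (i < n)%N -> represented n (z i).
Proof. by move=> lt_in L lL; rewrite repE. Qed.

Lemma representedD n (a : R) x y : represented n x -> represented n y ->
  represented n (a *: x + y).
Proof. by move=> rx ry L lL; rewrite lL rx// ry// Blin. Qed.

Lemma represented_comb m n (a : 'cV[R]_m) : (m <= n)%N -> represented n (comb a).
Proof.
move=> mn L lL; rewrite (lin_comb _ lL) (lin_comb _ (lin_Bl _)).
by apply: eq_bigr => i _; rewrite repE// (leq_trans (ltn_ord i)).
Qed.

Lemma energyE n L : lin L -> energy n L = L (rep n L).
Proof.
move=> lL; rewrite (lin_comb _ lL) /energy -mulmxA mxE; apply: eq_bigr => i _.
by rewrite [(vals n L)^T _ _]mxE [vals n L _ _]mxE mulrC.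
Qed.

Lemma energy_norm n L : lin L -> energy n L = B (rep n L) (rep n L).
Proof. by move=> lL; rewrite energyE// {1}(represented_comb _ (leqnn n)). Qed.

(** Pythagoras: [rep m L] is the projection of [rep n L]. *)
Lemma energy_diff m n L : lin L -> (m <= n)%N ->
  energy n L - energy m L = B (rep n L - rep m L) (rep n L - rep m L).
Proof.
move=> lL mn; rewrite B_subsub -!energy_norm// (Bsym (rep n L)).
rewrite -(represented_comb _ mn)// -energyE//; ring.
Qed.

Lemma energy_homo m n L : lin L -> (m <= n)%N -> energy m L <= energy n L.
Proof. by move=> lL mn; rewrite -subr_ge0 energy_diff. Qed.

(** Testing the bound on [rep n L], where [L] takes the value of the squared norm [E], gives
    [E^2 <= C E]. *)
Lemma energy_le n L (C : R) : lin L -> 0 <= C -> (forall x, L x ^+ 2 <= C * B x x) ->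
  energy n L <= C.
Proof.
move=> lL C0 LC; have := LC (rep n L); rewrite -energyE// -energy_norm// expr2.
have e0 : 0 <= energy n L by rewrite energy_norm.
have [->//|e_neq0] := eqVneq (energy n L) 0.
by rewrite ler_pM2r// lt_neqAle eq_sym e_neq0.
Qed.

(** The form in which Bessel's inequality is used: on vectors orthogonal to the first [m], only the
    increment of the energy after [m] counts, and for a bounded [L] the energies increase to a
    finite limit. *)
Lemma tail_bound m n L y : lin L -> (m <= n)%N -> represented n y ->
  (forall i, (i < m)%N -> B (z i) y = 0) ->
  L y ^+ 2 <= (energy n L - energy m L) * B y y.
Proof.
move=> lL mn ry yorth; rewrite energy_diff// mulrC.
have -> : L y = B y (rep n L - rep m L).
  rewrite ry// (linB _ _ (lin_Br _)) (Bsym _ (rep m L)) (lin_comb _ (lin_Bl _)).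
  by rewrite big1 ?subr0// => i _; rewrite yorth ?mulr0.
exact: B_CauchySchwarz.
Qed.

Lemma res_orth n x i : (i < n)%N -> B (z i) (res n x) = 0.
Proof.
by move=> lt_in; rewrite (linB _ _ (lin_Br _)) repE// (Bsym x) subrr.
Qed.

Lemma res_orth_comb n x (a : 'cV[R]_n) : B (comb a) (res n x) = 0.
Proof.
by rewrite (lin_comb _ (lin_Bl _)) big1// => i _; rewrite res_orth ?mulr0.
Qed.

Lemma combB n (a b : 'cV[R]_n) : comb a - comb b = comb (a - b).
Proof.
by rewrite -sumrB; apply: eq_bigr => i _; rewrite !mxE scalerBl.
Qed.

Lemma combD n (a b : 'cV[R]_n) : comb (a + b) = comb a + comb b.
Proof. by rewrite -big_split; apply: eq_bigr => i _; rewrite !mxE scalerDl. Qed.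

Lemma combZ n k (a : 'cV[R]_n) : comb (k *: a) = k *: comb a.
Proof. by rewrite scaler_sumr; apply: eq_bigr => i _; rewrite !mxE scalerA. Qed.

Lemma res_min n x (a : 'cV[R]_n) : B (res n x) (res n x) <= B (x - comb a) (x - comb a).
Proof.
set b := a - invmx (gram n) *m vals n (B x).
have -> : x - comb a = res n x - comb b.
  by rewrite /b -combB opprB addrA subrK.
rewrite [leRHS]B_subsub [B (res n x) (comb b)]Bsym res_orth_comb mulr0 subr0.
by rewrite lerDl.
Qed.

Lemma res_le n x : B (res n x) (res n x) <= B x x.
Proof.
have := res_min x (0 : 'cV[R]_n); suff -> : comb (0 : 'cV[R]_n) = 0 by rewrite subr0.
by rewrite /comb big1// => i _; rewrite mxE scale0r.
Qed.

Lemma resB n x y : res n x - res n y = res n (x - y).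
Proof.
have -> : res n (x - y) = x - y - (rep n (B x) - rep n (B y)).
  rewrite /res /rep combB -mulmxBr; congr (_ - comb (_ *m _)).
  by apply/matrixP => i j; rewrite !mxE !(Bsym _ (z i)) (linB _ _ (lin_Br _)).
by rewrite /res !opprB addrACA [RHS]addrACA [- _ - y]addrC.
Qed.

Lemma represented_res n k : (k < n)%N -> forall m, (m <= n)%N -> represented n (res m (z k)).
Proof.
move=> kn m mn; rewrite /res addrC -scaleN1r; apply: representedD.
  exact: represented_comb.
exact: represented_z.
Qed.

Definition innov n : V := res n (z n).

Lemma comb_recr n (b : 'cV[R]_n.+1) :
  comb b = comb (\col_(i < n) b (widen_ord (leqnSn n) i) 0) + b ord_max 0 *: z n.
Proof.
rewrite /comb big_ord_recr/=; congr (_ + _); apply: eq_bigr => i _.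
by rewrite mxE.
Qed.

Lemma innov_gt0 n : 0 < B (innov n) (innov n).
Proof.
rewrite lt_neqAle Bge0 andbT eq_sym; apply/negP => /eqP E0.
pose a := invmx (gram n) *m vals n (B (z n)).
pose b := \col_(i < n.+1) if unlift ord_max i is Some j then - a j 0 else 1.
have bE : innov n = comb b.
  rewrite comb_recr mxE unlift_none scale1r addrC /innov /res; congr (_ + _).
  rewrite /rep /comb -sumrN -/a; apply: eq_bigr => i _; rewrite ![(\col__ _) _ _]mxE.
  have -> : widen_ord (leqnSn n) i = lift ord_max i.
    by apply: val_inj; rewrite /= /bump leqNgt ltn_ord.
  by rewrite liftK -scaleNr.
have /zfree : B (comb b) (comb b) = 0 by rewrite -bE.
move/matrixP => /(_ ord_max 0); rewrite !mxE unlift_none => /eqP.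
by rewrite oner_eq0.
Qed.

(** The increment of the representer is orthogonal to the first [n] vectors and lies in the span of
    [n + 1], hence is a multiple of the innovation; the multiple is the last coefficient of the new
    representer. *)
Lemma energyS n L : lin L ->
  energy n.+1 L = energy n L + L (innov n) ^+ 2 / B (innov n) (innov n).
Proof.
move=> lL; apply/eqP; rewrite addrC -subr_eq energy_diff//; apply/eqP.
set D := rep n.+1 L - rep n L; set e := innov n.
have vec (p t q r : V) : p + t - q + (r - t) = p - q + r.
  by rewrite [p + t - q]addrAC -(addrA (p - q) t) (addrC t) subrK.
have [al De] : exists al : R, D = al *: e.
  pose b := invmx (gram n.+1) *m vals n.+1 L; exists (b ord_max 0).
  apply/eqP; rewrite -subr_eq0; apply/eqP.
  have [a aE] : exists a : 'cV[R]_n, D - b ord_max 0 *: e = comb a.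
    exists ((\col_(i < n) b (widen_ord (leqnSn n) i) 0) - invmx (gram n) *m vals n L
      + b ord_max 0 *: (invmx (gram n) *m vals n (B (z n)))).
    rewrite combD combZ -combB /D /e /innov /res {1}/rep -/b comb_recr scalerBr opprB.
    exact: vec.
  rewrite aE (_ : a = 0) ?/comb; first by rewrite big1// => i _; rewrite mxE scale0r.
  apply: zfree; rewrite (lin_comb _ (lin_Bl _)) big1// => i _.
  rewrite -aE (linB _ _ (lin_Br _)) (linZ _ _ (lin_Br _)) res_orth// mulr0 subr0.
  have lt_in1 : (i < n.+1)%N := ltnW (ltn_ord i).
  by rewrite /D (linB _ _ (lin_Br _)) !repE// subrr mulr0.
have eE : L e = al * B e e.
  have re : represented n.+1 e by apply: represented_res.
  rewrite re// -[rep n.+1 L](subrK (rep n L)) -/D De (linD _ _ (lin_Br _)) (linZ _ _ (lin_Br _)).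
  by rewrite (Bsym e (rep n L)) res_orth_comb addr0.
have e0 := innov_gt0 n; rewrite -/e in e0.
rewrite De (linZ _ _ (lin_Br _)) (linZ _ _ (lin_Bl _)) eE.
by field; rewrite gt_eqF.
Qed.

Lemma energy_sum n L : lin L ->
  energy n L = \sum_(k < n) L (innov k) ^+ 2 / B (innov k) (innov k).
Proof.
move=> lL; elim: n => [|n IH]; last by rewrite energyS// IH big_ord_recr.
by rewrite big_ord0 energyE// /rep /comb big_ord0 lin0.
Qed.

Lemma innov_orth j k : (j < k)%N -> B (innov j) (innov k) = 0.
Proof.
move=> jk; rewrite /innov {1}/res (linB _ _ (lin_Bl _)) res_orth// sub0r.
by rewrite (lin_comb _ (lin_Bl _)) big1 ?oppr0// => i _; rewrite res_orth ?mulr0// (ltn_trans _ jk).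
Qed.

Section Vanishing.
Variables (L : V -> R) (C : R).
Hypotheses (lL : lin L) (C_ge0 : 0 <= C) (LC : forall x, L x ^+ 2 <= C * B x x).

Lemma energy_cvg : exists T : R, (forall n, energy n L <= T) /\
  forall e : R, 0 < e -> \forall n \near \oo, T - energy n L <= e.
Proof.
have nd : nondecreasing_seq (fun n => energy n L).
  by move=> m n mn; exact: energy_homo.
have ub : has_ubound (range (fun n => energy n L)).
  by exists C => _ [n _ <-]; exact: energy_le.
have cv := nondecreasing_is_cvgn nd ub.
exists (limn (fun n => energy n L)); split.
  by move=> n; exact: nondecreasing_cvgn_le.
move=> e e0; have /cvgrPdist_le /(_ e e0) := cv.
by apply: filterS => n; apply: le_trans; exact: ler_norm.
Qed.

Lemma innov_vanish (eta : R) : 0 < eta ->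
  \forall n \near \oo, L (innov n) ^+ 2 <= eta * B (innov n) (innov n).
Proof.
move=> eta0; have [T [TE /(_ eta eta0)]] := energy_cvg.
apply: filterS => n Tn.
have re : represented n.+1 (innov n) by apply: represented_res.
apply: (le_trans (tail_bound lL (leqnSn n) re (fun i => @res_orth n (z n) i))).
by rewrite ler_wpM2r// (le_trans _ Tn)// lerB.
Qed.

(** [x] is only a limit of the [z k], so [tail_bound] does not reach its residual directly; it is
    applied to the residual of a nearby [z k]. The threshold on [n] depends on the energies alone
    and is fixed before [k], which may then be as close to [x] as desired. *)
Lemma res_vanish x (eta : R) : 0 < eta ->
  (forall e : R, 0 < e -> exists k, B (x - z k) (x - z k) <= e) ->
  \forall n \near \oo, L (res n x) ^+ 2 <= eta * B (res n x) (res n x).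
Proof.
move=> eta0 xz; have eta4 : 0 < eta / 4 by rewrite divr_gt0.
have [T [TE /(_ _ eta4)]] := energy_cvg.
apply: filterS => n Tn; set u := res n x.
have tau0 : 0 <= T - energy n L by rewrite subr_ge0.
apply/ler_addgt0Pr => e e0.
(* Collects the errors proportional to [dl]: [2 * C] from [L (u - y)] and [eta] from replacing
   [B y y] by [B u u]; the [1] makes it positive. *)
pose K := 2 * C + eta + 1.
have K0 : 0 < K by rewrite ltr_wpDl// addr_ge0 ?mulr_ge0// ltW.
have [k] := xz (e / K) (divr_gt0 e0 K0); set dl := B _ _ => dlK.
pose y := res n (z k).
have uy : B (u - y) (u - y) <= dl by rewrite resB res_le.
have y_le : L y ^+ 2 <= eta / 4 * B y y.
  pose N := maxn n k.+1.
  have ry : represented N y by apply: represented_res; rewrite ?leq_maxl ?leq_maxr.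
  apply: (le_trans (tail_bound lL (leq_maxl n k.+1) ry (fun i => @res_orth n (z k) i))).
  by rewrite ler_wpM2r// (le_trans _ Tn)// lerB.
have Luy := LC (u - y).
rewrite (linB _ _ lL) in Luy.
have By : B y y <= 2 * B u u + 2 * dl.
  have := Bge0 (y - 2 *: u); rewrite B_subsub.
  rewrite (linZ _ _ (lin_Br _)) (linZ _ _ (lin_Br _)) (linZ _ _ (lin_Bl _)).
  by move: uy; rewrite B_subsub (Bsym u y); lra.
have dl0 : 0 <= dl by exact: Bge0.
have h1 : C * B (u - y) (u - y) <= C * dl by rewrite ler_wpM2l.
have h2 : eta / 4 * B y y <= eta / 4 * (2 * B u u + 2 * dl).
  exact: ler_wpM2l (ltW eta4) _ _ By.
have h3 : dl * K <= e by rewrite -ler_pdivlMr.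
have h4 : L u ^+ 2 <= 2 * L y ^+ 2 + 2 * (L u - L y) ^+ 2.
  by have := sqr_ge0 (L u - 2 * L y); nra.
have h5 : 0 <= eta * dl by rewrite mulr_ge0// ltW.
rewrite /K in h3; nra.
Qed.

End Vanishing.

End Gram.

Section OrthonormalRows.
Variables (R : realType) (V : lmodType R) (B0 B1 : V -> V -> R).
Hypothesis B0lin : forall w (a : R) x y, B0 (a *: x + y) w = a * B0 x w + B0 y w.
Hypothesis B0sym : forall x y, B0 x y = B0 y x.
Hypothesis B0ge0 : forall x, 0 <= B0 x x.
Hypothesis B1lin : forall w (a : R) x y, B1 (a *: x + y) w = a * B1 x w + B1 y w.
Hypothesis B1sym : forall x y, B1 x y = B1 y x.
Variable L : R.
Hypothesis B01 : forall x, B0 x x <= L * B1 x x.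
Variable g : nat -> V.
Hypothesis g_orthonormal : forall j k, B1 (g j) (g k) = (j == k)%:R.

(** The row sum [r] equals both [B0 (g j) p] and [B1 p p], so Cauchy-Schwarz and domination give
    [r^2 <= L * (L * r)]. Adding [n] rows bounds the sum of all squared entries by [O(n)], which is
    the variance estimate of the strong law. *)
Lemma orthonormal_row_bound j n : \sum_(k < n) B0 (g j) (g k) ^+ 2 <= L ^+ 2.
Proof.
set r := \sum_(k < n) _; pose c (k : 'I_n) := B0 (g j) (g k).
pose p := \sum_(k < n) c k *: g k.
have linsum (F : V -> R) : lin F -> F p = \sum_(k < n) c k * F (g k).
  move=> lF; rewrite /p; elim: (index_enum _) => [|i l IH]; first by rewrite !big_nil lin0.
  by rewrite !big_cons linD// linZ// IH.
have e1 : B0 (g j) p = r.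
  rewrite (linsum _ (lin_Br B0lin B0sym _)).
  by apply: eq_bigr => k _; rewrite expr2.
have e2 : B1 p p = r.
  rewrite (linsum _ (lin_Br B1lin B1sym _)).
  apply: eq_bigr => k _; rewrite (linsum _ (lin_Bl B1lin _)).
  rewrite (bigD1 k)//= g_orthonormal eqxx mulr1 big1 ?addr0 ?expr2// => i ik.
  by rewrite g_orthonormal (_ : (_ == _ :> nat) = false) ?mulr0//; apply/negbTE.
have r0 : 0 <= r by apply: sumr_ge0 => k _; exact: sqr_ge0.
have := B_CauchySchwarz B0lin B0sym B0ge0 (g j) p; rewrite e1 => cs.
have h1 : B0 (g j) (g j) <= L by have := B01 (g j); rewrite g_orthonormal eqxx mulr1.
have h2 := B01 p; rewrite e2 in h2.
have h3 : r ^+ 2 <= L * (L * r) by apply: (le_trans cs); exact: ler_pM.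
have [->|r_neq0] := eqVneq r 0; first exact: sqr_ge0.
have r_gt0 : 0 < r by rewrite lt_neqAle eq_sym r_neq0.
by move: h3; rewrite !expr2 mulrA ler_pM2r.
Qed.

End OrthonormalRows.

(** * Finite combinations of process values encoded as polynomials *)

Section PolyForm.
Variables (R : realType) (d : nat).
Variable tt : nat -> 'rV[R]_d.
Implicit Types (f : nat -> R) (p q : {poly R}) (K : 'rV[R]_d -> 'rV[R]_d -> R).

(* The polynomial [p] stands for the finite linear combination of the values
   of the process at the sites [tt i] with coefficients [p`_i]. *)
Definition pev f p : R := \sum_(i < size p) p`_i * f i.

Lemma pev_widen f p N : (size p <= N)%N -> pev f p = \sum_(i < N) p`_i * f i.
Proof.
move=> pN; rewrite /pev (big_ord_widen N (fun i => p`_i * f i))// big_mkcond/=.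
apply: eq_bigr => i _; case: ltnP => // pi.
by rewrite nth_default// mul0r.
Qed.

Lemma lin_pev f : lin (pev f).
Proof.
move=> a p q; pose N := maxn (size (a *: p + q)) (maxn (size p) (size q)).
rewrite !(@pev_widen f _ N) /N ?leq_maxl ?leq_max ?leqnn ?orbT//.
rewrite mulr_sumr -big_split; apply: eq_bigr => i _ /=.
by rewrite coefD coefZ; ring.
Qed.

Lemma pev_Xn f n : pev f 'X^n = f n.
Proof.
rewrite /pev size_polyXn big_ord_recr/= coefXn eqxx mul1r big1 ?add0r// => i _.
by rewrite coefXn (ltn_eqF (ltn_ord i)) mul0r.
Qed.

Definition pform K p q : R := pev (fun i => pev (fun j => K (tt i) (tt j)) q) p.

Lemma pform_lin K q (a : R) x y : pform K (a *: x + y) q = a * pform K x q + pform K y q.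
Proof. exact: lin_pev. Qed.

Lemma pform_sym K p q : (forall t u, K t u = K u t) -> pform K p q = pform K q p.
Proof.
move=> Ks; rewrite /pform /pev; under eq_bigr do rewrite mulr_sumr.
rewrite exchange_big; apply: eq_bigr => j _ /=; rewrite mulr_sumr.
by apply: eq_bigr => i _; rewrite Ks mulrCA.
Qed.

Lemma pform_qform K p : pform K p p = qform K (fun i : 'I_(size p) => p`_i) (fun i => tt i).
Proof.
apply: eq_bigr => i _; rewrite /pev mulr_sumr; apply: eq_bigr => j _.
by rewrite mulrA.
Qed.

Lemma pform_Xn K i j : pform K 'X^i 'X^j = K (tt i) (tt j).
Proof. by rewrite /pform !pev_Xn. Qed.

(** Exponent [0] is kept for the target: [1] stands for the value at [s0], and ['X^(i.+1)] for the
    value at [s i], in accordance with [site]. *)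
Definition zX (i : nat) : {poly R} := 'X^(i.+1).

Lemma coef_comb n (a : 'cV[R]_n) (i : 'I_n) : (comb zX a)`_i.+1 = a i 0.
Proof.
rewrite coef_sum (bigD1 i)//= coefZ coefXn eqxx mulr1 big1 ?addr0// => j ji.
by rewrite coefZ coefXn eqSS eq_sym (inj_eq val_inj) (negbTE ji) mulr0.
Qed.

Lemma coef_comb0 n (a : 'cV[R]_n) : (comb zX a)`_0 = 0.
Proof. by rewrite coef_sum big1// => i _; rewrite coefZ coefXn mulr0. Qed.

End PolyForm.

(** * Prediction errors as residuals, and the limits of their variance ratios *)

Section Prediction.
Variables (R : realType) (d : nat) (nu : R) (rho : R) (s : nat -> 'rV[R]_d) (s0 : 'rV[R]_d).
Hypothesis nu_gt0 : 0 < nu.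
Hypothesis rho_ge0 : 0 <= rho.

Definition site (i : nat) : 'rV[R]_d := if i is j.+1 then s j else s0.

Hypothesis site_inj : injective site.
Hypothesis site_box : forall i l, `|site i 0 l| <= rho.
Hypothesis s0_lim : forall e : R, 0 < e -> exists k, sqdist s0 (s k) < e.

Local Notation form th := (pform site (ch nu th)).
Local Notation z := (@zX R).
Local Notation err th n := (res (form th) z n 1).

Section OneParameter.
Variable th : R * R.
Hypotheses (a_gt0 : 0 < th.1) (b_gt0 : 0 < th.2).

Let thE : th = (th.1, th.2). Proof. by case: th. Qed.

Lemma form_sym p q : form th p q = form th q p.
Proof. by apply: pform_sym => t u; rewrite thE; exact: ch_sym. Qed.

Lemma form_ge0 p : 0 <= form th p p.
Proof. by rewrite pform_qform thE; exact: qform_ch_ge0. Qed.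

Lemma form_eq0 p : form th p p = 0 -> p = 0.
Proof.
rewrite pform_qform thE => /(qform_ch_eq0 nu_gt0 a_gt0 b_gt0) H.
have inj : injective (fun i : 'I_(size p) => site i) by move=> i j /site_inj/val_inj.
have {}H := H inj; apply/polyP => i; rewrite coef0.
by case: (ltnP i (size p)) => [ip|pi]; [exact: (H (Ordinal ip))|rewrite nth_default].
Qed.

Lemma form_gt0 p : p != 0 -> 0 < form th p p.
Proof.
move=> p0; rewrite lt_neqAle form_ge0 andbT eq_sym.
by apply: contra p0 => /eqP/form_eq0 ->.
Qed.

Lemma form_free n (a : 'cV[R]_n) : form th (comb z a) (comb z a) = 0 -> a = 0.
Proof.
move/form_eq0 => c0; apply/matrixP => i j.
by rewrite !mxE ord1 -coef_comb c0 coef0.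
Qed.

(** The error has constant coefficient [1], whichever parameter the predictor is built with, and the
    form is definite. *)
Lemma err_gt0 (th' : R * R) n : 0 < form th (err th' n) (err th' n).
Proof.
apply: form_gt0; apply/eqP => /(congr1 (fun p : {poly R} => p`_0)).
by rewrite /res coefB coef_comb0 coef1 coef0 subr0; apply/eqP; rewrite oner_eq0.
Qed.

Lemma form_site_lim (e : R) : 0 < e -> exists k, form th (1 - z k) (1 - z k) <= e.
Proof.
move=> e0; have e2 : 0 < e / 2 by rewrite divr_gt0.
have [eta eta0 H] := ch_continuous_diag d nu_gt0 a_gt0 b_gt0 e2.
have [k sk] := s0_lim eta0; exists k.
rewrite (B_subsub (@pform_lin _ _ site (ch nu th)) form_sym).
rewrite -(expr0 'X) !pform_Xn /=.
have := H _ _ sk; rewrite -thE.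
have -> : ch nu th s0 s0 = 1 by rewrite thE ch_diag.
have -> : ch nu th (s k) (s k) = 1 by rewrite thE ch_diag.
lra.
Qed.

Lemma moment_pev_bound m : exists2 C : R, 0 <= C &
  forall p, pev (fun i => mono m (site i)) p ^+ 2 <= C * form th p p.
Proof.
have [C H] := ch_moment_bound d nu_gt0 a_gt0 b_gt0 rho_ge0.
have [C0 Hm] := H m; exists (C m) => // p.
rewrite pform_qform thE; apply: Hm => a i; exact: site_box.
Qed.

Lemma err_vanish m (eta : R) : 0 < eta -> \forall n \near \oo,
  pev (fun i => mono m (site i)) (err th n) ^+ 2 <= eta * form th (err th n) (err th n).
Proof.
move=> eta0; have [C C0 HC] := moment_pev_bound m.
apply: (res_vanish (@pform_lin _ _ site (ch nu th)) form_sym form_ge0 form_free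
  (@lin_pev _ _) C0 HC eta0).
exact: form_site_lim.
Qed.

Lemma innov_pev_vanish m (eta : R) : 0 < eta -> \forall n \near \oo,
  pev (fun i => mono m (site i)) (innov (form th) z n) ^+ 2 <=
  eta * form th (innov (form th) z n) (innov (form th) z n).
Proof.
move=> eta0; have [C C0 HC] := moment_pev_bound m.
exact: (innov_vanish (@pform_lin _ _ site (ch nu th)) form_sym form_ge0 form_free
  (@lin_pev _ _) C0 HC eta0).
Qed.

Lemma gram_corr_mx n : gram (form th) z n = corr_mx nu th s n.
Proof. by apply/matrixP => i j; rewrite !mxE pform_Xn. Qed.

(** The vector [a] of kriging weights for [th] is also the coefficient vector of the projection of
    [1]; expanding [form th'] at [1 - comb z a] produces the three terms of the closed formula. *)
Lemma pred_err_var_form (th' : R * R) (sg : R) n : 0 < th'.1 -> 0 < th'.2 ->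
  pred_err_var nu th' sg th s s0 n = sg * form th' (err th n) (err th n).
Proof.
move=> a0' b0'; have th'E : th' = (th'.1, th'.2) by case: (th').
have sym' p q : form th' p q = form th' q p.
  by apply: pform_sym => t u; rewrite th'E; exact: ch_sym.
rewrite /pred_err_var; congr (_ * _); set Ri := invmx _.
set r := corr_vec nu th _ _ _; set r' := corr_vec nu th' _ _ _; set R' := corr_mx nu th' _ _.
set a := Ri *m r.
have valsE : vals z n (form th 1) = r.
  by apply/matrixP => i j; rewrite !mxE -(expr0 'X) pform_Xn.
have -> : res (form th) z n 1 = 1 - comb z a.
  by rewrite /res /rep gram_corr_mx valsE.
have aT : r^T *m Ri = a^T.
  rewrite /a trmx_mul; congr (_ *m _); rewrite /Ri trmx_inv; congr invmx.
  by apply/matrixP => i j; rewrite !mxE eucl_distC.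
rewrite -[_ *m _ *m R' *m Ri *m r]mulmxA -/a !aT.
rewrite (B_subsub (@pform_lin _ _ site (ch nu th')) sym').
congr (_ - 2 * _ + _).
- by rewrite -(expr0 'X) pform_Xn th'E ch_diag.
- rewrite (lin_comb _ _ (lin_Br (@pform_lin _ _ site (ch nu th')) sym' 1)) mxE.
  apply: eq_bigr => i _; rewrite [a^T _ _]mxE [r' _ _]mxE -(expr0 'X) pform_Xn.
  by [].
- rewrite (lin_comb _ _ (lin_Bl (@pform_lin _ _ site (ch nu th')) _)) -mulmxA mxE.
  apply: eq_bigr => i _; rewrite [a^T _ _]mxE.
  rewrite (B_comb (@pform_lin _ _ site (ch nu th')) sym'); congr (_ * _).
  by congr ((_ *m _) _ _); apply/matrixP => j k; rewrite !mxE pform_Xn.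
Qed.

End OneParameter.

Lemma ratio_dist (k Q Q' e : R) : 0 < k -> 0 < Q ->
  `|k * Q' - Q| <= e * k * Q -> `|k^-1 - Q' / Q| <= e.
Proof.
move=> k0 Q0; have kQ := mulr_gt0 k0 Q0.
have -> : k * Q' - Q = - (k * Q) * (k^-1 - Q' / Q) by field; rewrite !gt_eqF.
rewrite normrM normrN (gtr0_norm kQ).
have -> : e * k * Q = k * Q * e by ring.
by rewrite ler_pM2l.
Qed.

Section TwoParameters.
Variables th0 th1 : R * R.
Hypotheses (a0_gt0 : 0 < th0.1) (b0_gt0 : 0 < th0.2).
Hypotheses (a1_gt0 : 0 < th1.1) (b1_gt0 : 0 < th1.2).

Let th0E : th0 = (th0.1, th0.2). Proof. by case: th0. Qed.
Let th1E : th1 = (th1.1, th1.2). Proof. by case: th1. Qed.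

Lemma form_ratio_cvg (u : nat -> {poly R}) : (forall n, 0 < form th0 (u n) (u n)) ->
  (forall m (eta : R), 0 < eta -> \forall n \near \oo,
    pev (fun i => mono m (site i)) (u n) ^+ 2 <= eta * form th0 (u n) (u n)) ->
  form th1 (u n) (u n) / form th0 (u n) (u n) @[n --> \oo] -->
    micro nu th1.1 th1.2 / micro nu th0.1 th0.2.
Proof.
move=> u0 um; have k00 := micro_gt0 nu_gt0 a0_gt0 b0_gt0.
have k10 := micro_gt0 nu_gt0 a1_gt0 b1_gt0.
rewrite -invf_div; have k_gt0 := divr_gt0 k00 k10.
apply/cvgrPdist_le => e e0; have e1 := mulr_gt0 e0 k_gt0.
have [N [eta [eta0 H]]] := ch_comparison d nu_gt0 a0_gt0 b0_gt0 a1_gt0 b1_gt0 rho_ge0 e1.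
(* A multi-index of degree at most [N] has all entries below [N.+1]. Ranging over this finite type,
   finitely many eventual bounds can be intersected. *)
have : \forall n \near \oo, forall g : {ffun 'I_d -> 'I_N.+1},
    pev (fun i => mono (fun l => g l) (site i)) (u n) ^+ 2 <= eta * form th0 (u n) (u n).
  by apply: filter_forall => g; exact: um.
apply: filterS => n Hn; apply: (ratio_dist k_gt0 (u0 n)).
have := H _ (fun i : 'I_(size (u n)) => (u n)`_i) (fun i => site i).
rewrite -!pform_qform -th0E -th1E; apply=> [a i|m mN]; first exact: site_box.
pose g : {ffun 'I_d -> 'I_N.+1} := [ffun i => inord (m i)].
have gE : (fun i => nat_of_ord (g i)) = m.
  apply/funext => i; rewrite ffunE inordK// ltnS (leq_trans _ mN)//.
  by rewrite (bigD1 i)//= leq_addr.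
by have := Hn g; rewrite gE.
Qed.

End TwoParameters.

Section Asymptotics.
Variables th0 th1 : R * R.
Hypotheses (a0_gt0 : 0 < th0.1) (b0_gt0 : 0 < th0.2).
Hypotheses (a1_gt0 : 0 < th1.1) (b1_gt0 : 0 < th1.2).

Lemma err_misspecified_cvg :
  form th0 (err th1 n) (err th1 n) / form th1 (err th1 n) (err th1 n) @[n --> \oo] -->
    micro nu th0.1 th0.2 / micro nu th1.1 th1.2.
Proof.
apply: form_ratio_cvg => //; first by move=> n; exact: err_gt0.
exact: err_vanish.
Qed.

Lemma err_efficiency_cvg :
  form th0 (err th1 n) (err th1 n) / form th0 (err th0 n) (err th0 n) @[n --> \oo] --> (1 : R).
Proof.
have k00 := micro_gt0 nu_gt0 a0_gt0 b0_gt0.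
have k10 := micro_gt0 nu_gt0 a1_gt0 b1_gt0.
have c1 := err_misspecified_cvg.
have c2 : form th1 (err th0 n) (err th0 n) / form th0 (err th0 n) (err th0 n) @[n --> \oo] -->
    micro nu th1.1 th1.2 / micro nu th0.1 th0.2.
  by apply: form_ratio_cvg => //; [move=> n; exact: err_gt0|exact: err_vanish].
(* [xij] is the variance under model [i] of the error of predictor [j]. Optimality of each predictor
   under its own model squeezes the loss of efficiency between [1] and a product of two
   misspecification ratios with inverse limits. *)
have key (x00 x01 x10 x11 : R) : 0 < x00 -> 0 < x10 -> 0 < x11 -> x00 <= x01 -> x11 <= x10 ->
    1 <= x01 / x00 <= x01 / x11 * (x10 / x00).
  move=> p0 p1 p2 l0 l1; rewrite ler_pdivlMr// mul1r l0/= mulrA ler_pM2r ?invr_gt0//.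
  rewrite mulrAC ler_pdivlMr// ler_wpM2l//.
  exact: le_trans (ltW p0) l0.
have c12 := cvgM c1 c2.
rewrite mulrA (divfK (lt0r_neq0 k10)) (divff (lt0r_neq0 k00)) in c12.
apply: (@squeeze_cvgr _ _ _ _ (fun=> 1) _ _ _ 1); [|exact: cvg_cst|exact: c12].
apply: nearW => n.
have p00 := err_gt0 a0_gt0 b0_gt0 th0 n; have p01 := err_gt0 a0_gt0 b0_gt0 th1 n.
have p10 := err_gt0 a1_gt0 b1_gt0 th0 n; have p11 := err_gt0 a1_gt0 b1_gt0 th1 n.
have min th th' : 0 < th.1 -> 0 < th.2 ->
    form th (err th n) (err th n) <= form th (err th' n) (err th' n).
  move=> a0 b0; exact: (res_min (@pform_lin _ _ site (ch nu th)) (form_sym a0 b0)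
    (form_ge0 a0 b0) (form_free a0 b0)).
exact: (key _ _ _ _ p00 p10 p11 (min _ _ a0_gt0 b0_gt0) (min _ _ a1_gt0 b1_gt0)).
Qed.

End Asymptotics.

End Prediction.

(** * Moments of normal laws *)

Section NormalMoments.
Variable R : realType.
Local Notation mu := (@lebesgue_measure R).
Implicit Types (m s c : R) (f g G : R -> R).

Lemma ge0_integral_normal_prob m s f : measurable_fun setT f -> (forall x, 0 <= f x) ->
  (\int[normal_prob m s]_x (f x)%:E = \int[mu]_x (f x * normal_pdf m s x)%:E)%E.
Proof.
move=> mf f0.
have dom := @normal_prob_dominates R m s.
have mf' : measurable_fun setT (EFin \o f) by exact/measurable_EFinP.
rewrite -(Radon_Nikodym_SigmaFinite.change_of_variables dom (f := EFin \o f) _ measurableT mf'); last first.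
  by move=> x; rewrite lee_fin.
have irn := Radon_Nikodym_SigmaFinite.f_integrable dom.
under [RHS]eq_integral do rewrite EFinM.
apply: ae_eq_integral => //.
- apply: emeasurable_funM => //; exact: measurable_int irn.
- by apply: emeasurable_funM => //; apply/measurable_EFinP; exact: measurable_normal_pdf.
- apply: ae_eqe_mul2l; apply: integral_ae_eq => //.
    by apply/measurable_EFinP; exact: measurable_normal_pdf.
  by move=> E _ mE; rewrite -(Radon_Nikodym_SigmaFinite.f_integral dom mE).
Qed.

Lemma is_derive_normal_pdf m s (x : R) : s != 0 ->
  is_derive x (1 : R) (normal_pdf m s) (- ((x - m) / s ^+ 2) * normal_pdf m s x).
Proof.
move=> s0; rewrite normal_pdfE//.
have d1 : is_derive x (1 : R) (fun y => - (s ^+ 2 *+ 2)^-1 * (y - m) ^+ 2)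
    (- (s ^+ 2 *+ 2)^-1 * (2%:R * (x - m) ^+ 1 * 1)).
  exact: (is_derive1Z _ (is_derive1X 2 (is_derive1_shift (- m) x))).
have d2 := is_derive1Z (normal_peak s) (is_derive1_comp (is_derive_expR _) d1).
rewrite (_ : (fun y => normal_peak s * normal_fun m s y) =
  fun y => normal_peak s * (expR \o (fun y => - (s ^+ 2 *+ 2)^-1 * (y - m) ^+ 2)) y); last first.
  by apply/funext => y; rewrite /normal_fun /=; congr (_ * expR _); rewrite mulNr mulrC mulNr.
apply: (is_derive1_eq d2); rewrite /=.
have s2 : s ^+ 2 != 0 by rewrite sqrf_eq0.
have -> : expR (- (s ^+ 2 *+ 2)^-1 * (x - m) ^+ 2) = normal_fun m s x.
  by rewrite /normal_fun; congr expR; rewrite mulNr mulrC mulNr.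
have -> : s ^+ 2 *+ 2 = 2 * s ^+ 2 by rewrite mulr_natl.
by field.
Qed.

(** From [exp (- y) <= 2 / y^2] with [y = u^2 / (2 s^2)], and [1 + |u|^3 <= 2 |u|^3]: the fourth
    power gained against the cubic growth leaves [1 / |u|]. *)
Let bnd m s G (K : R) : s != 0 -> 0 <= K ->
  (forall x, `|G x| <= K * (1 + `|x - m| ^+ 3)) ->
  forall u : R, 1 <= `|u| ->
  `|G (m + u) * normal_pdf m s (m + u)| <= K * normal_peak s * 16 * s ^+ 4 / `|u|.
Proof.
move=> s0 K0 GK u u1; have u0 : 0 < `|u| := lt_le_trans ltr01 u1.
have s2 : 0 < s ^+ 2 by rewrite exprn_even_gt0.
have p0 := normal_peak_ge0 s.
rewrite normrM [`|normal_pdf _ _ _|]ger0_norm ?normal_pdf_ge0// normal_pdfE//.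
have -> : K * normal_peak s * 16 * s ^+ 4 / `|u| =
    (K * (2 * `|u| ^+ 3)) * (normal_peak s * (8 * s ^+ 4 / `|u| ^+ 4)).
  by field; rewrite gt_eqF.
apply: ler_pM => //; first by rewrite mulr_ge0// expR_ge0.
  apply: (le_trans (GK _)); rewrite ler_wpM2l// [m + u]addrC addrK.
  have : 1 <= `|u| ^+ 3 by rewrite exprn_ege1.
  by lra.
rewrite ler_wpM2l// /normal_fun [m + u]addrC addrK.
set y := u ^+ 2 / (s ^+ 2 *+ 2).
have yE : y = `|u| ^+ 2 / (2 * s ^+ 2) by rewrite /y real_normK ?num_real// mulr_natl.
have y0 : 0 < y.
  by rewrite yE; exact: divr_gt0 (exprn_gt0 2 u0) (mulr_gt0 (ltr0Sn R 1) s2).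
have -> : - u ^+ 2 / (s ^+ 2 *+ 2) = - y by rewrite mulNr.
rewrite expRN; have -> : 8 * s ^+ 4 / `|u| ^+ 4 = (y ^+ 2 / 2)^-1.
  by rewrite yE; field; rewrite ?(gt_eqF u0) ?s0.
rewrite lef_pV2 ?posrE ?expR_gt0 ?divr_gt0 ?exprn_gt0//.
have := expR_ge1Dxn 1 (ltW y0); rewrite (_ : 2`!%:R = 2 :> R)//.
by lra.
Qed.

(** Integrates an exact derivative whose boundary terms vanish. Each moment below then only requires
    a polynomial [G] with [G' - G (x - m) / s^2 = g - c]. *)
Lemma normal_integral m s g G c (K : R) : s != 0 -> 0 <= K ->
  (forall x, 0 <= g x) -> continuous g ->
  (forall x, `|G x| <= K * (1 + `|x - m| ^+ 3)) ->
  (forall x : R, is_derive x (1 : R) (fun y => G y * normal_pdf m s y)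
     ((g x - c) * normal_pdf m s x)) ->
  (\int[mu]_x (g x * normal_pdf m s x)%:E = c%:E)%E.
Proof.
move=> s0 K0 g0 cg GK dG.
pose J n : set R := `[m - n.+1%:R, m + n.+1%:R]%classic.
have JU : \bigcup_n J n = setT.
  apply/seteqP; split => // x _; exists (Num.bound `|x - m|) => //=.
  rewrite /J/= in_itv/=.
  have : `|x - m| <= (Num.bound `|x - m|).+1%:R.
    by rewrite ltW// (lt_le_trans (archi_boundP (normr_ge0 _)))// ler_nat.
  by rewrite ler_norml => /andP[h1 h2]; apply/andP; split; lra.
have Jnd : nondecreasing_seq J.
  move=> a b ab; rewrite subsetEset => x; rewrite /J/= !in_itv/=.
  have : a.+1%:R <= b.+1%:R :> R by rewrite ler_nat ltnS.
  by move=> h /andP[h1 h2]; apply/andP; split; lra.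
have mJ n : measurable (J n) by exact: measurable_itv.
have cp := @continuous_normal_pdf R m s s0.
have cgp (x : R) : {for x, continuous (fun x => g x * normal_pdf m s x)}.
  by apply: continuous1M; [exact: cg|exact: cp].
have lim f : continuous f -> (forall x, 0 <= f x) ->
    (\int[mu]_(x in J n) (f x)%:E @[n --> \oo] --> \int[mu]_x (f x)%:E)%E.
  move=> cf f0; rewrite -JU; apply: ge0_nondecreasing_set_cvg_integral => //.
    move=> n; apply/measurable_EFinP; apply: measurable_funTS.
    exact: continuous_measurable_fun.
  by move=> _ x _; rewrite lee_fin.
have l1 := lim _ cgp (fun x => mulr_ge0 (g0 x) (normal_pdf_ge0 m s x)).
have l2 := lim _ cp (normal_pdf_ge0 m s); rewrite integral_normal_pdf in l2.
have ab n : m - n.+1%:R < m + n.+1%:R :> R.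
  by rewrite ltrD2l (@lt_trans _ _ 0)// ?oppr_lt0 ltr0n.
have ip n : mu.-integrable (J n) (EFin \o normal_pdf m s).
  by apply: continuous_itv_integrable => x _; exact: cp.
have ig n : mu.-integrable (J n) (EFin \o (fun x => g x * normal_pdf m s x)).
  by apply: continuous_itv_integrable => x _; exact: cgp.
pose H x := G x * normal_pdf m s x.
have E n : \int[mu]_(x in J n) (g x * normal_pdf m s x) =
    c * \int[mu]_(x in J n) (normal_pdf m s x) + (H (m + n.+1%:R) - H (m - n.+1%:R)).
  have <- : \int[mu]_(x in J n) ((g x - c) * normal_pdf m s x) = H (m + n.+1%:R) - H (m - n.+1%:R).
    apply: (Rintegral_FTC (ab n) (fun x _ => dG x)) => x _.
    apply: continuous1M; last exact: cp.
    by apply: continuous1D; [exact: cg|exact: continuous1_cst].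
  have mJn := mJ n; rewrite -RintegralZl// -RintegralD//; first by apply: eq_Rintegral => x _; ring.
    rewrite (_ : EFin \o _ = (fun x => c%:E * (EFin \o normal_pdf m s) x)%E).
      by apply: integrableZl.
    by apply/funext => x; rewrite /= EFinM.
  apply: continuous_itv_integrable => x _; apply: continuous1M; last exact: cp.
  by apply: continuous1D; [exact: cg|exact: continuous1_cst].
pose C := K * normal_peak s * 16 * s ^+ 4.
have hb (n : nat) (u : R) : `|u| = n.+1%:R -> `|H (m + u)| <= C * harmonic n.
  move=> un; have u1 : 1 <= `|u| by rewrite un ler1n.
  by have := bnd s0 K0 GK u1; rewrite un.
have H0 (v : nat -> R) : (forall n, `|v n| = n.+1%:R) -> H (m + v n) @[n --> \oo] --> (0 : R).
  move=> vn; have cz : C * harmonic n @[n --> \oo] --> (0 : R).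
    rewrite -(mulr0 C); apply: cvgM; [exact: cvg_cst|exact: cvg_harmonic].
  apply/norm_cvg0P; apply: (@squeeze_cvgr _ _ _ _ (fun=> 0) _ _ _ 0); [|exact: cvg_cst|exact: cz].
  by apply: nearW => n; rewrite normr_ge0 hb.
have r2 : \int[mu]_(x in J n) normal_pdf m s x @[n --> \oo] --> (1 : R).
  exact: fine_cvg.
have r1 : c * \int[mu]_(x in J n) normal_pdf m s x +
    (H (m + n.+1%:R) - H (m - n.+1%:R)) @[n --> \oo] --> c * 1 + (0 - 0).
  apply: cvgD; first by apply: cvgM; [exact: cvg_cst|].
  apply: cvgB; first by apply: H0 => n; rewrite normr_nat.
  by apply: H0 => n; rewrite normrN normr_nat.
rewrite mulr1 subr0 addr0 in r1.
have r3 : (\int[mu]_(x in J n) (g x * normal_pdf m s x)%:E @[n --> \oo] --> c%:E)%E.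
  have -> : (fun n => \int[mu]_(x in J n) (g x * normal_pdf m s x)%:E)%E =
    EFin \o (fun n => \int[mu]_(x in J n) (g x * normal_pdf m s x)).
    apply/funext => n; rewrite /= /Rintegral fineK//.
    by apply: (integrable_fin_num _ (ig n)); exact: mJ.
  under [X in EFin \o X]eq_fun do rewrite E.
  by apply: cvg_EFin; [exact: nearW|exact: r1].
exact: cvg_unique l1 r3.
Qed.

Lemma le_norm_cube (u a b : R) : 0 <= a -> 0 <= b ->
  a + b * `|u| <= (a + b) * (1 + `|u| ^+ 3).
Proof.
move=> a0 b0; have h : `|u| <= 1 + `|u| ^+ 3.
  have [u1|/ltW u1] := leP `|u| 1; first by rewrite (le_trans u1)// lerDl exprn_ge0.
  have : `|u| ^+ 1 <= `|u| ^+ 3 by rewrite ler_weXn2l.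
  by rewrite expr1; lra.
have h3 : 0 <= `|u| ^+ 3 by rewrite exprn_ge0.
have : b * `|u| <= b * (1 + `|u| ^+ 3) by rewrite ler_wpM2l.
have : 0 <= a * `|u| ^+ 3 by rewrite mulr_ge0.
by rewrite mulrDl mulrDr mulr1; lra.
Qed.

Let dGpdf m s (G dG : R -> R) (x : R) : s != 0 -> is_derive x (1 : R) G (dG x) ->
  is_derive x (1 : R) (fun y => G y * normal_pdf m s y)
    ((dG x - G x * (x - m) / s ^+ 2) * normal_pdf m s x).
Proof.
move=> s0 h; apply: (is_derive1_eq (is_derive1M h (is_derive_normal_pdf m x s0))).
by ring.
Qed.

Let cpoly m (k : nat) : continuous (fun x : R => (x - m) ^+ k).
Proof. by move=> x; exact: (continuous_derivable (is_derive1X k (is_derive1_shift (- m) x))). Qed.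

Lemma normal_moment2 m s : s != 0 ->
  (\int[mu]_x ((x - m) ^+ 2 * normal_pdf m s x)%:E = (s ^+ 2)%:E)%E.
Proof.
move=> s0; have s20 : 0 <= s ^+ 2 by exact: sqr_ge0.
apply: (@normal_integral m s _ (fun x => - s ^+ 2 * (x - m)) (s ^+ 2) (s ^+ 2) s0 s20).
- by move=> x; exact: sqr_ge0.
- exact: cpoly.
- move=> x; rewrite normrM normrN (ger0_norm s20).
  by have := le_norm_cube (x - m) (lexx 0) s20; rewrite !add0r.
- move=> x.
  have h := is_derive1Z (- s ^+ 2) (is_derive1_shift (- m) x).
  apply: (is_derive1_eq (dGpdf m (dG := fun=> - s ^+ 2 * 1) s0 h)).
  by congr (_ * _); field.
Qed.

Lemma normal_moment2_shift m s : s != 0 ->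
  (\int[mu]_x ((x - m + 1) ^+ 2 * normal_pdf m s x)%:E = (s ^+ 2 + 1)%:E)%E.
Proof.
move=> s0; have s20 : 0 <= s ^+ 2 by exact: sqr_ge0.
apply: (@normal_integral m s _ (fun x => - s ^+ 2 * (x - m + 2)) (s ^+ 2 + 1) (s ^+ 2 * 3) s0).
- exact: mulr_ge0 s20 (ler0n _ _).
- by move=> x; exact: sqr_ge0.
- move=> x.
  have h := is_derive1X 2 (is_derive1_shift 1 (x - m)).
  exact: (continuous_derivable (is_derive1_comp_shift h)).
- move=> x; rewrite normrM normrN (ger0_norm s20) -mulrA ler_wpM2l//.
  apply: (le_trans (ler_normD _ _)); rewrite (ger0_norm (ler0n R 2)).
  have := le_norm_cube (x - m) (ler0n R 2) ler01; rewrite mul1r.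
  have -> : (2 + 1 : R) = 3 by lra.
  by rewrite addrC.
- move=> x.
  have h := is_derive1Z (- s ^+ 2) (is_derive1D (is_derive1_shift (- m) x) (is_derive_cst (2 : R) x 1)).
  apply: (is_derive1_eq (dGpdf m (dG := fun=> - s ^+ 2 * (1 + 0)) s0 h)).
  by congr (_ * _); field.
Qed.

Lemma normal_moment4 m s : s != 0 ->
  (\int[mu]_x ((x - m) ^+ 4 * normal_pdf m s x)%:E = (3 * s ^+ 4)%:E)%E.
Proof.
move=> s0; have s20 : 0 <= s ^+ 2 by exact: sqr_ge0.
apply: (@normal_integral m s _ (fun x => - s ^+ 2 * ((x - m) ^+ 3 + 3 * s ^+ 2 * (x - m)))
  (3 * s ^+ 4) (s ^+ 2 * (1 + 3 * s ^+ 2)) s0).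
- exact: mulr_ge0 s20 (addr_ge0 ler01 (mulr_ge0 (ler0n _ _) s20)).
- by move=> x; rewrite exprn_even_ge0.
- exact: cpoly.
- move=> x; rewrite normrM normrN (ger0_norm s20) -[leRHS]mulrA ler_wpM2l//.
  apply: (le_trans (ler_normD _ _)); rewrite normrX [`|_ * (x - m)|]normrM.
  have b0 : 0 <= 3 * s ^+ 2 by rewrite mulr_ge0.
  rewrite (ger0_norm b0); have := le_norm_cube (x - m) (lexx 0) b0.
  by rewrite !add0r mulrDl mul1r; lra.
- move=> x.
  have h := is_derive1Z (- s ^+ 2) (is_derive1D (is_derive1X 3 (is_derive1_shift (- m) x))
    (is_derive1Z (3 * s ^+ 2) (is_derive1_shift (- m) x))).
  apply: (is_derive1_eq (dGpdf m (dG := fun x => - s ^+ 2 * (3%:R * (x - m) ^+ 2 * 1 + 3 * s ^+ 2 * 1)) s0 h)).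
  by congr (_ * _); field.
Qed.

End NormalMoments.

Section NormalLaw.
Variables (R : realType) (disp : measure_display) (Omega : measurableType disp).
Variable P : probability Omega R.
Local Notation mu := (@lebesgue_measure R).
Implicit Types (X Y : Omega -> R) (f : R -> R).

Lemma integrable_lincomb2 X Y (a b : R) :
  P.-integrable setT (EFin \o X) -> P.-integrable setT (EFin \o Y) ->
  P.-integrable setT (EFin \o (fun w => a * X w + b * Y w)) /\
  \int[P]_w (a * X w + b * Y w) = a * \int[P]_w X w + b * \int[P]_w Y w.
Proof.
move=> iX iY.
have iZ (c : R) (Z : Omega -> R) : P.-integrable setT (EFin \o Z) ->
    P.-integrable setT (EFin \o (fun w => c * Z w)).
  move=> iZ; rewrite (_ : EFin \o _ = (fun w => c%:E * (EFin \o Z) w)%E).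
    by apply: integrableZl.
  by apply/funext => x; rewrite /= EFinM.
split.
  rewrite (_ : EFin \o _ = ((EFin \o (fun w => (a * X w)%R)) \+ (EFin \o (fun w => (b * Y w)%R)))%E).
    by apply: integrableD => //; exact: iZ.
  by apply/funext => x; rewrite /= EFinD.
by rewrite RintegralD//; [rewrite !RintegralZl|exact: iZ|exact: iZ].
Qed.

Lemma integrable_prob_cst (c : R) : P.-integrable setT (EFin \o (fun _ : Omega => c)) /\
  \int[P]_w c = c.
Proof.
split; first exact: finite_measure_integrable_cst.
by have := expectation_cst P c; rewrite unlock /Rintegral => ->.
Qed.

Lemma integrable_affine_sqr X (b : R) :
  P.-integrable setT (EFin \o X) -> P.-integrable setT (EFin \o (fun w => X w ^+ 2)) ->
  \int[P]_w X w = 0 -> \int[P]_w (X w + b) ^+ 2 = \int[P]_w (X w ^+ 2) + b ^+ 2.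
Proof.
move=> iX iX2 X0; have [ic cE] := integrable_prob_cst 1.
have [i1 e1] := integrable_lincomb2 (2 * b) (b ^+ 2) iX ic.
have [i2 e2] := integrable_lincomb2 1 1 iX2 i1.
rewrite (_ : (fun w => (X w + b) ^+ 2) = fun w => 1 * (X w ^+ 2) + 1 * (2 * b * X w + b ^+ 2 * 1)).
  by rewrite e2 e1 X0 cE; ring.
by apply/funext => w; ring.
Qed.

Section Law.
Variables (X : Omega -> R) (m v : R).
Hypotheses (mX : measurable_fun setT X) (v_ge0 : 0 <= v).
Hypothesis lawX : forall B : set R, measurable B -> P (X @^-1` B) = normal_law m v B.

Lemma ge0_integral_normal_law f (I : R) : measurable_fun setT f -> (forall x, 0 <= f x) ->
  (v == 0 -> f m = I) ->
  (v != 0 -> (\int[mu]_x (f x * normal_pdf m (Num.sqrt v) x)%:E = I%:E)%E) ->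
  (\int[P]_w (f (X w))%:E = I%:E)%E.
Proof.
move=> mf f0 I0 I1; have mf' : measurable_fun setT (EFin \o f) by exact/measurable_EFinP.
have H := @ge0_integral_pushforward _ _ _ (measurableTypeR R) R X mX P setT (EFin \o f) measurableT mf'.
rewrite preimage_setT in H; rewrite (_ : (fun w => (f (X w))%:E) = (EFin \o f) \o X)// -H; last first.
  by move=> x _; rewrite lee_fin.
have [v0|v0] := boolP (v == 0).
  rewrite (@eq_measure_integral _ (measurableTypeR R) R setT (dirac (m : measurableTypeR R))); last by move=> A mA _; rewrite [LHS]lawX// /normal_law v0.
  by rewrite integral_dirac//= diracT mul1e I0.
rewrite (@eq_measure_integral _ (measurableTypeR R) R setT (normal_prob m (Num.sqrt v))).
  by rewrite ge0_integral_normal_prob// I1.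
by move=> A mA _; rewrite [LHS]lawX// /normal_law (negbTE v0).
Qed.

Let s0 : v != 0 -> Num.sqrt v != 0.
Proof. by move=> v0; rewrite gt_eqF// sqrtr_gt0 lt_neqAle eq_sym v0. Qed.

Let mpow (b : R) k : measurable_fun setT (fun x : R => (x + b) ^+ k).
Proof.
apply: continuous_measurable_fun => x.
exact: (continuous_derivable (is_derive1X k (is_derive1_shift b x))).
Qed.

Lemma normal_law_moment2 : (\int[P]_w ((X w - m) ^+ 2)%:E = v%:E)%E.
Proof.
apply: (@ge0_integral_normal_law (fun x => (x - m) ^+ 2)).
- exact: mpow.
- by move=> x; exact: sqr_ge0.
- by move=> /eqP ->; rewrite subrr expr0n.
- by move=> v0; rewrite normal_moment2 ?s0// sqr_sqrtr.
Qed.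

Lemma normal_law_moment2_shift : (\int[P]_w ((X w - m + 1) ^+ 2)%:E = (v + 1)%:E)%E.
Proof.
apply: (@ge0_integral_normal_law (fun x => (x - m + 1) ^+ 2)).
- by under eq_fun do rewrite -addrA; exact: mpow.
- by move=> x; exact: sqr_ge0.
- by move=> /eqP ->; rewrite subrr !add0r expr1n.
- by move=> v0; rewrite normal_moment2_shift ?s0// sqr_sqrtr.
Qed.

Lemma normal_law_moment4 : (\int[P]_w ((X w - m) ^+ 4)%:E = (3 * v ^+ 2)%:E)%E.
Proof.
apply: (@ge0_integral_normal_law (fun x => (x - m) ^+ 4)).
- exact: mpow.
- by move=> x; rewrite exprn_even_ge0.
- by move=> /eqP ->; rewrite subrr !expr0n mulr0.
- move=> v0; rewrite normal_moment4 ?s0//; congr (_ * _)%:E.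
  by rewrite -[in RHS](sqr_sqrtr v_ge0) -exprM.
Qed.

(* The second moments about [m] and [m - 1] determine the mean; this avoids
   integrating a function without constant sign. *)
Lemma normal_law_fourth_moment :
  P.-integrable setT (EFin \o X) -> P.-integrable setT (EFin \o (fun w => X w ^+ 2)) ->
  \int[P]_w X w = 0 ->
  P.-integrable setT (EFin \o (fun w => X w ^+ 4)) /\
  \int[P]_w (X w ^+ 4) = 3 * (\int[P]_w (X w ^+ 2)) ^+ 2.
Proof.
move=> iX iX2 X0.
have e1 : \int[P]_w (X w - m) ^+ 2 = v by rewrite /Rintegral normal_law_moment2.
have e2 : \int[P]_w (X w - m + 1) ^+ 2 = v + 1 by rewrite /Rintegral normal_law_moment2_shift.
(* With mean zero the two identities read [E X^2 + m^2 = v] and [E X^2 + (1 - m)^2 = v + 1]; their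
   difference leaves [m = 0]. *)
have m0 : m = 0.
  rewrite (integrable_affine_sqr (- m) iX iX2 X0) in e1.
  have e3 := integrable_affine_sqr (- m + 1) iX iX2 X0.
  rewrite (_ : (fun w => (X w + (- m + 1)) ^+ 2) = fun w => (X w - m + 1) ^+ 2) in e3; last first.
    by apply/funext => w; rewrite addrA.
  by rewrite e2 in e3; nra.
have e4 := normal_law_moment4; rewrite m0 in e1 e4.
have E4 : (\int[P]_w (X w ^+ 4)%:E = (3 * v ^+ 2)%:E)%E.
  by rewrite -e4; apply: eq_integral => w _; rewrite subr0.
have E2 : \int[P]_w (X w ^+ 2) = v.
  by rewrite -e1; apply: eq_Rintegral => w _; rewrite subr0.
split; last by rewrite E2 /Rintegral E4.
apply/integrableP; split.
  by apply/measurable_EFinP; exact: measurable_funX.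
under eq_integral do rewrite /= ger0_norm ?exprn_even_ge0//.
by rewrite E4 ltry.
Qed.

End Law.

End NormalLaw.

(** * A strong law along squares *)

Section StrongLaw.
Variable R : realType.

Lemma sqrt_floor (n : nat) : exists m, (m ^ 2 <= n < m.+1 ^ 2)%N.
Proof.
elim: n => [|n [m /andP[h1 h2]]]; first by exists 0%N.
have [h|h] := ltnP n.+1 (m.+1 ^ 2); first by exists m; rewrite h (leqW h1).
exists m.+1; rewrite h /=; move: h2; rewrite !expnS !expn0 !muln1 => h2.
lia.
Qed.

(** Between consecutive squares, monotonicity squeezes the mean between its values at the two
    squares, up to the factor [((m + 1) / (m + 2))^2] or its inverse, both tending to [1]. *)
Lemma monotone_mean_cvg (S : nat -> R) (v : R) :
  (forall m n, (m <= n)%N -> S m <= S n) -> (forall n, 0 <= S n) ->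
  S (m.+1 ^ 2)%N / (m.+1 ^ 2)%:R @[m --> \oo] --> v ->
  S n / n%:R @[n --> \oo] --> v.
Proof.
move=> Smono S0 Sv.
have r1 : m.+1%:R / m.+2%:R @[m --> \oo] --> (1 : R).
  rewrite (_ : (fun m => _) = fun m => 1 - harmonic m.+1); last first.
    apply/funext => m; rewrite /harmonic/= -[m.+2%:R]natr1.
    have : m.+1%:R + 1 != 0 :> R by rewrite natr1.
    by move: (m.+1%:R) => x x0; field.
  rewrite -[X in _ --> X]subr0; apply: cvgB; first exact: cvg_cst.
  by have := @cvg_harmonic R; rewrite -(cvg_shiftS (@harmonic R)).
have lo : S (m.+1 ^ 2)%N / (m.+1 ^ 2)%:R * (m.+1%:R / m.+2%:R) ^+ 2 @[m --> \oo] --> v.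
  rewrite -[X in _ --> X]mulr1; apply: cvgM; first exact: Sv.
  by rewrite -[X in _ --> X](expr1n R 2); apply: cvgM.
have up : S (m.+2 ^ 2)%N / (m.+2 ^ 2)%:R * (m.+1%:R / m.+2%:R) ^- 2 @[m --> \oo] --> v.
  rewrite -[X in _ --> X]mulr1; apply: cvgM.
    by have := Sv; rewrite -(cvg_shiftS (fun m => S (m.+1 ^ 2)%N / (m.+1 ^ 2)%:R)).
  rewrite -[X in _ --> X](@invr1 R); apply: cvgV; first exact: oner_neq0.
  by rewrite -[X in _ --> X](expr1n R 2); apply: cvgM.
apply/cvgrPdist_le => e e0.
move/cvgrPdist_le: lo => /(_ e e0)[N1 _ H1].
move/cvgrPdist_le: up => /(_ e e0)[N2 _ H2].
exists ((maxn N1 N2).+1 ^ 2)%N => // n /= Nn.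
have [m /andP[mn nm]] := sqrt_floor n.
have mN : (maxn N1 N2 < m)%N.
  rewrite ltnNge; apply/negP => mN; move: (leq_ltn_trans Nn nm).
  by rewrite ltn_exp2r// ltnS ltnNge mN.
case: m mN mn nm => [//|m] mN mn nm.
have {}H1 := H1 m (leq_trans (leq_maxl _ _) mN).
have {}H2 := H2 m (leq_trans (leq_maxr _ _) mN).
rewrite /= in H1 H2.
have n0 : 0 < n%:R :> R by rewrite ltr0n (leq_trans _ mn)// expn_gt0.
have a0 : m.+1%:R != 0 :> R by rewrite pnatr_eq0.
have b0 : m.+2%:R != 0 :> R by rewrite pnatr_eq0.
have le1 : S (m.+1 ^ 2)%N / (m.+1 ^ 2)%:R * (m.+1%:R / m.+2%:R) ^+ 2 <= S n / n%:R.
  have -> : S (m.+1 ^ 2)%N / (m.+1 ^ 2)%:R * (m.+1%:R / m.+2%:R) ^+ 2 = S (m.+1 ^ 2)%N / (m.+2 ^ 2)%:R.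
    by rewrite !natrX; move: a0 b0; move: (m.+1%:R) (m.+2%:R) => a b a0 b0; field; rewrite a0 b0.
  apply: ler_pM => //; first exact: Smono.
  by rewrite lef_pV2 ?posrE// ?ltr0n ?expn_gt0// ler_nat ltnW.
have le2 : S n / n%:R <= S (m.+2 ^ 2)%N / (m.+2 ^ 2)%:R * (m.+1%:R / m.+2%:R) ^- 2.
  have -> : S (m.+2 ^ 2)%N / (m.+2 ^ 2)%:R * (m.+1%:R / m.+2%:R) ^- 2 = S (m.+2 ^ 2)%N / (m.+1 ^ 2)%:R.
    by rewrite !natrX; move: a0 b0; move: (m.+1%:R) (m.+2%:R) => a b a0 b0; field; rewrite a0 b0.
  apply: ler_pM => //; first by apply: Smono; exact: ltnW.
  by rewrite lef_pV2 ?posrE// ?ltr0n ?expn_gt0// ler_nat.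
have aux (a b x : R) : `|v - a| <= e -> `|v - b| <= e -> a <= x -> x <= b -> `|v - x| <= e.
  by rewrite !ler_norml => /andP[h1 h2] /andP[h3 h4] h5 h6; apply/andP; split; lra.
exact: aux H1 H2 le1 le2.
Qed.

Lemma sum_inv_sqr_le N : \sum_(0 <= m < N) (m.+1 ^ 2)%:R^-1 <= 2 :> R.
Proof.
suff H n : \sum_(0 <= m < n.+1) (m.+1 ^ 2)%:R^-1 <= 2 - n.+1%:R^-1 :> R.
  case: N => [|N]; first by rewrite big_geq.
  by apply: (le_trans (H N)); rewrite lerBlDr lerDl invr_ge0.
elim: n => [|n IH]; first by rewrite big_nat1 invr1; lra.
rewrite big_nat_recr//=; apply: (le_trans (lerD IH (lexx _))).
have x0 : 0 < n.+1%:R :> R by rewrite ltr0n.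
rewrite natrX -[n.+2%:R]natr1; move: (n.+1%:R) x0 => x x0.
have x1 : 0 < x + 1 by rewrite addr_gt0.
have -> : 2 - (x + 1)^-1 = 2 - x^-1 + (x * (x + 1))^-1 by field; rewrite !gt_eqF.
by rewrite lerD2l lef_pV2 ?posrE ?exprn_gt0 ?mulr_gt0// expr2 ler_pM2r// lerDl.
Qed.

Variables (disp : measure_display) (Omega : measurableType disp) (P : probability Omega R).

(** Summable integrals make the series integrable, hence almost everywhere finite, so its terms tend
    to [0]. *)
Lemma ae_cvg0_of_integrals (D : nat -> Omega -> R) (K : R) :
  (forall n w, 0 <= D n w) -> (forall n, measurable_fun setT (D n)) ->
  (forall n, (\int[P]_w (D n w)%:E <= (K / (n.+1 ^ 2)%:R)%:E)%E) ->
  {ae P, forall w, D n w @[n --> \oo] --> (0 : R)}.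
Proof.
move=> D0 mD DK.
have mDE n : measurable_fun setT (EFin \o D n) by exact/measurable_EFinP.
have D0E n w : (0 <= (D n w)%:E)%E by rewrite lee_fin.
have IS : (\int[P]_w (\sum_(n <oo) (D n w)%:E) < +oo)%E.
  rewrite (@integral_nneseries _ _ _ P setT measurableT (fun n w => (D n w)%:E))//.
  apply: (@le_lt_trans _ _ (2 * `|K|)%:E); last exact: ltry.
  apply: lime_le; first by apply: is_cvg_nneseries => n _ _; exact: integral_ge0.
  apply: nearW => N.
  apply: (@le_trans _ _ (\sum_(0 <= n < N) (K / (n.+1 ^ 2)%:R)%:E)%E).
    by apply: lee_sum => n _; exact: DK.
  rewrite sumEFin lee_fin -mulr_sumr.
  have s0 : 0 <= \sum_(0 <= m < N) (m.+1 ^ 2)%:R^-1 :> R.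
    by apply: sumr_ge0 => i _; rewrite invr_ge0.
  apply: (@le_trans _ _ (`|K| * \sum_(0 <= m < N) (m.+1 ^ 2)%:R^-1)).
    by rewrite ler_wpM2r// ler_norm.
  by rewrite mulrC ler_wpM2r// sum_inv_sqr_le.
have iS : P.-integrable setT (fun w => \sum_(n <oo) (D n w)%:E)%E.
  apply/integrableP; split.
    by apply: ge0_emeasurable_sum => [k w _ _|k _]; [exact: D0E|exact: mDE].
  by under eq_integral do rewrite gee0_abs ?nneseries_ge0//.
have := integrable_ae measurableT iS; apply: filterS => w /(_ I) Sfin.
apply: cvg_series_cvg_0; apply: nondecreasing_is_cvgn.
  by apply: nondecreasing_series => n _ _; exact: D0.
exists (fine (\sum_(n <oo) (D n w)%:E)%E) => _ [N _ <-].
rewrite -lee_fin fineK// /series/= -sumEFin.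
exact: nneseries_lim_ge.
Qed.

(** The mean of [n] terms has variance at most [K / n], which is summable along the squares though
    not along all [n]; the nonnegativity of the [Y k] then fills the gaps. *)
Lemma strong_law (Y : nat -> Omega -> R) (C : nat -> nat -> R) (y : nat -> R) (v K : R) :
  (forall k w, 0 <= Y k w) -> (forall k, measurable_fun setT (Y k)) ->
  (forall j k, P.-integrable setT (EFin \o (fun w => (Y j w - y j) * (Y k w - y k))) /\
     \int[P]_w ((Y j w - y j) * (Y k w - y k)) = C j k) ->
  (forall n, \sum_(j < n) \sum_(k < n) C j k <= K * n%:R) ->
  y n @[n --> \oo] --> v ->
  {ae P, forall w, (\sum_(k < n) Y k w) / n%:R @[n --> \oo] --> v}.
Proof.
move=> Y0 mY YC CK yv.
pose D m w := ((\sum_(k < m.+1 ^ 2) (Y k w - y k)) / (m.+1 ^ 2)%:R) ^+ 2.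
have DE m w : D m w = (m.+1 ^ 2)%:R ^- 2 * (\sum_(j < m.+1 ^ 2) 1 * (\sum_(k < m.+1 ^ 2) 1 * ((Y j w - y j) * (Y k w - y k)))).
  rewrite /D exprMn -exprVn mulrC; congr (_ * _); rewrite expr2 mulr_suml.
  apply: eq_bigr => j _; rewrite mul1r mulr_sumr; apply: eq_bigr => k _.
  by rewrite mul1r.
have Dint m : P.-integrable setT (EFin \o D m) /\ \int[P]_w D m w <= K / (m.+1 ^ 2)%:R.
  set n := (m.+1 ^ 2)%N in DE *.
  have h1 (j : 'I_n) := @Rintegral_sumZ R _ _ P setT n (fun=> 1) _ measurableT (fun k : 'I_n => proj1 (YC j k)).
  have [h2 h3] := @Rintegral_sumZ R _ _ P setT n (fun=> 1) _ measurableT (fun j => proj1 (h1 j)).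
  have [h4 h5] := @Rintegral_sumZ R _ _ P setT 1 (fun=> n%:R ^- 2) _ measurableT (fun=> h2).
  have Dfun : D m = (fun w => \sum_(i < 1) n%:R ^- 2 * \sum_(j < n) 1 * (\sum_(k < n) 1 * ((Y j w - y j) * (Y k w - y k)))).
    by apply/funext => w; rewrite DE big_ord1.
  rewrite Dfun; split; first exact: h4.
  rewrite h5 big_ord1 h3.
  have n0 : 0 < n%:R :> R by rewrite ltr0n expn_gt0.
  have -> : K / n%:R = n%:R ^- 2 * (K * n%:R) by field; rewrite gt_eqF.
  rewrite ler_pM2l ?invr_gt0 ?exprn_gt0//; apply: le_trans (CK n).
  apply: ler_sum => j _; rewrite mul1r (proj2 (h1 j)); apply: ler_sum => k _.
  by rewrite mul1r (proj2 (YC j k)).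
have D0 m w : 0 <= D m w by exact: sqr_ge0.
have : {ae P, forall w, D n w @[n --> \oo] --> (0 : R)}.
  apply: (@ae_cvg0_of_integrals D K) => // m.
    by apply/measurable_EFinP; case/integrableP: (proj1 (Dint m)).
  have [i1 le1] := Dint m; rewrite -[leLHS]fineK; first by rewrite lee_fin.
  by apply: (integrable_fin_num _ i1).
apply: filterS => w Dw.
apply: (@monotone_mean_cvg (fun n => \sum_(k < n) Y k w)).
- move=> a b ab; rewrite -(subnKC ab) big_split_ord/= lerDl.
  by apply: sumr_ge0 => i _.
- by move=> n; apply: sumr_ge0.
have mean : (\sum_(k < m.+1 ^ 2) y k) / (m.+1 ^ 2)%:R @[m --> \oo] --> v.
  have h := cesaro yv.
  (* [arithmetic_mean y k] averages [k + 1] terms, hence the predecessor. *)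
  have : arithmetic_mean y ((m.+1 ^ 2).-1) @[m --> \oo] --> v.
    apply: (cvg_comp _ _ _ h); move=> A [N _ HN]; exists N => // m /= Nm; apply: HN => /=.
    by rewrite (leq_trans Nm)// leq_addr.
  apply: cvg_trans; apply: near_eq_cvg; apply: nearW => m.
  rewrite /arithmetic_mean; have : (0 < m.+1 ^ 2)%N by rewrite expn_gt0.
  by move: (m.+1 ^ 2)%N => [//|k] _; rewrite /= mulrC /series/= big_mkord.
have dev : (\sum_(k < m.+1 ^ 2) (Y k w - y k)) / (m.+1 ^ 2)%:R @[m --> \oo] --> (0 : R).
  apply/norm_cvg0P; rewrite (_ : (fun m => _) = (fun m => Num.sqrt (D m w))).
    by rewrite -[X in _ --> X](@sqrtr0 R); apply: continuous_cvg => //; exact: sqrt_continuous.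
  by apply/funext => m; rewrite /D sqrtr_sqr.
have dm : (\sum_(k < m.+1 ^ 2) (Y k w - y k)) / (m.+1 ^ 2)%:R + (\sum_(k < m.+1 ^ 2) y k) / (m.+1 ^ 2)%:R
    @[m --> \oo] --> 0 + v by exact: cvgD.
rewrite add0r in dm; apply: cvg_trans dm; apply: near_eq_cvg; apply: nearW => m.
by rewrite /= -mulrDl sumrB subrK.
Qed.

End StrongLaw.

(** * Almost sure convergence of the variance estimator *)

Section GaussianEnergy.
Variables (R : realType) (d : nat) (nu rho : R) (s : nat -> 'rV[R]_d) (s0 : 'rV[R]_d).
Hypothesis nu_gt0 : 0 < nu.
Hypothesis rho_ge0 : 0 <= rho.
Local Notation pt := (site s s0).
Hypothesis site_inj : injective pt.
Hypothesis site_box : forall i l, `|pt i 0 l| <= rho.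
Variables th0 th1 : R * R.
Hypotheses (a0_gt0 : 0 < th0.1) (b0_gt0 : 0 < th0.2).
Hypotheses (a1_gt0 : 0 < th1.1) (b1_gt0 : 0 < th1.2).
Variable sg : R.
Hypothesis sg_gt0 : 0 < sg.
Variables (disp : measure_display) (Omega : measurableType disp) (P : probability Omega R).
Variables (D : set 'rV[R]_d) (Z : 'rV[R]_d -> {RV P >-> R}).
Hypothesis site_D : forall i, D (pt i).
Hypothesis gp : gaussian_process D Z (fun=> 0)
  (fun t u => CH_cov nu th0.1 th0.2 sg (eucl_dist t u)).

Local Notation form th := (pform pt (ch nu th)).
Local Notation z := (zX R).

Definition sample (p : {poly R}) (w : Omega) : R := pev (fun i => Z (pt i) w) p.

Let Zcov i j : covariance P (Z (pt i)) (Z (pt j)) = (sg * ch nu th0 (pt i) (pt j))%:E.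
Proof.
have [_ _ covZ] := gp; rewrite covZ//; congr EFin.
by rewrite /ch /CH_corr /CH_cov mul1r !mulrA.
Qed.

Let ZL2 i : (Z (pt i) : Omega -> R) \in Lfun P 2%:E.
Proof.
have [_ EZ _] := gp; apply: (mean0_Lfun2 _ (Zcov i i)).
exact: EZ.
Qed.

Let Pfin : P setT \is a fin_num. Proof. exact: fin_num_measure. Qed.

Let ZL1 i : (Z (pt i) : Omega -> R) \in Lfun P 1.
Proof. exact: (Lfun_subset12 Pfin). Qed.

Let Zint i : P.-integrable setT (EFin \o Z (pt i)) /\ \int[P]_w Z (pt i) w = 0.
Proof.
split; first exact/Lfun1_integrable.
have [_ EZ _] := gp; have := EZ _ (site_D i).
by rewrite expectation.unlock /Rintegral => ->.
Qed.

Let ZZint i j : P.-integrable setT (EFin \o (fun w => Z (pt i) w * Z (pt j) w)) /\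
  \int[P]_w (Z (pt i) w * Z (pt j) w) = sg * ch nu th0 (pt i) (pt j).
Proof.
have ZZ1 := Lfun2_mul_Lfun1 (ZL2 i) (ZL2 j).
split; first exact/Lfun1_integrable.
have [_ EZ _] := gp; have := covarianceE (ZL1 i) (ZL1 j) ZZ1.
rewrite Zcov !EZ// mule0 sube0 expectation.unlock => e.
by rewrite /Rintegral -e.
Qed.

Lemma sample_integrable p :
  P.-integrable setT (EFin \o sample p) /\ \int[P]_w sample p w = 0.
Proof.
have [h1 h2] := @Rintegral_sumZ R _ _ P setT _ (fun i : 'I_(size p) => p`_i) _ measurableT
  (fun i => proj1 (Zint i)).
by split; [exact: h1|rewrite h2 big1// => i _; rewrite (proj2 (Zint i)) mulr0].
Qed.

Lemma sample_mul p q :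
  P.-integrable setT (EFin \o (fun w => sample p w * sample q w)) /\
  \int[P]_w (sample p w * sample q w) = sg * form th0 p q.
Proof.
have h1 (i : 'I_(size p)) := @Rintegral_sumZ R _ _ P setT _ (fun j : 'I_(size q) => q`_j) _
  measurableT (fun j => proj1 (ZZint i j)).
have [h2 h3] := @Rintegral_sumZ R _ _ P setT _ (fun i : 'I_(size p) => p`_i) _ measurableT
  (fun i => proj1 (h1 i)).
have E : (fun w => sample p w * sample q w) =
    fun w => \sum_(i < size p) p`_i * \sum_(j < size q) q`_j * (Z (pt i) w * Z (pt j) w).
  apply/funext => w; rewrite /sample /pev mulr_suml; apply: eq_bigr => i _.
  rewrite -mulrA; congr (_ * _); rewrite mulr_sumr; apply: eq_bigr => j _.
  by rewrite mulrCA.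
rewrite E; split; first exact: h2.
rewrite h3 /pform /pev mulr_sumr; apply: eq_bigr => i _.
rewrite (proj2 (h1 i)) [RHS]mulrCA; congr (_ * _); rewrite mulr_sumr; apply: eq_bigr => j _.
by rewrite (proj2 (ZZint i j)) mulrCA.
Qed.

Lemma measurable_sample p : measurable_fun setT (sample p).
Proof.
by apply/measurable_EFinP; case/integrableP: (proj1 (sample_integrable p)).
Qed.

Lemma sample_fourth p : P.-integrable setT (EFin \o (fun w => sample p w ^+ 4)) /\
  \int[P]_w (sample p w ^+ 4) = 3 * (sg * form th0 p p) ^+ 2.
Proof.
have [i1 e1] := sample_integrable p; have [i2 e2] := sample_mul p p.
rewrite -e2; under [X in 3 * X ^+ 2]eq_Rintegral do rewrite -expr2.
rewrite (_ : (fun w => sample p w * sample p w) = fun w => sample p w ^+ 2) in i2; last first.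
  by apply/funext => w; rewrite expr2.
have [lawZ _ _] := gp.
have [m [v [v0 law]]] := lawZ (size p) (fun i => pt i) (fun i => p`_i) (fun i => site_D i).
exact: (normal_law_fourth_moment (measurable_sample p) v0 law i1 i2 e1).
Qed.

Lemma sampleD p q w : sample (p + q) w = sample p w + sample q w.
Proof. exact: linD (lin_pev _). Qed.

Lemma sampleB p q w : sample (p - q) w = sample p w - sample q w.
Proof. exact: linB (lin_pev _). Qed.

(** Isserlis' formula by polarization: [12 p^2 q^2 = (p + q)^4 + (p - q)^4 - 2 p^4 - 2 q^4], so that
    fourth moments of single normal variables suffice. *)
Lemma sample_sqr_mul p q :
  P.-integrable setT (EFin \o (fun w => sample p w ^+ 2 * sample q w ^+ 2)) /\
  \int[P]_w (sample p w ^+ 2 * sample q w ^+ 2) =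
    sg ^+ 2 * (form th0 p p * form th0 q q + 2 * form th0 p q ^+ 2).
Proof.
have [i1 e1] := sample_fourth (p + q); have [i2 e2] := sample_fourth (p - q).
have [i3 e3] := sample_fourth p; have [i4 e4] := sample_fourth q.
have [i5 e5] := integrable_lincomb2 12^-1 12^-1 i1 i2.
have [i6 e6] := integrable_lincomb2 (- 6^-1) (- 6^-1) i3 i4.
have [i7 e7] := integrable_lincomb2 1 1 i5 i6.
have E : (fun w => sample p w ^+ 2 * sample q w ^+ 2) = (fun w =>
    1 * (12^-1 * sample (p + q) w ^+ 4 + 12^-1 * sample (p - q) w ^+ 4) +
    1 * (- 6^-1 * sample p w ^+ 4 + - 6^-1 * sample q w ^+ 4)).
  by apply/funext => w; rewrite sampleD sampleB; field.
rewrite E; split; first exact: i7.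
rewrite e7 e5 e6 e1 e2 e3 e4.
have fs := form_sym s s0 nu_gt0 a0_gt0 b0_gt0.
rewrite (B_subsub (pform_lin pt (ch nu th0)) fs).
have -> : form th0 (p + q) (p + q) = form th0 p p + 2 * form th0 p q + form th0 q q.
  rewrite (linD _ _ (lin_Br (pform_lin pt (ch nu th0)) fs (p + q))).
  rewrite !(linD _ _ (lin_Bl (pform_lin pt (ch nu th0)) _)) (fs q p).
  by ring.
by field.
Qed.

Lemma sample_cov_sqr p q :
  P.-integrable setT (EFin \o (fun w =>
    (sample p w ^+ 2 - sg * form th0 p p) * (sample q w ^+ 2 - sg * form th0 q q))) /\
  \int[P]_w ((sample p w ^+ 2 - sg * form th0 p p) * (sample q w ^+ 2 - sg * form th0 q q)) =
    2 * (sg * form th0 p q) ^+ 2.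
Proof.
have [i1 e1] := sample_sqr_mul p q; have [ip ep] := sample_mul p p.
have [iq eq] := sample_mul q q; have [ic ec] := integrable_prob_cst P 1.
set a := sg * form th0 p p; set b := sg * form th0 q q.
have [i2 e2] := integrable_lincomb2 (- b) (- a) ip iq.
have [i3 e3] := integrable_lincomb2 1 (a * b) i2 ic.
have [i4 e4] := integrable_lincomb2 1 1 i1 i3.
have E : (fun w => (sample p w ^+ 2 - a) * (sample q w ^+ 2 - b)) = (fun w =>
    1 * (sample p w ^+ 2 * sample q w ^+ 2) +
    1 * (1 * (- b * (sample p w * sample p w) + - a * (sample q w * sample q w)) + a * b * 1)).
  by apply/funext => w; ring.
rewrite E; split; first exact: i4.
by rewrite e4 e1 e3 e2 ep eq ec /a /b; ring.
Qed.

Let e n := innov (form th1) z n.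

Let e_gt0 n : 0 < form th1 (e n) (e n).
Proof.
exact: (innov_gt0 (form_ge0 s s0 nu_gt0 a1_gt0 b1_gt0) (form_free nu_gt0 site_inj a1_gt0 b1_gt0)).
Qed.

(** Innovations of the fitted model [th1], normalized in its own form, while their samples follow
    [th0]: they are uncorrelated for [th1] only. *)
Let g n : {poly R} := (Num.sqrt (form th1 (e n) (e n)))^-1 *: e n.

Let formZZ th (a b : R) p q : 0 < th.1 -> 0 < th.2 ->
  form th (a *: p) (b *: q) = a * b * form th p q.
Proof.
move=> a0 b0; rewrite (linZ _ _ (lin_Bl (pform_lin pt (ch nu th)) _)).
rewrite (linZ _ _ (lin_Br (pform_lin pt (ch nu th)) (form_sym s s0 nu_gt0 a0 b0) _)).
by rewrite mulrA.
Qed.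

Let g_orthonormal j k : form th1 (g j) (g k) = (j == k)%:R.
Proof.
have fs := form_sym s s0 nu_gt0 a1_gt0 b1_gt0.
rewrite /g formZZ//; have [->|jk] := eqVneq j k.
  rewrite -invfM -expr2 sqr_sqrtr ?mulVf ?gt_eqF ?e_gt0//; exact: ltW (e_gt0 _).
have orth i l : (i < l)%N -> form th1 (e i) (e l) = 0.
  exact: (innov_orth (pform_lin pt (ch nu th1)) fs (form_free nu_gt0 site_inj a1_gt0 b1_gt0)).
case: (ltngtP j k) jk => // h _; first by rewrite (orth _ _ h) mulr0.
by rewrite fs (orth _ _ h) mulr0.
Qed.

Let g_sqr n w : sample (g n) w ^+ 2 = sample (e n) w ^+ 2 / form th1 (e n) (e n).
Proof.
rewrite /sample (linZ _ _ (lin_pev _)) exprMn mulrC exprVn sqr_sqrtr//; exact: ltW (e_gt0 _).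
Qed.

Let form_g n : form th0 (g n) (g n) = form th0 (e n) (e n) / form th1 (e n) (e n).
Proof.
by rewrite (formZZ _ _ _ _ a0_gt0 b0_gt0) -invfM -expr2 (sqr_sqrtr (ltW (e_gt0 n))) mulrC.
Qed.

Let cov_bound : exists2 K : R, 0 <= K & forall n,
  \sum_(j < n) \sum_(k < n) 2 * (sg * form th0 (g j) (g k)) ^+ 2 <= K * n%:R.
Proof.
(* The parameters are passed in exchanged order: the true form is to be dominated by the fitted
   one. *)
have [L L0 HL] := ch_dominated d nu_gt0 a1_gt0 b1_gt0 a0_gt0 b0_gt0 rho_ge0.
have th0E : (th0.1, th0.2) = th0 by case: (th0).
have th1E : (th1.1, th1.2) = th1 by case: (th1).
rewrite th0E th1E in HL.
have {}HL p : form th0 p p <= L * form th1 p p.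
  rewrite (pform_qform _ (ch nu th0)) (pform_qform _ (ch nu th1)).
  by apply: HL => a i; exact: site_box.
exists (2 * sg ^+ 2 * L ^+ 2) => [|n].
  exact: mulr_ge0 (mulr_ge0 (ler0n _ _) (sqr_ge0 _)) (sqr_ge0 _).
have row := orthonormal_row_bound (pform_lin pt (ch nu th0))
  (form_sym s s0 nu_gt0 a0_gt0 b0_gt0) (form_ge0 s s0 nu_gt0 a0_gt0 b0_gt0)
  (pform_lin pt (ch nu th1)) (form_sym s s0 nu_gt0 a1_gt0 b1_gt0) HL g_orthonormal.
apply: (@le_trans _ _ (\sum_(j < n) 2 * sg ^+ 2 * L ^+ 2)).
  apply: ler_sum => j _; rewrite (eq_bigr (fun k : 'I_n => 2 * sg ^+ 2 * form th0 (g j) (g k) ^+ 2)).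
    rewrite -mulr_sumr ler_wpM2l ?row//; exact: mulr_ge0 (ler0n _ _) (sqr_ge0 _).
  by move=> k _; rewrite exprMn mulrA.
by rewrite sumr_const card_ord mulr_natr.
Qed.

(** For a fixed outcome, evaluation along the path is a linear functional, and [energy_sum] asks for
    linearity alone; it turns the estimator into a mean of squares to which [strong_law] applies. *)
Lemma sigma2_hat_cvg : {ae P, forall w,
  sigma2_hat nu th1 s (\col_(i < n) Z (s i) w) @[n --> \oo] -->
    sg * (micro nu th0.1 th0.2 / micro nu th1.1 th1.2)}.
Proof.
have [K K0 HK] := cov_bound.
pose y n := sg * form th0 (g n) (g n).
have ycvg : y n @[n --> \oo] --> sg * (micro nu th0.1 th0.2 / micro nu th1.1 th1.2).
  apply: cvgM; first exact: cvg_cst.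
  under eq_fun do rewrite form_g.
  apply: (form_ratio_cvg nu_gt0 rho_ge0 site_box a1_gt0 b1_gt0 a0_gt0 b0_gt0 e_gt0).
  move=> m eta eta0.
  exact: (innov_pev_vanish nu_gt0 rho_ge0 site_inj site_box a1_gt0 b1_gt0 m eta0).
have := @strong_law R _ _ P (fun k w => sample (g k) w ^+ 2)
  (fun j k => 2 * (sg * form th0 (g j) (g k)) ^+ 2) y _ K _ _ _ HK ycvg.
move=> H; have {}H := H (fun k w => sqr_ge0 _)
  (fun k => measurable_funX 2 (measurable_sample (g k)))
  (fun j k => sample_cov_sqr (g j) (g k)).
apply: filterS H => w; apply: cvg_trans; apply: near_eq_cvg; apply: nearW => n.
rewrite /sigma2_hat; congr (_ / _).
have fs := form_sym s s0 nu_gt0 a1_gt0 b1_gt0.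
have := energy_sum (pform_lin pt (ch nu th1)) fs (form_ge0 s s0 nu_gt0 a1_gt0 b1_gt0)
  (form_free nu_gt0 site_inj a1_gt0 b1_gt0) n (lin_pev (fun i => Z (pt i) w)).
rewrite /energy gram_corr_mx.
have -> : vals z n (pev (fun i => Z (pt i) w)) = \col_(i < n) Z (s i) w.
  by apply/matrixP => i j; rewrite !mxE pev_Xn.
by move=> ->; apply: eq_bigr => k _; rewrite g_sqr.
Qed.

End GaussianEnergy.

(** * Geometry of the sites and assembly of the three limits *)

Section Main.
Variables (R : realType) (d : nat).

Lemma bounded_set_box (D : set 'rV[R]_d) : bounded_set D ->
  exists2 rho : R, 0 <= rho & forall t, D t -> forall l, `|t 0 l| <= rho.
Proof.
move=> [M [_ HM]]; have MM : M < Num.max M 0 + 1.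
  by rewrite (@le_lt_trans _ _ (Num.max M 0)) ?ltrDl// le_max lexx.
exists (Num.max M 0 + 1).
  by rewrite addr_ge0// le_max lexx orbT.
move=> t Dt l; apply: le_trans (HM _ MM t Dt).
rewrite /Num.norm/= mx_normrE.
exact: (le_bigmax _ (fun ij : 'I_1 * 'I_d => `|t ij.1 ij.2|) (0, l)).
Qed.

Lemma limit_point_sqdist (s : nat -> 'rV[R]_d) (s0 : 'rV[R]_d) : limit_point (range s) s0 ->
  forall e : R, 0 < e -> exists k, sqdist s0 (s k) < e.
Proof.
(* The squared distance has [d] terms, each at most [del^2 <= del]; the denominator [d + 1] gives
   the strict inequality. *)
move=> lim e e0; pose del : R := Num.min 1 (e / d.+1%:R).
have d1 : 0 < d.+1%:R :> R by rewrite ltr0n.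
have del0 : 0 < del by rewrite lt_min ltr01 divr_gt0.
have [_ [_ [k _ <-] []]] := lim _ (nbhsx_ballx s0 del del0).
move=> _ H; exists k.
apply: (@le_lt_trans _ _ (\sum_(i < d) del)).
  apply: ler_sum => i _; have := H 0 i; rewrite /ball/= => /ltW h.
  rewrite -real_normK ?num_real// expr2 -[leRHS]mulr1; apply: ler_pM => //.
  by rewrite (le_trans h)// ge_min lexx.
rewrite sumr_const card_ord -[_ *+ d]mulr_natr.
apply: (@lt_le_trans _ _ (del * d.+1%:R)); first by rewrite ltr_pM2l// ltr_nat.
by rewrite -ler_pdivlMr// ge_min lexx orbT.
Qed.

Lemma site_injective (s : nat -> 'rV[R]_d) (s0 : 'rV[R]_d) :
  injective s -> ~ range s s0 -> injective (site s s0).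
Proof.
move=> sinj s0s [|i] [|j]//=; [move=> h|move=> h|by move=> /sinj ->].
  by exfalso; apply: s0s; exists j.
by exfalso; apply: s0s; exists i.
Qed.

End Main.

Theorem theorem6 (R : realType) (d : nat) (hd : (1 <= d <= 3)%N)
  (D : set 'rV[R]_d) (hD : bounded_set D)
  (nu alpha0 beta0 sigma2_0 alpha1 beta1 sigma2_1 : R)
  (hnu : 0 < nu)
  (ha0 : 0 < alpha0) (hb0 : 0 < beta0) (hs0 : 0 < sigma2_0)
  (ha1 : 0 < alpha1) (hb1 : 0 < beta1) (hs1 : 0 < sigma2_1)
  (s : nat -> 'rV[R]_d) (hsD : forall i, D (s i)) (hsinj : injective s)
  (s0 : 'rV[R]_d) (hs0D : D s0) (hs0s : ~ range s s0)
  (hs0lim : limit_point (range s) s0) :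
  [/\
    (* (a) *)
    (fun n : nat =>
       pred_err_var nu (alpha0, beta0) sigma2_0 (alpha1, beta1) s s0 n /
       pred_err_var nu (alpha0, beta0) sigma2_0 (alpha0, beta0) s s0 n)
      @ \oo --> (1 : R),
    (* (b) *)
    sigma2_0 * beta0 `^ (- (2 * nu)) * Gamma (nu + alpha0) / Gamma alpha0 =
    sigma2_1 * beta1 `^ (- (2 * nu)) * Gamma (nu + alpha1) / Gamma alpha1 ->
    (fun n : nat =>
       pred_err_var nu (alpha1, beta1) sigma2_1 (alpha1, beta1) s s0 n /
       pred_err_var nu (alpha0, beta0) sigma2_0 (alpha1, beta1) s s0 n)
      @ \oo --> (1 : R) &
    (* (c) *)
    forall (disp : measure_display) (Omega : measurableType disp)
      (P0 : probability Omega R) (Z : 'rV[R]_d -> {RV P0 >-> R}),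
      gaussian_process D Z (fun=> 0)
        (fun t u => CH_cov nu alpha0 beta0 sigma2_0 (eucl_dist t u)) ->
      {ae P0, forall w : Omega,
        (fun n : nat =>
           pred_err_var nu (alpha1, beta1)
             (sigma2_hat nu (alpha1, beta1) s (\col_(i < n) Z (s i) w))
             (alpha1, beta1) s s0 n /
           pred_err_var nu (alpha0, beta0) sigma2_0 (alpha1, beta1) s s0 n)
          @ \oo --> (1 : R)}].
Proof.
have [rho rho0 Hrho] := bounded_set_box hD.
have inj := site_injective hsinj hs0s.
have siteD i : D (site s s0 i) by case: i.
have box i l : `|site s s0 i 0 l| <= rho by exact: Hrho.
have lim := limit_point_sqdist hs0lim.
pose th0 := (alpha0, beta0); pose th1 := (alpha1, beta1).
have k0 : 0 < micro nu th0.1 th0.2 by exact: micro_gt0.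
have k1 : 0 < micro nu th1.1 th1.2 by exact: micro_gt0.
(* The error of the predictor built with [th1], with its variance under [th] at [sigma^2 = 1]. *)
pose F th n := pform (site s s0) (ch nu th)
  (res (pform (site s s0) (ch nu th1)) (zX R) n 1)
  (res (pform (site s s0) (ch nu th1)) (zX R) n 1).
have F0 n : 0 < F th0 n by exact: (err_gt0 hnu inj (th := th0)).
have F1 n : 0 < F th1 n by exact: (err_gt0 hnu inj (th := th1)).
have ratio : F th1 n / F th0 n @[n --> \oo] --> micro nu th1.1 th1.2 / micro nu th0.1 th0.2.
  have h := err_misspecified_cvg hnu rho0 inj box lim (th0 := th0) (th1 := th1) ha0 hb0 ha1 hb1.
  have h' : (F th0 n / F th1 n)^-1 @[n --> \oo] --> (micro nu th0.1 th0.2 / micro nu th1.1 th1.2)^-1.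
    apply: cvgV; last exact: h.
    by rewrite mulf_neq0 ?invr_neq0// gt_eqF.
  rewrite invf_div in h'; apply: cvg_trans h'; apply: near_eq_cvg; apply: nearW => n.
  by rewrite invf_div.
have E th sg n : 0 < th.1 -> 0 < th.2 -> pred_err_var nu th sg th1 s s0 n = sg * F th n.
  by move=> a0 b0; exact: (pred_err_var_form s s0 hnu th1 sg n a0 b0).
(* Serves (b) and (c) together: the plugged-in variance may vary with [n], and only its limit has to
   match the parameter of the true model. It is constant in (b) and the estimate along a path in
   (c). *)
have limit (sg : nat -> R) (l : R) : sg n @[n --> \oo] --> l ->
    l * micro nu th1.1 th1.2 = sigma2_0 * micro nu th0.1 th0.2 ->
    pred_err_var nu th1 (sg n) th1 s s0 n / pred_err_var nu th0 sigma2_0 th1 s s0 n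
      @[n --> \oo] --> (1 : R).
  move=> sgl lE.
  have c : sg n / sigma2_0 * (F th1 n / F th0 n) @[n --> \oo] -->
      l / sigma2_0 * (micro nu th1.1 th1.2 / micro nu th0.1 th0.2).
    by apply: cvgM; [apply: cvgM; [exact: sgl|exact: cvg_cst]|exact: ratio].
  have l1 : l / sigma2_0 * (micro nu th1.1 th1.2 / micro nu th0.1 th0.2) = 1.
    rewrite (mulf_div l) lE divff//; exact: mulf_neq0 (lt0r_neq0 hs0) (lt0r_neq0 k0).
  rewrite l1 in c; apply: cvg_trans c; apply: near_eq_cvg; apply: nearW => n /=.
  by rewrite !E// -mulf_div.
split.
- have h := err_efficiency_cvg hnu rho0 inj box lim (th0 := th0) (th1 := th1) ha0 hb0 ha1 hb1.
  apply: cvg_trans h; apply: near_eq_cvg; apply: nearW => n /=.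
  rewrite (E th0)// (pred_err_var_form s s0 hnu th0 (th' := th0) sigma2_0 n ha0 hb0).
  by rewrite -mulf_div divff ?mul1r// gt_eqF.
- move=> match01; apply: (limit (fun=> sigma2_1)); first exact: cvg_cst.
  by rewrite /micro /= !mulrA match01.
- move=> disp Omega P0 Z gp.
  have := sigma2_hat_cvg hnu rho0 inj box (th0 := th0) (th1 := th1) ha0 hb0 ha1 hb1 siteD gp.
  apply: filterS => w sgw; apply: limit sgw _.
  by rewrite -mulrA divfK// gt_eqF.
Qed.
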